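(* Let $s\ge0$, $T>0$, $u_0\in H^s(\mathbb S)$, and let $u\in C([-T,T]:H^s(\mathbb S))$ be the corresponding solution of the periodic problem $$\partial_t u+(1-\partial_x^2)^{-1}(\partial_x u+u\,\partial_x u)=0,\qquad u(x,0)=u_0(x),\quad x\in\mathbb S.$$ Then $$u-u_0\in C^\infty\big([-T,T]:H^{(2s+1/2)^-}(\mathbb S)\big)\quad\text{if } s\in[0,1/2],$$ and $$u-u_0\in C^\infty\big([-T,T]:H^{s+1}(\mathbb S)\big)\quad\text{if } s>1/2.$$
   Context: $H^{r^-}$ means: in $H^{r'}$ for every $r'<r$. $\mathbb S=\mathbb R/\mathbb Z$, and $H^s(\mathbb S)$ is the usual $L^2$-based Sobolev space of real-valued functions. The equation is understood in the integral form $u(t)=u_0-\int_0^t\partial_x(1-\partial_x^2)^{-1}\big(u+\tfrac{u^2}{2}\big)(t')\,dt'$, where $\partial_x(1-\partial_x^2)^{-1}h=\partial_x\mathcal G*h$ (convolution on $\mathbb S$) with $\mathcal G(x)=\frac{\cosh(x-\lfloor x\rfloor-1/2)}{2\sinh(1/2)}$. It is known (Rosier-Zhang) that for every $s\ge0$, $u_0\in H^s(\mathbb S)$ and $T>0$ there is a unique solution $u\in C([-T,T]:H^s(\mathbb S))$. *)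

(* Defs.v *)
From mathcomp Require Import all_boot all_order all_algebra.
From mathcomp Require Import all_classical all_reals all_analysis.

Set Implicit Arguments.
Unset Strict Implicit.
Unset Printing Implicit Defensive.

Import Order.TTheory GRing.Theory Num.Theory.
Import numFieldNormedType.Exports.

Local Open Scope classical_set_scope.
Local Open Scope ring_scope.

(* Functions on the circle S = R/Z are functions R -> R of period 1, and an
   integral over S is an integral over [0, 1].  Elements of a Sobolev space
   H^r(S), r any real number, are real periodic distributions; functions enter
   through the embedding [distr_of]. *)

Section Distributions.
Variable R : realType.
Implicit Types (f phi psi : R -> R) (F : (R -> R) -> R) (r : R).

Local Notation mu := (@lebesgue_measure R).

Definition test_function phi : Prop :=
  periodic phi 1 /\ forall (n : nat) (x : R), derivable (derive1n n phi) x 1.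

(* The values of [F] outside the test functions are irrelevant.  The last
   clause is continuity for the Frechet topology of C^infty(S). *)
Definition periodic_distribution F : Prop :=
  (forall (a : R) phi psi, test_function phi -> test_function psi ->
     F (fun x => a * phi x + psi x) = a * F phi + F psi) /\
  exists (C : R) (N : nat), forall phi (M : R), test_function phi ->
    (forall (j : nat) (x : R), (j <= N)%N -> `|derive1n j phi x| <= M) ->
    `|F phi| <= C * M.

Definition distr_of f : (R -> R) -> R :=
  fun phi => \int[mu]_(x in `[0, 1]) (f x * phi x).

(* |F^(k)|^2, where F^(k) = F(e^{-2 i pi k x}) is the k-th complex Fourier
   coefficient of the real distribution F. *)
Definition fourier_sqr F (k : int) : R :=
  F (fun x => cos (2 * pi * k%:~R * x)) ^+ 2 +
  F (fun x => sin (2 * pi * k%:~R * x)) ^+ 2.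

Definition Hnorm r F : \bar R :=
  ((\esum_(k in [set: int])
      ((1 + (2 * pi * k%:~R) ^+ 2) `^ r * fourier_sqr F k)%:E)
   `^ 2^-1)%E.

Definition inH r F : Prop :=
  periodic_distribution F /\ (Hnorm r F < +oo)%E.

Definition L2_circle f : Prop :=
  [/\ periodic f 1, measurable_fun [set: R] f &
      mu.-integrable `[0, 1] (EFin \o (fun x => f x ^+ 2))].

End Distributions.

Section Curves.
Variable R : realType.
Implicit Types (r T t : R) (w : R -> (R -> R) -> R).

(* Curves are only considered on [-T, T]; limits at the end points are
   one-sided. *)
Definition continuous_curve r T w : Prop :=
  forall t, t \in `[- T, T] ->
    inH r (w t) /\
    Hnorm r (fun phi => w t' phi - w t phi)
      @[t' --> within `[- T, T] (nbhs t)] --> 0%E.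

Definition derivative_curve r T w w' : Prop :=
  forall t, t \in `[- T, T] ->
    Hnorm r (fun phi => (t' - t)^-1 * (w t' phi - w t phi) - w' t phi)
      @[t' --> within `[- T, T] t^'] --> 0%E.

Fixpoint Ck_curve r T (k : nat) w : Prop :=
  continuous_curve r T w /\
  if k is k'.+1 then
    exists w', derivative_curve r T w w' /\ Ck_curve r T k' w'
  else True.

Definition Cinfty_curve r T w : Prop := forall k : nat, Ck_curve r T k w.

End Curves.

Section Equation.
Variable R : realType.
Implicit Types (g h f : R -> R) (u : R -> R -> R) (s T t x : R).

Local Notation mu := (@lebesgue_measure R).

Definition coshR x : R := (expR x + expR (- x)) / 2.
Definition sinhR x : R := (expR x - expR (- x)) / 2.

Definition Gker x : R :=
  coshR (x - (Num.floor x)%:~R - 2^-1) / (2 * sinhR 2^-1).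

Definition conv_circle g h x : R :=
  \int[mu]_(y in `[0, 1]) (g (x - y) * h y).

(* [Gker] is Lipschitz and differentiable off the integers, so its pointwise
   derivative represents its distributional one; the values at integers do not
   affect the convolution. *)
Definition dxG_conv h : R -> R := conv_circle (derive1 Gker) h.

Definition oriented_integral t f : R :=
  if 0 <= t then \int[mu]_(t' in `[0, t]) f t'
  else - \int[mu]_(t' in `[t, 0]) f t'.

(* u t : R -> R is the function x |-> u(x, t).  For u in C([-T, T] : H^s),
   s >= 0, the convolution below is a continuous function of t' for every x
   (u + u^2/2 is continuous in time with values in L^1 and dx G is bounded), so
   the H^s-valued time integral may be computed pointwise in x. *)
Definition solution s T (u0 : R -> R) u : Prop :=
  [/\ forall t, t \in `[- T, T] -> L2_circle (u t),
      continuous_curve s T (fun t => distr_of (u t)) &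
      forall t, t \in `[- T, T] ->
        {ae mu, forall x, u t x = u0 x -
          oriented_integral t (fun t' =>
            dxG_conv (fun y => u t' y + u t' y ^+ 2 / 2) x)}].

End Equation.

(* Main.v *)
(** Write [A] for the operator [dx (1 - dx^2)^-1] and [B(v, w) = A(v w)], so
    that a solution satisfies [u' = - B(1 + u/2, u)].

    If [0 <= s], [r <= s + 1] and [2 (r - 1) < 4 s - 1], then [B] is bounded
    from [H^s x H^s] to [H^r]: on the Fourier side the weight of the output
    frequency [k] is moved to the larger of [|j|], [|k - j|], and
    Cauchy-Schwarz leaves the sum over [k] of
    [<k>^(-2(s - r + 1)) <k - j>^(-2s)], which is bounded uniformly in [j].
    Both cases of the theorem are instances of these conditions on [r], and so
    is [r = s]; hence the product rule shows, by induction on [n], that [u] is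
    [C^n] with values in [H^s], and then that [u - u0] is [C^(n+1)] with values
    in [H^r].

    That [|(f g)^(k)|] is at most the sum of [|f^(j)| |g^(k - j)|] is
    Parseval's identity.  It is proved by showing that the defect of the Fejer
    means is a positive semidefinite form, equal to an integral of
    [K_N(x - y) (f x - f y)^2], which tends to [0] on bounded continuous
    functions and therefore, by density, on [L^2].

    The equation is only used coefficientwise: every Fourier coefficient of [u]
    is differentiable in time, and the mean value theorem, applied to finite
    linear combinations of coefficients, turns this into differentiability in
    [H^r]. *)
Require Import Defs.
From mathcomp Require Import all_boot all_order all_algebra.
From mathcomp Require Import all_classical all_reals all_analysis.
From mathcomp Require Import measurable_realfun.
From mathcomp Require Import ring lra zify.
Import Order.TTheory GRing.Theory Num.Theory.
Import numFieldNormedType.Exports.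
Local Open Scope classical_set_scope.
Local Open Scope ring_scope.
Set Implicit Arguments.
Unset Strict Implicit.
Unset Printing Implicit Defensive.

(** * Integrals over the unit interval *)

Section UnitInterval.
Variable R : realType.
Implicit Types (f g h : R -> R) (c : R).
Local Notation mu := (@lebesgue_measure R).
Local Notation D := (`[(0:R), 1]%classic : set R).

Local Notation mfun f := (@measurable_fun _ _ (measurableTypeR R) R D f).

(** The integral equation holds, for each [t], only off a null set of [x] that depends on [t], and
    its time integral is taken pointwise in [x]; neither a pointwise time derivative of [u] nor an
    [H^r]-valued integral is at hand. Fourier coefficients ignore null sets, and Sobolev norms are
    handled as bounds on finite partial sums: a bound common to all finite sets of frequencies is a
    norm bound, while each finite sum is a scalar function of time, to which the mean value theorem
    applies. This gives a meaning to differentiability in [H^r] of a curve [u] that need not be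
    [H^r]-valued, since only increments of [u] are measured there. The threshold is that of the
    series of [<k>^(-2b)], which converges for [b > 1/2] and diverges for [b = 1/2]. It makes
    [2 (r - 1) < 4 s - 1] strict, whence the loss of the endpoint [2 s + 1/2] when [s <= 1/2]; when
    [s > 1/2], the order [s + 1], the full gain of an operator of order -1, satisfies it. *)

Definition integrable01 f := mu.-integrable D (EFin \o f).
Definition integral01 f := \int[mu]_(x in D) f x.

Lemma measurable01 : measurable (D : set (measurableTypeR R)).
Proof. exact: measurable_itv. Qed.

Lemma lebesgue_measure01 : mu D = 1%E.
Proof. by rewrite lebesgue_measure_itv/= lte_fin ltr01 -EFinB subr0. Qed.

Lemma integrable01_meas f : integrable01 f -> mfun f.
Proof. by move=> /integrableP[] /measurable_EFinP. Qed.

Lemma eq_integrable01 f g : (forall x, x \in `[(0:R), 1] -> f x = g x) ->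
    integrable01 f -> integrable01 g.
Proof.
move=> fg.
apply: (@eq_integrable _ _ _ mu D measurable01 (EFin \o f) (EFin \o g)) => // x.
by rewrite inE /= => /fg ->.
Qed.

Lemma integrable01D f g : integrable01 f -> integrable01 g -> integrable01 (fun
    x => f x + g x).
Proof. by move=> hf hg; have := integrableD measurable01 hf hg. Qed.

Lemma integrable01Z c f : integrable01 f -> integrable01 (fun x => c * f x).
Proof. by move=> hf; have := integrableZl measurable01 c hf. Qed.

Lemma integrable01B f g : integrable01 f -> integrable01 g -> integrable01 (fun
    x => f x - g x).
Proof. by move=> hf hg; have := integrableB measurable01 hf hg. Qed.

Lemma integrable01_norm f : integrable01 f -> integrable01 (fun x => `|f x|).
Proof. exact: integrable_norm. Qed.

Lemma integrable01_le f g : mfun f ->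
  (forall x, x \in `[(0:R), 1] -> `|f x| <= g x) -> integrable01 g ->
      integrable01 f.
Proof.
move=> mf fg; apply: (le_integrable measurable01); first exact/measurable_EFinP.
by move=> x xD; rewrite /= lee_fin (le_trans (fg _ xD))// ler_norm.
Qed.

Lemma integrable01_cst c : integrable01 (fun=> c).
Proof.
apply: continuous_compact_integrable; first exact: segment_compact.
exact: cst_continuous.
Qed.

Lemma integrable01_bnd f c : mfun f ->
  (forall x, x \in `[(0:R), 1] -> `|f x| <= c) -> integrable01 f.
Proof. by move=> mf fc; apply: integrable01_le mf fc _; exact:
    integrable01_cst. Qed.

Lemma integrable01M_bnd f g c : integrable01 f -> mfun g ->
  (forall x, x \in `[(0:R), 1] -> `|g x| <= c) -> integrable01 (fun x => f x *
      g x).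
Proof.
move=> hf mg gc; apply: (@integrable01_le _ (fun x => c * `|f x|)).
- by apply: measurable_funM => //; exact: integrable01_meas.
- by move=> x /gc h; rewrite normrM mulrC ler_wpM2r.
- exact/integrable01Z/integrable01_norm.
Qed.

Lemma integrable01_cont f : continuous f -> integrable01 f.
Proof.
move=> cf; apply: continuous_compact_integrable; first exact: segment_compact.
exact: continuous_subspaceT.
Qed.

Lemma integrable01_sum (K : Type) (s : seq K) (F : K -> R -> R) :
  (forall k, integrable01 (F k)) -> integrable01 (fun x => \sum_(k <- s) F k x).
Proof.
move=> hF; elim: s => [|k s ih].
  by apply: (@eq_integrable01 (fun=> 0)); [move=> *; rewrite big_nil|exact:
      integrable01_cst].
apply: (@eq_integrable01 (fun x => F k x + \sum_(k <- s) F k x)); last exact: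
    integrable01D.
by move=> *; rewrite big_cons.
Qed.

Lemma eq_integral01 f g : (forall x, x \in `[(0:R), 1] -> f x = g x) ->
    integral01 f = integral01 g.
Proof. by move=> fg; apply: eq_Rintegral => x; rewrite inE => /fg. Qed.

Lemma integral01D f g : integrable01 f -> integrable01 g -> integral01 (fun x
    => f x + g x) = integral01 f + integral01 g.
Proof. by move=> hf hg; exact: (RintegralD measurable01 hf hg). Qed.

Lemma integral01B f g : integrable01 f -> integrable01 g -> integral01 (fun x
    => f x - g x) = integral01 f - integral01 g.
Proof. by move=> hf hg; exact: (RintegralB measurable01 hf hg). Qed.

Lemma integral01Z c f : integrable01 f -> integral01 (fun x => c * f x) = c *
    integral01 f.
Proof. by move=> hf; exact: (RintegralZl _ measurable01 hf). Qed.

Lemma integral01_cst c : integral01 (fun=> c) = c.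
Proof. by rewrite /integral01 (Rintegral_cst _ measurable01) [X in fine
    X]lebesgue_measure01 mulr1. Qed.

Lemma integral01_ge0 f : (forall x, x \in `[(0:R), 1] -> 0 <= f x) -> 0 <=
    integral01 f.
Proof. by move=> h; apply: Rintegral_ge0 => x /h. Qed.

Lemma le_integral01 f g : integrable01 f -> integrable01 g ->
  (forall x, x \in `[(0:R), 1] -> f x <= g x) -> integral01 f <= integral01 g.
Proof. by move=> hf hg fg; apply: (le_Rintegral measurable01 hf hg fg). Qed.

Lemma norm_integral01 f : integrable01 f -> `|integral01 f| <= integral01 (fun
    x => `|f x|).
Proof. by move=> hf; exact: (le_normr_Rintegral measurable01 hf). Qed.

Lemma integral01_sum (K : Type) (s : seq K) (F : K -> R -> R) :
  (forall k, integrable01 (F k)) ->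
  integral01 (fun x => \sum_(k <- s) F k x) = \sum_(k <- s) integral01 (F k).
Proof.
move=> hF; elim: s => [|k s ih].
  by rewrite big_nil -[RHS]integral01_cst; apply: eq_integral01 => *; rewrite
      big_nil.
rewrite big_cons -ih -integral01D//; last exact: integrable01_sum.
by apply: eq_integral01 => *; rewrite big_cons.
Qed.

Lemma integral01_ae f g : mfun f -> mfun g ->
  {ae mu, forall x, D x -> f x = g x} -> integral01 f = integral01 g.
Proof.
move=> mf mg fg; congr fine; apply: (ae_eq_integral _ _ measurable01).
- exact/measurable_EFinP.
- exact/measurable_EFinP.
- exact: (ae_eq_comp EFin fg).
Qed.

Definition L2 f := mfun f /\ integrable01 (fun x => f x ^+ 2).

Lemma integrable01_L2M f g : L2 f -> L2 g -> integrable01 (fun x => f x * g x).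
Proof.
move=> [mf hf] [mg hg]; apply: (@integrable01_le _ (fun x => f x ^+ 2 + g x ^+
    2)).
- exact: measurable_funM.
- move=> x _; rewrite normrM -(real_normK (num_real (f x))).
  rewrite -(real_normK (num_real (g x))).
  have := sqr_ge0 (`|f x| - `|g x|); have := normr_ge0 (f x).
  have := normr_ge0 (g x); nra.
- exact: integrable01D.
Qed.

Lemma L2_bnd f c : mfun f ->
  (forall x, x \in `[(0:R), 1] -> `|f x| <= c) -> L2 f.
Proof.
move=> mf fc; split=> //; apply: (@integrable01_bnd _ (c ^+ 2)).
  exact: measurable_funX.
move=> x /fc h; rewrite normrX lerXn2r// nnegrE //.
exact: le_trans h.
Qed.

Lemma L2_cst c : L2 (fun=> c).
Proof. by apply: (@L2_bnd _ `|c|). Qed.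

Lemma L2_integrable01 f : L2 f -> integrable01 f.
Proof.
move=> hf; apply: (@eq_integrable01 (fun x => f x * 1)) => [x _|]; first by
    rewrite mulr1.
exact: integrable01_L2M (L2_cst 1).
Qed.

Lemma L2D f g : L2 f -> L2 g -> L2 (fun x => f x + g x).
Proof.
move=> hf hg; split.
  by apply: measurable_funD; [case: hf|case: hg].
apply: (@eq_integrable01 (fun x => (f x ^+ 2 + 2 * (f x * g x)) + g x ^+ 2)).
  by move=> x _; ring.
apply: integrable01D; last by case: hg.
by apply: integrable01D; [case: hf|apply: integrable01Z; exact:
    integrable01_L2M].
Qed.

Lemma L2Z c f : L2 f -> L2 (fun x => c * f x).
Proof.
move=> [mf hf]; split; first exact: measurable_funM.
apply: (@eq_integrable01 (fun x => c ^+ 2 * f x ^+ 2)); last exact: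
    integrable01Z.
by move=> x _; ring.
Qed.

Lemma L2N f : L2 f -> L2 (fun x => - f x).
Proof.
move=> hf; have -> : (fun x => - f x) = (fun x => -1 * f x).
  by apply/funext => x; rewrite mulN1r.
exact: L2Z.
Qed.

Lemma L2B f g : L2 f -> L2 g -> L2 (fun x => f x - g x).
Proof. by move=> hf hg; apply: L2D => //; exact: L2N. Qed.

Lemma L2M_bnd f g c : L2 f -> mfun g ->
  (forall x, x \in `[(0:R), 1] -> `|g x| <= c) -> L2 (fun x => f x * g x).
Proof.
move=> [mf hf] mg gc; split; first exact: measurable_funM.
apply: (@eq_integrable01 (fun x => f x ^+ 2 * g x ^+ 2)).
  by move=> x _; rewrite exprMn.
apply: (integrable01M_bnd (c := c ^+ 2)) => //; first exact: measurable_funX.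
move=> x /gc h; rewrite normrX lerXn2r// nnegrE //.
exact: le_trans h.
Qed.

(** Source of the Cauchy-Schwarz inequalities for integrals and for the Fejer form. The case [a = 0]
    matters because these forms may degenerate. *)
Lemma discriminant (a b c : R) : 0 <= a ->
  (forall t, 0 <= a * t ^+ 2 + 2 * b * t + c) -> b ^+ 2 <= a * c.
Proof.
rewrite le_eqVlt => /predU1P[<- h|a0 h].
  rewrite mul0r; have [->|b0] := eqVneq b 0; first by rewrite expr0n.
  (* For [a = 0] the polynomial is affine, and at this point it takes the value -1. *)
  have := h (- (c + 1) / (2 * b)).
  have -> : 0 * (- (c + 1) / (2 * b)) ^+ 2 + 2 * b * (- (c + 1) / (2 * b)) + c
    = -1 by field; rewrite b0.
  lra.
have := h (- b / a).
have -> : a * (- b / a) ^+ 2 + 2 * b * (- b / a) + c = (a * c - b ^+ 2) / a.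
  by field; rewrite gt_eqF.
by rewrite pmulr_lge0 ?invr_gt0 // subr_ge0.
Qed.

(** The polynomial in [t] is the integral of [(t |f| + |g|)^2]. The absolute value stays inside the
    integral because the sup norm of a convolution is later bounded by the L1 norm of a product. *)
Lemma L2_cauchy f g : L2 f -> L2 g ->
  integral01 (fun x => `|f x * g x|) ^+ 2 <=
  integral01 (fun x => f x ^+ 2) * integral01 (fun x => g x ^+ 2).
Proof.
move=> hf hg; apply: discriminant.
  by apply: integral01_ge0 => x _; exact: sqr_ge0.
move=> t.
have i1 : integrable01 (fun x => `|f x * g x|) by apply: integrable01_norm;
    exact: integrable01_L2M.
have [_ i2] := hf; have [_ i3] := hg.
have -> : integral01 (fun x => f x ^+ 2) * t ^+ 2 + 2 * integral01 (fun x =>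
    `|f x * g x|) * t +
    integral01 (fun x => g x ^+ 2) =
    integral01 (fun x => t ^+ 2 * f x ^+ 2 + 2 * t * `|f x * g x| + g x ^+ 2).
  rewrite integral01D//; last by apply: integrable01D; exact: integrable01Z.
  by rewrite integral01D ?integral01Z //; [ring|exact: integrable01Z|exact:
      integrable01Z].
apply: integral01_ge0 => x _.
rewrite normrM -(real_normK (num_real (f x))) -(real_normK (num_real (g x))).
by have := sqr_ge0 (t * `|f x| + `|g x|); nra.
Qed.

End UnitInterval.

(** * The Fejer form *)

Section Fejer.
Variable R : realType.
Implicit Types (f g h : R -> R) (c x y z : R) (k m : int) (N : nat).
Local Notation mu := (@lebesgue_measure R).
Local Notation D := (`[(0:R), 1]%classic : set R).
Local Notation mfun f := (@measurable_fun _ _ (measurableTypeR R) R D f).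

(** * Trigonometric modes and their integrals *)

Definition cos_mode k x : R := cos (2 * pi * k%:~R * x).
Definition sin_mode k x : R := sin (2 * pi * k%:~R * x).
(** The complex Fourier coefficient of [f] at [k] is [cos_coef f k - i sin_coef f k]. *)
Definition cos_coef f k := integral01 (fun x => f x * cos_mode k x).
Definition sin_coef f k := integral01 (fun x => f x * sin_mode k x).

Lemma derive_cont f (df : R -> R) :
  (forall x, is_derive x 1 f (df x)) -> continuous f.
Proof.
move=> h x; apply: differentiable_continuous; apply/derivable1_diffP.
by have [] := h x.
Qed.

Lemma cont_mfun f : continuous f -> mfun f.
Proof.
by move=> cf; apply: measurable_funTS; exact: continuous_measurable_fun.
Qed.

Lemma integral_FTC f (F : R -> R) (a b : R) : a < b -> continuous f ->
  (forall x, is_derive x 1 F (f x)) ->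
  \int[mu]_(x in `[a, b]) f x = F b - F a.
Proof.
move=> ab cf dF; have cF := derive_cont dF.
rewrite /Rintegral (@continuous_FTC2 _ f F)//.
- exact: continuous_subspaceT.
- split.
  + by move=> x _; have [] := dF x.
  + by apply: cvg_at_right_filter; exact: cF.
  + by apply: cvg_at_left_filter; exact: cF.
- by move=> x _; rewrite derive1E; have [_ ->] := dF x.
Qed.

Lemma cosD2pin c k : cos (c + 2 * pi * k%:~R) = cos c.
Proof.
have h (n : nat) x : cos (x + 2 * pi * n%:R) = cos x.
  rewrite -(periodicn (@cosD2pi R) n x); congr (cos (_ + _)).
  by rewrite -mulrnA -[RHS]mulr_natr natrM; ring.
case: k => n; first exact: h.
rewrite NegzE mulrNz mulrN -[LHS](h n.+1); congr cos.
by rewrite -addrA addNr addr0.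
Qed.

Lemma sinD2pin c k : sin (c + 2 * pi * k%:~R) = sin c.
Proof.
have h (n : nat) x : sin (x + 2 * pi * n%:R) = sin x.
  rewrite -(periodicn (@sinD2pi R) n x); congr (sin (_ + _)).
  by rewrite -mulrnA -[RHS]mulr_natr natrM; ring.
case: k => n; first exact: h.
rewrite NegzE mulrNz mulrN -[LHS](h n.+1); congr sin.
by rewrite -addrA addNr addr0.
Qed.

Lemma is_derive_lin (l c x : R) : is_derive x 1 (fun y => l * y + c) l.
Proof.
have := is_deriveD (is_deriveZ l (is_derive_id x 1)) (is_derive_cst c x 1).
by move=> /is_derive_eq; apply; rewrite /GRing.scale /= mulr1 addr0.
Qed.

Lemma is_derive_sin_lin (l c x : R) :
  is_derive x 1 (fun y => sin (l * y + c)) (l * cos (l * x + c)).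
Proof.
have h := is_derive_lin l c x.
have := @is_derive1_comp _ sin (fun y => l * y + c) x _ _ (is_derive_sin _) h.
by move=> /is_derive_eq; apply; rewrite /GRing.scale /= mulrC.
Qed.

Lemma is_derive_cos_lin (l c x : R) :
  is_derive x 1 (fun y => cos (l * y + c)) (- l * sin (l * x + c)).
Proof.
have h := is_derive_lin l c x.
have := @is_derive1_comp _ cos (fun y => l * y + c) x _ _ (is_derive_cos _) h.
by move=> /is_derive_eq; apply; rewrite /GRing.scale /= mulrC mulrN mulNr.
Qed.

Lemma cont_cos_lin (l c : R) : continuous (fun y => cos (l * y + c)).
Proof. by apply: derive_cont => x; exact: is_derive_cos_lin. Qed.

Lemma cont_sin_lin (l c : R) : continuous (fun y => sin (l * y + c)).
Proof. by apply: derive_cont => x; exact: is_derive_sin_lin. Qed.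

(** The free phase [c] lets one orthogonality relation serve cosines, sines (phase [- pi / 2]) and
    cosines of [x - y]. *)
Lemma integral01_cos_lin k c :
  integral01 (fun y => cos (2 * pi * k%:~R * y + c)) = if k == 0 then cos c
      else 0.
Proof.
have [->|k0] := eqVneq k 0.
  rewrite -[RHS]integral01_cst; apply: eq_integral01 => x _.
  by rewrite mulr0 mul0r add0r.
set l : R := 2 * pi * k%:~R.
have l0 : l != 0.
  by rewrite /l !mulf_neq0// ?intr_eq0// gt_eqF// pi_gt0.
have dF x : is_derive x 1 (fun y => l^-1 * sin (l * y + c)) (cos (l * x + c)).
  have := is_deriveZ l^-1 (is_derive_sin_lin l c x).
  by move=> /is_derive_eq; apply; rewrite /GRing.scale /= mulKf.
rewrite /integral01 (integral_FTC ltr01 (@cont_cos_lin l c) dF).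
by rewrite mulr1 mulr0 add0r [l + c]addrC /l sinD2pin subrr.
Qed.

Lemma cos_modeB k x y :
  cos_mode k (x - y) = cos_mode k x * cos_mode k y + sin_mode k x * sin_mode k
      y.
Proof. by rewrite /cos_mode mulrBr cosB. Qed.

Lemma cos_mode_cont k : continuous (cos_mode k).
Proof.
have -> : cos_mode k = fun y => cos (2 * pi * k%:~R * y + 0).
  by apply/funext => y; rewrite addr0.
exact: cont_cos_lin.
Qed.

Lemma sin_mode_cont k : continuous (sin_mode k).
Proof.
have -> : sin_mode k = fun y => sin (2 * pi * k%:~R * y + 0).
  by apply/funext => y; rewrite addr0.
exact: cont_sin_lin.
Qed.

Lemma cos_mode_le1 k x : `|cos_mode k x| <= 1.
Proof. by rewrite ler_norml cos_geN1 cos_le1. Qed.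

Lemma sin_mode_le1 k x : `|sin_mode k x| <= 1.
Proof. by rewrite ler_norml sin_geN1 sin_le1. Qed.

Lemma integrable01_cos_mode f k : integrable01 f -> integrable01 (fun x => f x
    * cos_mode k x).
Proof.
move=> hf; apply: (integrable01M_bnd (c := 1)) => //.
  by apply: cont_mfun; exact: cos_mode_cont.
by move=> x _; exact: cos_mode_le1.
Qed.

Lemma integrable01_sin_mode f k : integrable01 f -> integrable01 (fun x => f x
    * sin_mode k x).
Proof.
move=> hf; apply: (integrable01M_bnd (c := 1)) => //.
  by apply: cont_mfun; exact: sin_mode_cont.
by move=> x _; exact: sin_mode_le1.
Qed.

Lemma L2_cos_mode f k : L2 f -> L2 (fun x => f x * cos_mode k x).
Proof.
move=> hf; apply: (L2M_bnd (c := 1)) => //.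
  by apply: cont_mfun; exact: cos_mode_cont.
by move=> x _; exact: cos_mode_le1.
Qed.

Lemma L2_sin_mode f k : L2 f -> L2 (fun x => f x * sin_mode k x).
Proof.
move=> hf; apply: (L2M_bnd (c := 1)) => //.
  by apply: cont_mfun; exact: sin_mode_cont.
by move=> x _; exact: sin_mode_le1.
Qed.

Lemma integral01_cos_mode k : integral01 (cos_mode k) = (k == 0)%:R.
Proof.
transitivity (integral01 (fun y => cos (2 * pi * k%:~R * y + 0))).
  by apply: eq_integral01 => x _; rewrite addr0.
by rewrite integral01_cos_lin cos0; case: eqP.
Qed.

Lemma integral01_sin_mode k : integral01 (sin_mode k) = 0.
Proof.
transitivity (integral01 (fun y => cos (2 * pi * k%:~R * y + - (pi / 2)))).
  apply: eq_integral01 => x _.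
  by rewrite cosB cos_pihalf sin_pihalf mulr0 mulr1 add0r.
by rewrite integral01_cos_lin cosN cos_pihalf; case: eqP.
Qed.

(* This is [\sum_k (1 - |k| / N) F k]; over pairs of indices the Fejer kernel is
   visibly a square. *)
Definition fejer_sum N (F : int -> R) : R :=
  N%:R^-1 * \sum_(i < N) \sum_(j < N) F (i%:Z - j%:Z).

Definition fejer_kernel N z := fejer_sum N (fun k => cos_mode k z).

Lemma fejer_kernel_ge0 N z : 0 <= fejer_kernel N z.
Proof.
rewrite /fejer_kernel /fejer_sum mulr_ge0 ?invr_ge0 ?ler0n//.
(* The squared modulus of the sum of [e^(2 i pi n z)] over [n < N], in real and imaginary parts. *)
have -> : \sum_(i < N) \sum_(j < N) cos_mode (i%:Z - j%:Z) z =
    (\sum_(i < N) cos_mode i z) ^+ 2 + (\sum_(i < N) sin_mode i z) ^+ 2.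
  rewrite !expr2 !big_distrlr /= -big_split /=; apply: eq_bigr => i _.
  rewrite -big_split /=; apply: eq_bigr => j _.
  by rewrite /cos_mode /sin_mode rmorphB /= mulrBr mulrBl cosB.
by rewrite addr_ge0 ?sqr_ge0.
Qed.

Lemma fejer_sumD N F G :
  fejer_sum N (fun k => F k + G k) = fejer_sum N F + fejer_sum N G.
Proof.
rewrite /fejer_sum -mulrDr -big_split /=; congr (_ * _).
by apply: eq_bigr => i _; rewrite -big_split.
Qed.

Lemma fejer_sumZ N c F : fejer_sum N (fun k => c * F k) = c * fejer_sum N F.
Proof.
rewrite /fejer_sum mulrCA; congr (_ * _); rewrite mulr_sumr.
by apply: eq_bigr => i _; rewrite mulr_sumr.
Qed.

Lemma eq_fejer_sum N F G : F =1 G -> fejer_sum N F = fejer_sum N G.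
Proof. by move=> FG; congr fejer_sum; exact/funext. Qed.

Lemma integrable01_fejer_sum N (F : R -> int -> R) : (forall k, integrable01 (F
    ^~ k)) ->
  integrable01 (fun x => fejer_sum N (F x)).
Proof.
by move=> h; apply: integrable01Z; apply: integrable01_sum => i; apply:
    integrable01_sum => j; exact: h.
Qed.

Lemma integral01_fejer_sum N (F : R -> int -> R) : (forall k, integrable01 (F
    ^~ k)) ->
  integral01 (fun x => fejer_sum N (F x)) = fejer_sum N (fun k => integral01 (F
      ^~ k)).
Proof.
move=> h; rewrite /fejer_sum integral01Z; last first.
  by apply: integrable01_sum => i; apply: integrable01_sum => j; exact: h.
congr (_ * _); rewrite integral01_sum; last by move=> i; apply:
    integrable01_sum => j; exact: h.
by apply: eq_bigr => i _; rewrite integral01_sum// => j; exact: h.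
Qed.

Lemma sum_delta N (a : nat) : \sum_(i < N) (i == a :> nat)%:R = (a < N)%:R :> R.
Proof.
elim: N => [|N ih]; first by rewrite big_ord0.
rewrite big_ord_recr /= ih ltnS; have [h|h|h] := ltngtP a N;
  by rewrite ?addr0 ?add0r.
Qed.

Lemma fejer_delta0 N : (0 < N)%N -> fejer_sum N (fun m => (m == 0)%:R) = 1.
Proof.
move=> N0; rewrite /fejer_sum (eq_bigr (fun=> 1)).
  by rewrite sumr_const card_ord mulVf// pnatr_eq0 -lt0n.
move=> i _; rewrite (eq_bigr (fun j : 'I_N => (j == i :> nat)%:R)).
  by rewrite sum_delta ltn_ord.
by move=> j _; congr (nat_of_bool _)%:R; apply/eqP/eqP; lia.
Qed.

(** Exactly [N - 1] of the pairs of indices have difference 1, one for each [j < N - 1]. *)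
Lemma fejer_delta1 N : (0 < N)%N ->
  fejer_sum N (fun m => (m == 1)%:R) = 1 - N%:R^-1.
Proof.
case: N => // N _; rewrite /fejer_sum exchange_big /=.
rewrite (eq_bigr (fun j : 'I_N.+1 => (j < N)%N%:R)).
  rewrite big_ord_recr /= ltnn addr0 (eq_bigr (fun=> 1)).
    have n0 : N.+1%:R != 0 :> R by rewrite pnatr_eq0.
    apply: (mulfI n0); rewrite mulrBr mulVKf// mulr1 mulfV//.
    by rewrite sumr_const card_ord -natr1 addrK.
  by move=> i _; rewrite /= ltn_ord.
move=> j _; rewrite (eq_bigr (fun i : 'I_N.+1 => (i == j.+1 :> nat)%:R)).
  by rewrite sum_delta ltnS.
by move=> i _; congr (nat_of_bool _)%:R; apply/eqP/eqP; lia.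
Qed.

Lemma fejer_deltaN1 N : (0 < N)%N ->
  fejer_sum N (fun m => (m == -1)%:R) = 1 - N%:R^-1.
Proof.
move=> N0; rewrite -fejer_delta1// /fejer_sum exchange_big /=; congr (_ * _).
apply: eq_bigr => i _; apply: eq_bigr => j _.
by congr (nat_of_bool _)%:R; apply/eqP/eqP; lia.
Qed.

Lemma integral01_shift_cos_mode k x : integral01 (fun y => cos_mode k (x - y))
    = (k == 0)%:R.
Proof.
transitivity (integral01 (fun y => cos (2 * pi * (- k)%:~R * y + 2 * pi * k%:~R
    * x))).
  by apply: eq_integral01 => y _; rewrite /cos_mode; congr cos; rewrite mulrNz;
      ring.
rewrite integral01_cos_lin oppr_eq0; case: eqP => // ->.
by rewrite mulr0 mul0r cos0.
Qed.

Lemma cont_shift_cos_mode k x : continuous (fun y => cos_mode k (x - y)).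
Proof.
have -> : (fun y => cos_mode k (x - y)) =
    fun y => cos (- (2 * pi * k%:~R) * y + 2 * pi * k%:~R * x).
  by apply/funext => y; rewrite /cos_mode; congr cos; ring.
exact: cont_cos_lin.
Qed.

Lemma integrable01_shift_cos_mode f k x : integrable01 f -> integrable01 (fun y
    => cos_mode k (x - y) * f y).
Proof.
move=> hf; apply: (@eq_integrable01 _ (fun y => f y * cos_mode k (x - y))).
  by move=> y _; rewrite mulrC.
apply: (integrable01M_bnd (c := 1)) => //.
  by apply: cont_mfun; exact: cont_shift_cos_mode.
by move=> y _; exact: cos_mode_le1.
Qed.

Lemma fejer_kernelMr N z c : fejer_kernel N z * c = fejer_sum N (fun k =>
    cos_mode k z * c).
Proof.
by rewrite mulrC /fejer_kernel -fejer_sumZ; apply: eq_fejer_sum => k; rewrite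
    mulrC.
Qed.

Lemma integrable01_fejer_kernel N f x : integrable01 f -> integrable01 (fun y
    => fejer_kernel N (x - y) * f y).
Proof.
move=> hf; under eq_fun do rewrite fejer_kernelMr.
by apply: (@integrable01_fejer_sum N (fun y k => _)) => k; exact:
    integrable01_shift_cos_mode.
Qed.

Lemma integral01_fejer_kernel N x : (0 < N)%N -> integral01 (fun y =>
    fejer_kernel N (x - y)) = 1.
Proof.
move=> N0; rewrite integral01_fejer_sum.
  by rewrite -[RHS](fejer_delta0 N0); apply: eq_fejer_sum => k;
    rewrite integral01_shift_cos_mode.
by move=> k; apply: integrable01_cont; exact: cont_shift_cos_mode.
Qed.

Lemma cos_modeM1 k z : cos_mode k z * cos_mode 1 z = 2^-1 * (cos_mode (k + 1) z
    + cos_mode (k - 1) z).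
Proof.
rewrite /cos_mode; set a := 2 * pi * k%:~R * z; set b := 2 * pi * 1%:~R * z.
have -> : 2 * pi * (k + 1)%:~R * z = a + b by rewrite /a /b rmorphD /=; ring.
have -> : 2 * pi * (k - 1)%:~R * z = a - b by rewrite /a /b rmorphB /=; ring.
by rewrite cosD cosB; field.
Qed.

(** Since [1 - cos_mode 1] vanishes only at the integers, this moment measures the mass of the
    kernel away from the diagonal. It replaces any pointwise estimate of the kernel's tail; only the
    weights of the frequencies 0, 1 and -1 enter. *)
Lemma integral01_fejer_kernel_1subcos N x : (0 < N)%N ->
  integral01 (fun y => fejer_kernel N (x - y) * (1 - cos_mode 1 (x - y))) =
      N%:R^-1.
Proof.
move=> N0.
have i1 k : integrable01 (fun y => cos_mode k (x - y)) by
    exact/integrable01_cont/cont_shift_cos_mode.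
have i2 : integrable01 (fun y => fejer_kernel N (x - y)).
  by apply: (@integrable01_fejer_sum N (fun y k => cos_mode k (x - y))).
transitivity (integral01 (fun y => fejer_kernel N (x - y) -
  fejer_sum N (fun k => 2^-1 * (cos_mode (k + 1) (x - y) + cos_mode (k - 1) (x
      - y))))).
  apply: eq_integral01 => y _; rewrite mulrBr mulr1 fejer_kernelMr; congr (_ -
      _).
  by apply: eq_fejer_sum => k; exact: cos_modeM1.
have i3 k : integrable01 (fun y => 2^-1 * (cos_mode (k + 1) (x - y) + cos_mode
    (k - 1) (x - y))).
  by apply: integrable01Z; apply: integrable01D.
rewrite integral01B//; last first.
  by apply: (@integrable01_fejer_sum N (fun y k => _)) => k; exact: i3.
rewrite integral01_fejer_kernel// integral01_fejer_sum//.
rewrite (@eq_fejer_sum _ _ (fun k => 2^-1 * ((k == -1)%:R + (k == 1)%:R))).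
  by rewrite fejer_sumZ fejer_sumD fejer_delta1// fejer_deltaN1//; field;
    rewrite pnatr_eq0 -lt0n.
move=> k; rewrite integral01Z; last exact: integrable01D.
rewrite integral01D// !integral01_shift_cos_mode; congr (_ * ((nat_of_bool
    _)%:R + (nat_of_bool _)%:R)).
  by apply/eqP/eqP; lia.
by apply/eqP/eqP; lia.
Qed.

(** The Fejer mean of [f] at [x]: each summand is the real part of the [k]-th coefficient times
    [e^(2 i pi k x)]. *)
Lemma fejer_kernel_conv N f x : integrable01 f -> integral01 (fun y =>
    fejer_kernel N (x - y) * f y) =
  fejer_sum N (fun k => cos_mode k x * cos_coef f k + sin_mode k x * sin_coef f
      k).
Proof.
move=> hf; under eq_fun do rewrite fejer_kernelMr.
rewrite (@integral01_fejer_sum N (fun y k => _)); last by move=> k; exact: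
    integrable01_shift_cos_mode.
apply: eq_fejer_sum => k.
rewrite -integral01Z; last exact: integrable01_cos_mode.
rewrite -integral01Z; last exact: integrable01_sin_mode.
rewrite -integral01D; [|by apply: integrable01Z; exact:
    integrable01_cos_mode|by apply: integrable01Z; exact:
    integrable01_sin_mode].
by apply: eq_integral01 => y _; rewrite cos_modeB; ring.
Qed.

(** The real part of the product of the [k]-th coefficient of [f] with the conjugate of that of
    [g]. *)
Definition coef_dot f g k : R := cos_coef f k * cos_coef g k + sin_coef f k *
    sin_coef g k.

Definition fejer_form N f g : R := integral01 (fun x => f x * g x) - fejer_sum
    N (coef_dot f g).

Definition energy N f x := integral01 (fun y => fejer_kernel N (x - y) * (f x -
    f y) ^+ 2).

(** Expanding the square, the kernel mass 1 yields [f x ^+ 2], the cross term [f x] times a Fejer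
    mean, and the last term the Fejer mean of [f ^ 2]. In this closed form the integration in [x] is
    term by term and needs no Fubini theorem. *)
Lemma energyE N f x : (0 < N)%N -> L2 f ->
  energy N f x = f x ^+ 2 - 2 * fejer_sum N
       (fun k => cos_coef f k * (f x * cos_mode k x) + sin_coef f k * (f x *
           sin_mode k x)) +
    fejer_sum N (fun k => cos_mode k x * cos_coef (fun x => f x ^+ 2) k +
                          sin_mode k x * sin_coef (fun x => f x ^+ 2) k).
Proof.
move=> N0 hf; have hi := L2_integrable01 hf; have [_ hq] := hf.
transitivity (integral01 (fun y => f x ^+ 2 * fejer_kernel N (x - y) -
    2 * f x * (fejer_kernel N (x - y) * f y) + fejer_kernel N (x - y) * f y ^+
        2)).
  by apply: eq_integral01 => y _; ring.
have i1 : integrable01 (fun y => fejer_kernel N (x - y)).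
  apply: (@eq_integrable01 _ (fun y => fejer_kernel N (x - y) * 1)).
    by move=> y _; rewrite mulr1.
  exact/integrable01_fejer_kernel/integrable01_cst.
rewrite integral01D; [|by apply: integrable01B; apply: integrable01Z => //;
    exact: integrable01_fejer_kernel|exact: integrable01_fejer_kernel].
rewrite integral01B; [|exact: integrable01Z|by apply: integrable01Z; exact:
    integrable01_fejer_kernel].
rewrite (integral01Z (f x ^+ 2) i1) (integral01Z (2 * f x)
    (integrable01_fejer_kernel N x hi)).
rewrite integral01_fejer_kernel// !fejer_kernel_conv// mulr1 -mulrA -fejer_sumZ.
by congr (_ - 2 * _ + _); apply: eq_fejer_sum => k; ring.
Qed.

Lemma integrable01_energy1 f k : L2 f ->
  integrable01 (fun x => cos_coef f k * (f x * cos_mode k x) + sin_coef f k *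
      (f x * sin_mode k x)).
Proof.
by move=> /L2_integrable01 hf; apply: integrable01D; apply: integrable01Z;
    [exact: integrable01_cos_mode|exact: integrable01_sin_mode].
Qed.

Lemma integrable01_trig k (a b : R) : integrable01 (fun x => cos_mode k x * a +
    sin_mode k x * b).
Proof.
by apply: integrable01_cont => x; apply: cvgD; apply: cvgMl; [exact:
    cos_mode_cont|exact: sin_mode_cont].
Qed.

Lemma integrable01_energy N f : (0 < N)%N -> L2 f -> integrable01 (energy N f).
Proof.
move=> N0 hf; apply: eq_integrable01 => [x _|]; first by rewrite energyE.
apply: integrable01D.
  apply: integrable01B; first by case: hf.
  apply: integrable01Z; apply: (@integrable01_fejer_sum N (fun x k => _)) => k.
  exact: integrable01_energy1.
by apply: (@integrable01_fejer_sum N (fun x k => _)) => k; exact: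
    integrable01_trig.
Qed.

Lemma fejer_form_energy N f : (0 < N)%N -> L2 f -> 2 * fejer_form N f f =
    integral01 (energy N f).
Proof.
move=> N0 hf; have hi := L2_integrable01 hf; have [_ hq] := hf.
under [RHS]eq_integral01 do rewrite energyE//.
have j1 k := integrable01_energy1 k hf.
have j2 k := integrable01_trig k (cos_coef (fun x => f x ^+ 2) k) (sin_coef
    (fun x => f x ^+ 2) k).
rewrite integral01D; last 2 first.
  - by apply: integrable01B => //; apply: integrable01Z; apply:
      (@integrable01_fejer_sum N (fun x k => _)) => k.
  - by apply: (@integrable01_fejer_sum N (fun x k => _)) => k; exact: j2.
rewrite integral01B//; last by apply: integrable01Z; apply:
    (@integrable01_fejer_sum N (fun x k => _)) => k.
rewrite integral01Z; last by apply: (@integrable01_fejer_sum N (fun x k => _))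
    => k.
rewrite (@integral01_fejer_sum N (fun x k => _)); last by move=> k; exact: j1.
rewrite (@integral01_fejer_sum N (fun x k => _)); last by move=> k; exact: j2.
rewrite /fejer_form.
have -> : integral01 (fun x => f x * f x) = integral01 (fun x => f x ^+ 2).
  by apply: eq_integral01 => x _; rewrite expr2.
(* Integration in [x] kills every frequency but 0, whose Fejer weight is 1. So [f y ^+ 2]
   contributes as much as [f x ^+ 2], whence the factor 2 in the statement. *)
have -> : fejer_sum N (fun k => integral01 (fun x => cos_mode k x * cos_coef
    (fun x => f x ^+ 2) k +
                          sin_mode k x * sin_coef (fun x => f x ^+ 2) k)) =
          integral01 (fun x => f x ^+ 2).
  rewrite (@eq_fejer_sum _ _ (fun k => cos_coef (fun x => f x ^+ 2) 0 * (k ==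
      0)%:R)).
    rewrite fejer_sumZ fejer_delta0// mulr1; apply: eq_integral01 => x _.
    by rewrite /cos_mode mulr0 mul0r cos0 mulr1.
  move=> k.
  transitivity (integral01 (fun x => cos_coef (fun x => f x ^+ 2) k * cos_mode
      k x +
                          sin_coef (fun x => f x ^+ 2) k * sin_mode k x)).
    by apply: eq_integral01 => x _; ring.
  rewrite integral01D ?integral01Z ?integral01_cos_mode ?integral01_sin_mode//.
  - by rewrite mulr0 addr0; case: eqP => [->|]//; rewrite !mulr0.
  - exact/integrable01_cont/sin_mode_cont.
  - exact/integrable01_cont/cos_mode_cont.
  - exact/integrable01Z/integrable01_cont/cos_mode_cont.
  - exact/integrable01Z/integrable01_cont/sin_mode_cont.
have -> : fejer_sum N (fun k => integral01 (fun x => cos_coef f k * (f x *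
    cos_mode k x) +
    sin_coef f k * (f x * sin_mode k x))) = fejer_sum N (coef_dot f f).
  apply: eq_fejer_sum => k; rewrite integral01D ?integral01Z//.
  - exact: integrable01_sin_mode.
  - exact: integrable01_cos_mode.
  - by apply: integrable01Z; exact: integrable01_cos_mode.
  - by apply: integrable01Z; exact: integrable01_sin_mode.
ring.
Qed.

Lemma fejer_form_ge0 N f : (0 < N)%N -> L2 f -> 0 <= fejer_form N f f.
Proof.
move=> N0 hf; rewrite -(pmulr_rge0 _ (ltr0n _ 2)) fejer_form_energy//.
apply: integral01_ge0 => x _; apply: integral01_ge0 => y _.
by rewrite mulr_ge0 ?fejer_kernel_ge0 ?sqr_ge0.
Qed.

Lemma cos_coef_lin c f g k : integrable01 f -> integrable01 g ->
  cos_coef (fun x => c * f x + g x) k = c * cos_coef f k + cos_coef g k.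
Proof.
move=> hf hg; rewrite /cos_coef -integral01Z; last exact: integrable01_cos_mode.
rewrite -integral01D; [|by apply: integrable01Z; exact:
    integrable01_cos_mode|exact: integrable01_cos_mode].
by apply: eq_integral01 => x _; ring.
Qed.

Lemma sin_coef_lin c f g k : integrable01 f -> integrable01 g ->
  sin_coef (fun x => c * f x + g x) k = c * sin_coef f k + sin_coef g k.
Proof.
move=> hf hg; rewrite /sin_coef -integral01Z; last exact: integrable01_sin_mode.
rewrite -integral01D; [|by apply: integrable01Z; exact:
    integrable01_sin_mode|exact: integrable01_sin_mode].
by apply: eq_integral01 => x _; ring.
Qed.

Lemma fejer_form_quad N c f g : L2 f -> L2 g ->
  fejer_form N (fun x => c * f x + g x) (fun x => c * f x + g x) =
  fejer_form N f f * c ^+ 2 + 2 * fejer_form N f g * c + fejer_form N g g.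
Proof.
move=> hf hg; have if_ := L2_integrable01 hf; have ig_ := L2_integrable01 hg.
have i1 : integrable01 (fun x => f x * f x) by exact: integrable01_L2M.
have i2 : integrable01 (fun x => f x * g x) by exact: integrable01_L2M.
have i3 : integrable01 (fun x => g x * g x) by exact: integrable01_L2M.
rewrite /fejer_form.
have -> : integral01 (fun x => (c * f x + g x) * (c * f x + g x)) =
   c ^+ 2 * integral01 (fun x => f x * f x) + 2 * c * integral01 (fun x => f x
       * g x) +
   integral01 (fun x => g x * g x).
  rewrite -!integral01Z// -integral01D ?(integrable01Z)// -integral01D//; last
      by apply: integrable01D; exact: integrable01Z.
  by apply: eq_integral01 => x _; ring.
have -> : fejer_sum N (coef_dot (fun x => c * f x + g x) (fun x => c * f x + g
    x)) =
   c ^+ 2 * fejer_sum N (coef_dot f f) + 2 * c * fejer_sum N (coef_dot f g) +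
   fejer_sum N (coef_dot g g).
  rewrite -!fejer_sumZ -!fejer_sumD; apply: eq_fejer_sum => k.
  by rewrite /coef_dot cos_coef_lin// sin_coef_lin//; ring.
ring.
Qed.

Lemma fejer_form_cauchy N f g : (0 < N)%N -> L2 f -> L2 g ->
  fejer_form N f g ^+ 2 <= fejer_form N f f * fejer_form N g g.
Proof.
move=> N0 hf hg; apply: discriminant; first exact: fejer_form_ge0.
move=> t; rewrite -fejer_form_quad//; apply: fejer_form_ge0 => //.
by apply: L2D => //; exact: L2Z.
Qed.

Lemma fejer_form_le N f : fejer_form N f f <= integral01 (fun x => f x ^+ 2).
Proof.
have -> : integral01 (fun x => f x ^+ 2) = integral01 (fun x => f x * f x).
  by apply: eq_integral01 => x _; rewrite expr2.
rewrite /fejer_form lerBlDr lerDl /fejer_sum mulr_ge0 ?invr_ge0//.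
apply: sumr_ge0 => i _; apply: sumr_ge0 => j _.
by rewrite /coef_dot -!expr2 addr_ge0// sqr_ge0.
Qed.

(** Writing [F] for the quadratic form, [2 F(f - g) + 2 F(g) - F(f) = F(f - 2 g) >= 0], and
    [F(f - g)] is at most the squared L2 distance. This carries the density argument. *)
Lemma fejer_form_split N f g : (0 < N)%N -> L2 f -> L2 g ->
  fejer_form N f f <= 2 * integral01 (fun x => (f x - g x) ^+ 2) + 2 *
      fejer_form N g g.
Proof.
move=> N0 hf hg.
have hh : L2 (fun x => -1 * g x + f x) by apply: L2D => //; exact: L2Z.
have h1 := fejer_form_quad N (-1) hg hf.
have h2 := fejer_form_le N (fun x => -1 * g x + f x).
have h3 : integral01 (fun x => (-1 * g x + f x) ^+ 2) = integral01 (fun x => (f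
    x - g x) ^+ 2).
  by apply: eq_integral01 => x _; ring.
have h4 := fejer_form_quad N (-2) hg hf.
have h5 : 0 <= fejer_form N (fun x => -2 * g x + f x) (fun x => -2 * g x + f x).
  by apply: fejer_form_ge0 => //; apply: L2D => //; exact: L2Z.
nra.
Qed.

End Fejer.

(** * Parseval's identity *)

Section Parseval.
Variable R : realType.
Implicit Types (f g h : R -> R) (c x y z e : R) (k m : int) (N : nat).
Local Notation mu := (@lebesgue_measure R).
Local Notation D := (`[(0:R), 1]%classic : set R).
Local Notation mfun f := (@measurable_fun _ _ (measurableTypeR R) R D f).

(* Truncation to [[-c, c]]; this closed form makes it visibly continuous. *)
Definition clip c z : R := 2^-1 * (`|z + c| - `|z - c|).

Lemma clip_le c z : 0 <= c -> `|clip c z| <= c.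
Proof.
move=> c0; rewrite /clip ler_norml.
by case: (ger0P (z + c)) => ?; case: (ger0P (z - c)) => ?; lra.
Qed.

Lemma clip_lip c y z : `|clip c y - clip c z| <= `|y - z|.
Proof.
rewrite /clip ler_norml.
by case: (ger0P (y + c)) => ?; case: (ger0P (y - c)) => ?;
  case: (ger0P (z + c)) => ?; case: (ger0P (z - c)) => ?;
  case: (ger0P (y - z)) => ?; lra.
Qed.

Lemma clip_id c z : `|z| <= c -> clip c z = z.
Proof.
rewrite /clip ler_norml.
by case: (ger0P (z + c)) => ?; case: (ger0P (z - c)) => ? h; lra.
Qed.

Lemma clip_sub_le c z : 0 <= c -> `|z - clip c z| <= `|z|.
Proof.
move=> c0; rewrite /clip ler_norml.
by case: (ger0P (z + c)) => ?; case: (ger0P (z - c)) => ?;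
  case: (ger0P z) => ?; lra.
Qed.

Lemma clip_cont c : continuous (clip c).
Proof.
move=> z; rewrite /clip; apply: cvgM; first exact: cvg_cst.
apply: cvgB; apply: cvg_norm.
  by apply: cvgD; [exact: cvg_id|exact: cvg_cst].
by apply: cvgB; [exact: cvg_id|exact: cvg_cst].
Qed.

Lemma clip_mfun c f : mfun f -> mfun (fun x => clip c (f x)).
Proof.
move=> mf; apply: (@measurableT_comp _ _ _ _ _ _ (clip c)) => //.
exact: continuous_measurable_fun (@clip_cont c).
Qed.

Lemma cvg0_integral01 (u : nat -> R -> R) :
  (\int[mu]_(x in D) (u n x)%:E)%E @[n --> \oo] --> 0%E ->
  forall e, 0 < e -> exists N0, forall n, (N0 <= n)%N -> `|integral01 (u n)| <=
      e.
Proof.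
move=> /fine_cvgP[_ /cvgrPdist_le h] e /h [N0 _ hN].
by exists N0 => n /hN /=; rewrite sub0r normrN.
Qed.

Lemma L2_clip_approx f e : L2 f -> 0 < e ->
  exists2 c, 0 < c & integral01 (fun x => (f x - clip c (f x)) ^+ 2) <= e.
Proof.
move=> [mf hf] e0.
pose u (n : nat) x := (f x - clip n%:R (f x)) ^+ 2.
have mu_ n : mfun (u n).
  by apply: measurable_funX; apply: measurable_funB => //; exact: clip_mfun.
have hu n x : `|u n x| <= f x ^+ 2.
  rewrite /u normrX -(real_normK (num_real (f x))) lerXn2r ?nnegrE//.
  exact: clip_sub_le.
have := @dominated_convergence _ _ _ mu D (@measurable01 R) (fun n => EFin \o u
    n)
  (fun=> 0%E) (fun x => (f x ^+ 2)%:E).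
case.
- by move=> n; exact/measurable_EFinP.
- exact: measurable_cst.
- apply: aeW => x _; apply: cvg_near_cst.
  (* From this index on, the truncation leaves [f x] unchanged. *)
  exists (Num.truncn `|f x|).+1 => // n /= hn.
  rewrite /u clip_id ?subrr ?expr0n//.
  by apply: ltW; apply: lt_le_trans (truncnS_gt _) _; rewrite ler_nat.
- exact: hf.
- by apply: aeW => x n _; rewrite /= lee_fin hu.
move=> _ _; rewrite integral0 => /cvg0_integral01 /(_ e e0)[N0 hN].
exists N0.+1%:R; first by rewrite ltr0n.
by apply: le_trans (ler_norm _) _; apply: hN.
Qed.

(** Density in L1 is upgraded to L2 by truncation: once [h] and [g] are both bounded by [c],
    [(h - g)^2] is at most [2 c |h - g|], and truncating the continuous approximant does not move it
    away from [h]. *)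
Lemma L2_cont_approx f e : L2 f -> 0 < e -> exists g c,
  [/\ continuous g, forall x, `|g x| <= c &
      integral01 (fun x => (f x - g x) ^+ 2) <= e].
Proof.
move=> hf e0; have e4 : 0 < e / 4 by rewrite divr_gt0.
have [c c0 hc] := L2_clip_approx hf e4.
have [mf _] := hf.
pose h x := clip c (f x).
have hb x : `|h x| <= c by apply: clip_le; exact: ltW.
have mh : mfun h by exact: clip_mfun.
have h2 : L2 h by apply: (L2_bnd mh).
have muy : (mu D < +oo)%E by rewrite lebesgue_measure01 ltry.
have [g_ [gc gi]] :=
  @approximation_continuous_integrable R D h (@measurable01 R) muy
      (L2_integrable01 h2).
(* Multiplied by [2 c] this tolerance is [e / 4]; with the [e / 4] of the first truncation, both
   doubled below, the total is [e]. *)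
move=> /(@cvg0_integral01 (fun n z => `|h z - g_ n z|)) /(_ (e / (8 * c))).
case; first by rewrite divr_gt0// mulr_gt0.
move=> n /(_ n (leqnn n)) hn; pose g x := clip c (g_ n x).
have cg : continuous g.
  by move=> x; apply: (@continuous_comp _ _ _ (g_ n) (clip c));
    [exact: gc|exact: clip_cont].
have gb x : `|g x| <= c by apply: clip_le; exact: ltW.
have g2 : L2 g by apply: (L2_bnd (c := c)) => //; exact: cont_mfun.
exists g, c; split => //.
have hd1 : L2 (fun x => f x - h x) by exact: L2B.
have hd2 : L2 (fun x => h x - g x) by exact: L2B.
have hd3 : L2 (fun x => f x - g x) by exact: L2B.
have step : integral01 (fun x => (f x - g x) ^+ 2) <=
   2 * integral01 (fun x => (f x - h x) ^+ 2) + 2 * integral01 (fun x => (h x -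
       g x) ^+ 2).
  have [_ i1] := hd1; have [_ i2] := hd2; have [_ i3] := hd3.
  rewrite -!integral01Z// -integral01D; [|exact: integrable01Z..].
  apply: le_integral01 => //; first by apply: integrable01D; exact:
      integrable01Z.
  by move=> x _; have := sqr_ge0 (f x - h x - (h x - g x)); nra.
apply: le_trans step _.
suff : integral01 (fun x => (h x - g x) ^+ 2) <= e / 4.
  by move: hc; rewrite -/(h _); nra.
apply: (@le_trans _ _ (integral01 (fun x => 2 * c * `|h x - g_ n x|))).
  apply: le_integral01; [by case: hd2| |].
    by apply: integrable01Z; apply: integrable01_norm; apply: integrable01B;
        [exact: L2_integrable01|exact: gi].
  move=> x _; rewrite -(real_normK (num_real (h x - g x))) expr2.
  apply: ler_pM => //.
    by apply: le_trans (ler_normB _ _) _; move: (hb x) (gb x); lra.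
  have hE : h x = clip c (h x) by rewrite clip_id.
  by rewrite {1}hE; exact: clip_lip.
rewrite integral01Z; last by apply: integrable01_norm; apply: integrable01B;
    [exact: L2_integrable01|exact: gi].
have := le_trans (ler_norm _) hn; rewrite ler_pdivlMr ?mulr_gt0//; lra.
Qed.

(** * Concentration of the Fejer kernel on the diagonal *)

Lemma cos_le (a b : R) : 0 <= a -> a <= b -> b <= pi -> cos b <= cos a.
Proof.
move=> a0; rewrite le_eqVlt => /predU1P[->//|ab] bpi.
have b0 : 0 <= b by lra.
have api : a <= pi by lra.
by rewrite ltW// ltr_cos ?in_itv/= ?a0 ?b0 ?bpi ?api.
Qed.

Lemma cont_sqr_sub g c : continuous g -> continuous (fun y => (c - g y) ^+ 2).
Proof.
move=> gc.
have -> : (fun y => (c - g y) ^+ 2) = (fun y => (c - g y) * (c - g y)).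
  by apply/funext => y; rewrite expr2.
by move=> y; apply: cvgM; apply: cvgB; [exact: cvg_cst|exact: gc|
  exact: cvg_cst|exact: gc].
Qed.

(** The two hypotheses say that the distance of [x] and [y] on the circle is at least [d]. Parity
    and periodicity bring [x - y] into [[d, 1/2]], where the cosine decreases. *)
Lemma cos_mode1_le (d x y : R) : 0 < d -> d <= 2^-1 -> d <= `|x - y| ->
  `|x - y| <= 1 - d -> cos_mode 1 (x - y) <= cos_mode 1 d.
Proof.
move=> d0 d2 dxy xyd.
have mono (a : R) : d <= a -> a <= 2^-1 -> cos_mode 1 a <= cos_mode 1 d.
  move=> da a2; rewrite /cos_mode /= !mulr1.
  have p0 := pi_gt0 R.
  by apply: cos_le; nra.
have -> : cos_mode 1 (x - y) = cos_mode 1 `|x - y|.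
  by case: (ger0P (x - y)) => // _; rewrite /cos_mode mulrN cosN.
have [h|h] := leP `|x - y| 2^-1; first exact: mono.
have -> : cos_mode 1 `|x - y| = cos_mode 1 (1 - `|x - y|).
  rewrite /cos_mode mulrBr mulr1 -[RHS]cosN opprB.
  by rewrite -[RHS](cosD2pin _ 1) subrK.
by apply: mono; lra.
Qed.

(** Near the diagonal continuity makes [(g x - g y)^2] small; elsewhere it is dominated by a
    multiple of [1 - cos_mode 1 (x - y)], whose integral against the kernel is [1 / N]. The
    endpoints are excluded because [g 0] and [g 1] may differ. *)
Lemma energy_cvg0 g c : continuous g -> (forall x, `|g x| <= c) ->
  forall x, 0 < x < 1 -> forall e, 0 < e ->
  exists N0, forall N, (N0 <= N)%N -> (0 < N)%N -> energy N g x <= e.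
Proof.
move=> gc gb x /andP[x0 x1] e e0.
have c0 : 0 <= c by apply: le_trans (gb 0).
have e2 : 0 < Num.sqrt (e / 2) by rewrite sqrtr_gt0 divr_gt0.
have /cvgrPdist_le/(_ _ e2)/nbhs_ballP[d0 /= d00 hd0] := gc x.
(* The bound [d0 / 2] stays within the continuity radius; the two others give [d <= 1/2] and
   [|x - y| <= 1 - d] for all [y] in [[0, 1]], so that wrapping around the circle brings no [y]
   close to [x]. *)
pose d := Num.min (d0 / 2) (Num.min (x / 2) ((1 - x) / 2)).
have d_0 : 0 < d by rewrite /d !lt_min !divr_gt0 ?subr_gt0.
have [dd0 [dx d1x]] : d <= d0 / 2 /\ d <= x / 2 /\ d <= (1 - x) / 2.
  by rewrite /d !ge_min !lexx !orbT.
have w1 : cos_mode 1 d < 1.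
  rewrite /cos_mode -[X in _ < X](@cos0 R) mulr1.
  have p0 := pi_gt0 R.
  by rewrite ltr_cos ?in_itv/= ?lexx; nra.
(* Chosen so that [C (1 - cos_mode 1 (x - y))] exceeds the trivial bound [4 c^2] at distance at
   least [d]. *)
pose C := 4 * c ^+ 2 / (1 - cos_mode 1 d).
have C0 : 0 <= C by rewrite /C divr_ge0 ?mulr_ge0 ?sqr_ge0// subr_ge0 ltW.
have key y : y \in `[(0:R), 1] ->
    (g x - g y) ^+ 2 <= e / 2 + C * (1 - cos_mode 1 (x - y)).
  rewrite in_itv/= => /andP[y0 y1].
  have wle : 0 <= 1 - cos_mode 1 (x - y) by rewrite subr_ge0 cos_le1.
  have [h|h] := ltP `|x - y| d.
    have := hd0 y; rewrite /ball /= => /(_ ltac:(by move: d_0; lra)) hy.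
    rewrite -(real_normK (num_real _)).
    have := lerXn2r 2 (normr_ge0 (g x - g y)) (ltW e2) hy.
    rewrite sqr_sqrtr; last by rewrite divr_ge0// ltW.
    by have := mulr_ge0 C0 wle; lra.
  have hw : cos_mode 1 (x - y) <= cos_mode 1 d.
    apply: cos_mode1_le => //; first by lra.
    by rewrite ler_norml; apply/andP; split; lra.
  have h4 : (g x - g y) ^+ 2 <= 4 * c ^+ 2.
    rewrite -(real_normK (num_real _)).
    have -> : 4 * c ^+ 2 = (2 * c) ^+ 2 by ring.
    rewrite lerXn2r ?nnegrE ?mulr_ge0//.
    by apply: le_trans (ler_normB _ _) _; move: (gb x) (gb y); lra.
  have : 4 * c ^+ 2 <= C * (1 - cos_mode 1 (x - y)).
    rewrite /C -mulrA ler_peMr ?mulr_ge0 ?sqr_ge0// mulrC ler_pdivlMr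
        ?subr_gt0//.
    by lra.
  by lra.
exists (Num.truncn (2 * C / e)).+1 => N hN N0.
have NC : C / N%:R <= e / 2.
  rewrite ler_pdivrMr ?ltr0n//.
  have : 2 * C / e < N%:R.
    by apply: lt_le_trans (truncnS_gt _) _; rewrite ler_nat.
  by rewrite ltr_pdivrMr//; lra.
have cw : continuous (fun y => 1 - cos_mode 1 (x - y)).
  by move=> y; apply: cvgB; [exact: cvg_cst|exact: cont_shift_cos_mode].
have i1 : integrable01 (fun y => fejer_kernel N (x - y) * 1) by
    exact/integrable01_fejer_kernel/integrable01_cst.
have i2 : integrable01 (fun y => fejer_kernel N (x - y) * (1 - cos_mode 1 (x -
    y))).
  by apply: integrable01_fejer_kernel; exact: integrable01_cont.
apply: (@le_trans _ _ (integral01 (fun y => e / 2 * (fejer_kernel N (x - y) *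
    1) +
    C * (fejer_kernel N (x - y) * (1 - cos_mode 1 (x - y)))))).
  apply: le_integral01.
  - by apply: integrable01_fejer_kernel; apply: integrable01_cont; exact:
      cont_sqr_sub.
  - by apply: integrable01D; exact: integrable01Z.
  - by move=> y yD; have := ler_wpM2l (fejer_kernel_ge0 N (x - y)) (key y yD);
      lra.
rewrite integral01D; [|exact: integrable01Z|exact: integrable01Z].
rewrite (integral01Z _ i1) (integral01Z _ i2) integral01_fejer_kernel_1subcos//.
have -> : integral01 (fun y => fejer_kernel N (x - y) * 1) = 1.
  transitivity (integral01 (fun y => fejer_kernel N (x - y))); last exact:
      integral01_fejer_kernel.
  by apply: eq_integral01 => y _; rewrite mulr1.
by rewrite mulr1; lra.
Qed.

Lemma energy_ge0 N g x : 0 <= energy N g x.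
Proof. by apply: integral01_ge0 => y _; rewrite mulr_ge0 ?fejer_kernel_ge0
    ?sqr_ge0. Qed.

Lemma energy_le N g c x : (0 < N)%N -> continuous g ->
  (forall x, `|g x| <= c) -> energy N g x <= 4 * c ^+ 2.
Proof.
move=> N0 gc gb.
have c0 : 0 <= c by apply: le_trans (gb 0).
have i1 : integrable01 (fun y => fejer_kernel N (x - y) * 1) by
    exact/integrable01_fejer_kernel/integrable01_cst.
apply: (@le_trans _ _ (integral01 (fun y => 4 * c ^+ 2 * (fejer_kernel N (x -
    y) * 1)))).
  apply: le_integral01.
  - by apply: integrable01_fejer_kernel; apply: integrable01_cont; exact:
      cont_sqr_sub.
  - exact: integrable01Z.
  - move=> y _; rewrite mulr1 mulrC ler_wpM2r ?fejer_kernel_ge0//.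
    rewrite -(real_normK (num_real _)).
    have -> : 4 * c ^+ 2 = (2 * c) ^+ 2 by ring.
    rewrite lerXn2r ?nnegrE ?mulr_ge0//.
    by apply: le_trans (ler_normB _ _) _; move: (gb x) (gb y); lra.
rewrite (integral01Z _ i1).
have -> : integral01 (fun y => fejer_kernel N (x - y) * 1) = 1.
  transitivity (integral01 (fun y => fejer_kernel N (x - y))); last exact:
      integral01_fejer_kernel.
  by apply: eq_integral01 => y _; rewrite mulr1.
by rewrite mulr1.
Qed.

Lemma fejer_form_cont_cvg0 g c : continuous g -> (forall x, `|g x| <= c) ->
  forall e, 0 < e -> exists N0, forall N, (N0 <= N)%N -> (0 < N)%N ->
  fejer_form N g g <= e.
Proof.
move=> gc gb e e0.
have g2 : L2 g by apply: (@L2_bnd _ _ c) => //; exact: cont_mfun.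
have := @dominated_convergence _ _ _ mu D (@measurable01 R)
  (fun n => EFin \o energy n.+1 g) (fun=> 0%E) (fun=> (4 * c ^+ 2)%:E).
case.
- by move=> n; apply/measurable_EFinP; apply: integrable01_meas; exact:
    integrable01_energy.
- exact: measurable_cst.
(* Pointwise convergence is available at interior points; the two endpoints form a null set. *)
- have : mu.-negligible ([set 0; 1] : set R).
    exists [set 0; 1]; split => //.
      by apply: measurableU; exact: measurable_set1.
    by apply: countable_lebesgue_measure0; exact: finite_set_countable.
  move=> [B [mB B0 hB]]; exists B; split => //= x /= hx; apply: hB => /=.
  apply: contrapT => /not_orP[x0 x1]; apply: hx => xD.
  have {}xD : 0 < x < 1.
    move: xD; rewrite in_itv/= => /andP[a b].
    by rewrite !lt_neqAle a b !andbT; apply/andP; split; apply/eqP => // /esym.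
  apply/fine_cvgP; split; first exact: nearW.
  apply/cvgrPdist_le => e' /(energy_cvg0 gc gb xD)[N0 hN0].
  exists N0 => // n /= hn; rewrite sub0r normrN ger0_norm ?energy_ge0//.
  by apply: hN0 => //; exact: leqW.
- exact: integrable01_cst.
- by apply: aeW => x n _; rewrite /= lee_fin ger0_norm ?energy_ge0// energy_le.
move=> _ _; rewrite integral0 => /cvg0_integral01 /(_ e e0)[N0 hN].
exists N0.+1 => -[//|N] hNN _.
have := fejer_form_energy (ltn0Sn N) g2; have := hN _ hNN.
have := fejer_form_ge0 (ltn0Sn N) g2; have := ler_norm (integral01 (energy N.+1
    g)); lra.
Qed.

Lemma fejer_form_cvg0 f : L2 f -> forall e, 0 < e ->
  exists N0, forall N, (N0 <= N)%N -> (0 < N)%N -> fejer_form N f f <= e.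
Proof.
move=> hf e e0; have e4 : 0 < e / 4 by rewrite divr_gt0.
have [g [c [gc gb hg]]] := L2_cont_approx hf e4.
have g2 : L2 g by apply: (@L2_bnd _ _ c) => //; exact: cont_mfun.
have [N0 hN0] := fejer_form_cont_cvg0 gc gb e4.
exists N0 => N hN N1; have := fejer_form_split N1 hf g2; have := hN0 N hN N1;
    lra.
Qed.

(** By Cauchy-Schwarz for the Fejer form, the squared defect of the pair is at most the defect of
    [f] times the integral of [g ^ 2]; only the first factor has to tend to 0. *)
Lemma parseval_lim f g : L2 f -> L2 g -> forall e, 0 < e ->
  exists N0, forall N, (N0 <= N)%N -> (0 < N)%N ->
  `|integral01 (fun x => f x * g x) - fejer_sum N (coef_dot f g)| <= e.
Proof.
move=> hf hg e e0.
pose b := integral01 (fun x => g x ^+ 2).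
have b0 : 0 <= b by apply: integral01_ge0 => x _; exact: sqr_ge0.
have b1 : 0 < 1 + b by lra.
have e1 : 0 < e ^+ 2 / (1 + b) by rewrite divr_gt0// exprn_gt0.
have [N0 hN0] := fejer_form_cvg0 hf e1.
exists N0 => N hN N1; have h1 := hN0 N hN N1.
have h2 := fejer_form_cauchy N1 hf hg; have h3 := fejer_form_le N g; rewrite
    -/b in h3.
have h4 := fejer_form_ge0 N1 hf; have h5 := fejer_form_ge0 N1 hg.
rewrite ler_pdivlMr// in h1.
rewrite -/(fejer_form N f g) -(ler_pXn2r (n := 2))// ?nnegrE ?ltW//.
rewrite real_normK ?num_real//.
have : fejer_form N f f * fejer_form N g g <= fejer_form N f f * b by apply:
    ler_wpM2l.
by nra.
Qed.

End Parseval.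

(** * Weighted convolution estimates *)

Section Weights.
Variable R : realType.
Implicit Types (a b r s x : R) (k l j : int) (N : nat).

Lemma ler_sum_sub (T : eqType) (s t : seq T) (F : T -> R) :
  uniq s -> uniq t -> {subset s <= t} -> (forall i, 0 <= F i) ->
  \sum_(i <- s) F i <= \sum_(i <- t) F i.
Proof.
move=> us ut st F0.
rewrite (perm_big [seq i <- t | i \in s])/=; last first.
  apply: uniq_perm => //; first exact: filter_uniq.
  by move=> i; rewrite mem_filter; apply/idP/andP => [h|[]//]; split=> //;
      exact: st.
rewrite big_filter big_mkcond /=; apply: ler_sum => i _.
by case: ifP.
Qed.

(** The square of the bracket [<k>]: [weight k] to the power [r] is the weight of the squared [H^r]
    norm, and a negative power of it is summable over the integers when its exponent is below
    -1/2. *)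
Definition weight k : R := 1 + (2 * pi * k%:~R) ^+ 2.

Lemma weight_ge1 k : 1 <= weight k. Proof. by rewrite lerDl sqr_ge0. Qed.

Lemma weight_gt0 k : 0 < weight k. Proof. exact: lt_le_trans ltr01 (weight_ge1
    k). Qed.

Lemma powR_le_base (x y r : R) : 0 < x -> x <= y -> 0 <= r -> x `^ r <= y `^ r.
Proof.
move=> x0 xy r0; apply: ge0_ler_powR => //; rewrite nnegrE ltW//.
exact: lt_le_trans xy.
Qed.

Lemma powRN_le_base (x y r : R) : 0 < x -> x <= y -> 0 <= r ->
  y `^ (- r) <= x `^ (- r).
Proof.
move=> x0 xy r0; rewrite !powRN lef_pV2 ?posrE ?powR_gt0//.
  exact: powR_le_base.
exact: lt_le_trans xy.
Qed.

(** The larger of [|j|] and [|k - j|] is at least [|k| / 2]; squaring gives the factor 4. *)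
Lemma weight_sub k j : weight k <= 4 * Num.max (weight j) (weight (k - j)).
Proof.
have -> : weight k = 1 + (2 * pi) ^+ 2 * k%:~R ^+ 2 by rewrite /weight; ring.
have -> : weight j = 1 + (2 * pi) ^+ 2 * j%:~R ^+ 2 by rewrite /weight; ring.
have -> : weight (k - j) = 1 + (2 * pi) ^+ 2 * (k%:~R - j%:~R) ^+ 2.
  by rewrite /weight rmorphB /=; ring.
set p := (2 * pi) ^+ 2; have p0 : 0 <= p by exact: sqr_ge0.
move: (k%:~R : R) (j%:~R : R) => x y.
have [h|h] := leP (y ^+ 2) ((x - y) ^+ 2).
- have hx : x ^+ 2 <= 4 * (x - y) ^+ 2.
    by have := sqr_ge0 (x - 2 * y); nra.
  have := ler_wpM2l p0 hx.
  by rewrite (max_idPr _); [lra|rewrite lerD2l; exact: ler_wpM2l].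
- have hx : x ^+ 2 <= 4 * y ^+ 2.
    by have := sqr_ge0 (x - 2 * y); nra.
  have := ler_wpM2l p0 hx.
  by rewrite (max_idPl _); [lra|rewrite lerD2l; apply: ler_wpM2l => //; exact:
      ltW].
Qed.

Lemma weight_pow_sub s k j : 0 <= s ->
  weight k `^ s <= 4 `^ s * (weight j `^ s + weight (k - j) `^ s).
Proof.
move=> s0; apply: le_trans (powR_le_base (weight_gt0 k) (weight_sub k j) s0) _.
have := weight_gt0 j; have := weight_gt0 (k - j); move: (weight j) (weight (k -
    j)) => a b b0 a0.
rewrite powRM ?le_max ?(ltW a0)//; apply: ler_wpM2l; first exact: powR_ge0.
by case: (leP a b) => _; rewrite ?lerDr ?lerDl powR_ge0.
Qed.

(** The integral test in telescoping form: by the mean value theorem the difference is [d] times a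
    power [- (1 + d)] of a point below [N + 2]. *)
Lemma powR_telescope (d : R) N : 0 < d ->
  N.+2%:R `^ (- (1 + d)) <= d^-1 * (N.+1%:R `^ (- d) - N.+2%:R `^ (- d)).
Proof.
move=> d0.
have dF (x : R) : x \in `]N.+1%:R, N.+2%:R[ ->
    is_derive x 1 (@powR R ^~ (- d)) (- d * x `^ (- d - 1)).
  rewrite in_itv/= => /andP[x0 _]; apply: is_derive1_powR.
  by apply: lt_trans x0; rewrite ltr0n.
have N12 : N.+1%:R < N.+2%:R :> R by rewrite ltr_nat.
have := @MVT R (@powR R ^~ (- d)) (fun x => - d * x `^ (- d - 1)) _ _ N12 dF.
case.
  apply: derivable_within_continuous => x.
  rewrite in_itv/= => /andP[x0 _].
  have x1 : 0 < x by apply: lt_le_trans x0; rewrite ltr0n.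
  by have [] := is_derive1_powR (- d) x1.
move=> c; rewrite in_itv/= => /andP[c1 c2] E.
have c0 : 0 < c by apply: lt_trans c1; rewrite ltr0n.
have E' : N.+1%:R `^ (- d) - N.+2%:R `^ (- d) = d * c `^ (- d - 1).
  have : (N.+2%:R : R) - N.+1%:R = 1 by rewrite -[N.+2%:R]natr1 addrAC subrr
      add0r.
  by move=> e1; move: E; rewrite e1 mulr1 => E; rewrite -opprB E; ring.
rewrite E' mulKf ?gt_eqF//.
have -> : - d - 1 = - (1 + d) by ring.
by apply: powRN_le_base => //; [exact: ltW|lra].
Qed.

Lemma sum_powR_bound (d : R) N : 0 < d ->
  \sum_(i < N) i.+1%:R `^ (- (1 + d)) <= 1 + d^-1.
Proof.
move=> d0; case: N => [|N].
  by rewrite big_ord0 addr_ge0// invr_ge0 ltW.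
(* The remainder term is kept so that the induction telescopes. *)
suff : \sum_(i < N.+1) i.+1%:R `^ (- (1 + d)) <=
    1 + d^-1 * (1 - N.+1%:R `^ (- d)).
  move=> h; apply: le_trans h _; rewrite lerD2l; apply: ler_piMr.
    by rewrite invr_ge0 ltW.
  by rewrite lerBlDr lerDl powR_ge0.
elim: N => [|N ih].
  by rewrite big_ord_recl big_ord0 !powR1 subrr mulr0.
rewrite big_ord_recr /=; apply: le_trans (lerD ih (powR_telescope N d0)) _.
by rewrite -addrA -mulrDr addrA subrK.
Qed.

Lemma sum_weight_bound b : 2^-1 < b ->
  exists2 C, 0 <= C & forall s : seq int, uniq s ->
    \sum_(k <- s) weight k `^ (- b) <= C.
Proof.
move=> b2; pose d := 2 * b - 1; have d0 : 0 < d by rewrite /d; lra.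
have W1 (n : nat) : weight n.+1%:Z `^ (- b) <= n.+1%:R `^ (- (1 + d)).
  have -> : - (1 + d) = 2%:R * (- b) by rewrite /d; ring.
  rewrite powRrM powR_mulrn ?ler0n//.
  apply: powRN_le_base; [by rewrite exprn_gt0// ltr0n| |lra].
  rewrite /weight exprMn /= -pmulrn.
  have h : 1 <= (2 * pi : R) ^+ 2.
    by have := pi_ge2 R; nra.
  have := ler_wpM2r (sqr_ge0 (n.+1%:R : R)) h; lra.
have WN k : weight (- k) = weight k by rewrite /weight mulrNz; ring.
pose S N := \sum_(i < N) weight i.+1%:Z `^ (- b).
have SN N : S N <= 1 + d^-1.
  by apply: le_trans (sum_powR_bound N d0); apply: ler_sum.
have d1 : 0 < d^-1 by rewrite invr_gt0.
(* The frequency 0 contributes 1, and each half-line at most [1 + d^-1], because [weight n >= n^2]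
   and [2 b = 1 + d]. *)
exists (1 + 2 * (1 + d^-1)); first lra.
move=> s us.
pose N := (\max_(k <- s) `|k|)%N.
have sN k : k \in s -> (`|k| <= N)%N by move=> ks; rewrite /N (big_rem k)//=
    leq_maxl.
pose t := 0%:Z :: [seq i.+1%:Z | i <- iota 0 N] ++ [seq - i.+1%:Z | i <- iota 0
    N].
have ut : uniq t.
  rewrite /t cons_uniq cat_uniq !map_inj_uniq ?iota_uniq; last 2 first.
  - by move=> i j /oppr_inj [].
  - by move=> i j [].
  rewrite mem_cat andbT /=; apply/andP; split.
    by apply/negP => /orP[|] /mapP[i _]; lia.
  by apply/hasPn => _ /mapP[i _ ->]; apply/mapP => -[j _]; lia.
have st : {subset s <= t}.
  move=> k /sN kN; rewrite /t in_cons mem_cat.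
  have [->|k0] := eqVneq k 0; first by [].
  have [h|h] := leP 0 k; apply/orP; right; apply/orP; [left|right].
    by apply/mapP; exists (`|k|.-1)%N; [rewrite mem_iota|]; lia.
  by apply/mapP; exists (`|k|.-1)%N; [rewrite mem_iota|]; lia.
have F0 k : 0 <= weight k `^ (- b) by exact: powR_ge0.
have : \sum_(k <- s) weight k `^ (- b) <= \sum_(k <- t) weight k `^ (- b).
  exact: ler_sum_sub.
move=> h; apply: le_trans h _.
rewrite /t big_cons big_cat /= !big_map.
have -> : \sum_(i <- iota 0 N) weight i.+1%:Z `^ (- b) = S N.
  by rewrite /S -[N in iota 0 N]subn0 -/(index_iota 0 N) big_mkord.
have -> : \sum_(i <- iota 0 N) weight (- i.+1%:Z) `^ (- b) = S N.
  rewrite /S -[N in iota 0 N]subn0 -/(index_iota 0 N) big_mkord.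
  by apply: eq_bigr => i _; rewrite WN.
have -> : weight 0 `^ (- b) = 1 by rewrite /weight mulr0 expr0n addr0 powR1.
by have := SN N; lra.
Qed.

(** Putting both negative powers on the smaller of the two weights bounds each term by a sum of two
    terms with exponent [- (a + b)]. Translation by [l] only moves the index set, so the bound is
    independent of [l]. *)
Lemma sum_weight2_bound a b : 0 <= a -> 0 <= b -> 2^-1 < a + b ->
  exists2 C, 0 <= C & forall (s : seq int) l, uniq s ->
    \sum_(k <- s) weight k `^ (- a) * weight (k - l) `^ (- b) <= C.
Proof.
move=> a0 b0 /sum_weight_bound[C C0 hC]; exists (2 * C); first lra.
move=> s l us.
apply: (@le_trans _ _ (\sum_(k <- s) (weight k `^ (- (a + b)) + weight (k - l)
    `^ (- (a + b))))).
  apply: ler_sum => k _.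
  have := weight_gt0 k; have := weight_gt0 (k - l); move: (weight k) (weight (k
      - l)) => x y y0 x0.
  have p (z : R) : 0 < z -> z `^ (- (a + b)) = z `^ (- a) * z `^ (- b).
    by move=> z0; rewrite opprD powRD// (gt_eqF z0) implybT.
  rewrite !p//.
  have [h|h] := leP x y.
    have := powRN_le_base x0 h b0 => h1.
    have := ler_wpM2l (powR_ge0 x (- a)) h1.
    have := mulr_ge0 (powR_ge0 y (- a)) (powR_ge0 y (- b)); lra.
  have := powRN_le_base y0 (ltW h) a0 => h1.
  have := ler_wpM2r (powR_ge0 y (- b)) h1.
  have := mulr_ge0 (powR_ge0 x (- a)) (powR_ge0 x (- b)); lra.
rewrite big_split /=.
have h1 := hC s us.
have h2 : \sum_(k <- s) weight (k - l) `^ (- (a + b)) <= C.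
  rewrite -(big_map (fun k => k - l) predT (fun k => weight k `^ (- (a + b)))).
  by apply: hC; rewrite map_inj_uniq// => i j /addIr.
lra.
Qed.

Lemma cauchy_sum (s : seq int) (p q : int -> R) :
  (\sum_(j <- s) p j * q j) ^+ 2 <=
  (\sum_(j <- s) p j ^+ 2) * (\sum_(j <- s) q j ^+ 2).
Proof.
elim: s => [|j s ih]; first by rewrite !big_nil expr0n mulr0.
rewrite !big_cons.
set A := \sum_(j <- s) p j * q j in ih *.
set P := \sum_(j <- s) p j ^+ 2 in ih *.
set Q := \sum_(j <- s) q j ^+ 2 in ih *.
have P0 : 0 <= P by apply: sumr_ge0 => i _; exact: sqr_ge0.
have Q0 : 0 <= Q by apply: sumr_ge0 => i _; exact: sqr_ge0.
suff : 2 * (p j * q j) * A <= p j ^+ 2 * Q + q j ^+ 2 * P by nra.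
have [h|h] := leP (2 * (p j * q j) * A) 0.
  by apply: le_trans h _; rewrite addr_ge0// mulr_ge0// sqr_ge0.
rewrite -(ler_pXn2r (n := 2))// ?nnegrE ?(ltW h)//; last first.
  by rewrite addr_ge0// mulr_ge0// sqr_ge0.
have := sqr_ge0 (p j ^+ 2 * Q - q j ^+ 2 * P).
have := ler_wpM2l (sqr_ge0 (p j * q j)) ih; nra.
Qed.

Definition weighted_bound r (F : int -> R) x :=
  forall s : seq int, uniq s -> \sum_(k <- s) weight k `^ r * F k <= x.

Section Bilinear.
Variables (s r : R).
(** Here [r] is the order of the product itself, before the operator gains one derivative: it will
    be instantiated by [r - 1]. *)
Hypotheses (s0 : 0 <= s) (rs : r <= s) (r4 : 2 * r < 4 * s - 1).

(* Cauchy-Schwarz in [j] after splitting the summand as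
   [(P j <k - j>^-s) (<k - j>^s q (k - j))]. *)
Lemma half_bilinear : exists2 C, 0 <= C &
  forall (P q : int -> R) x y, (forall k, 0 <= P k) -> (forall k, 0 <= q k) ->
    weighted_bound 0 (fun k => P k ^+ 2) x -> weighted_bound s (fun k => q k ^+
        2) y ->
    forall S I : seq int, uniq S -> uniq I ->
    \sum_(k <- S) weight k `^ (- (s - r)) * (\sum_(j <- I) P j * q (k - j)) ^+ 2
      <= C * (x * y).
Proof.
have h1 : 0 <= s - r by rewrite subr_ge0.
(* The hypothesis [r4] is exactly the summability threshold for the pair of exponents [s - r] and
   [s]. *)
have h2 : 2^-1 < s - r + s by move: r4; lra.
have [C C0 hC] := sum_weight2_bound h1 s0 h2.
exists C => // P q x y P0 q0 hx hy S I uS uI.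
have y0 : 0 <= y by have := hy [::] isT; rewrite big_nil.
have x0 : 0 <= x by have := hx [::] isT; rewrite big_nil.
have step k : (\sum_(j <- I) P j * q (k - j)) ^+ 2 <=
    y * \sum_(j <- I) P j ^+ 2 * weight (k - j) `^ (- s).
  have -> : \sum_(j <- I) P j * q (k - j) =
     \sum_(j <- I) (P j * weight (k - j) `^ (- (s / 2))) * (weight (k - j) `^
         (s / 2) * q (k - j)).
    apply: eq_bigr => j _; rewrite mulrA -[P j * _ * _]mulrA -powRD; last first.
      by rewrite (gt_eqF (weight_gt0 _)) implybT.
    by rewrite addNr powRr0 mulr1.
  apply: le_trans (cauchy_sum _ _ _) _; rewrite mulrC.
  have sq (z : R) (j : int) : (weight j `^ (z / 2)) ^+ 2 = weight j `^ z.
    by rewrite -powR_mulrn ?powR_ge0// -powRrM mulfVK.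
  have E1 : \sum_(j <- I) (P j * weight (k - j) `^ (- (s / 2))) ^+ 2 =
      \sum_(j <- I) P j ^+ 2 * weight (k - j) `^ (- s).
    by apply: eq_bigr => j _; rewrite exprMn -mulNr sq.
  have E2 : \sum_(j <- I) (weight (k - j) `^ (s / 2) * q (k - j)) ^+ 2 =
      \sum_(j <- I) weight (k - j) `^ s * q (k - j) ^+ 2.
    by apply: eq_bigr => j _; rewrite exprMn sq.
  rewrite E1 E2; apply: ler_wpM2r.
    by apply: sumr_ge0 => j _; rewrite mulr_ge0 ?sqr_ge0 ?powR_ge0.
  rewrite -(big_map (fun j => k - j) predT (fun l => weight l `^ s * q l ^+ 2)).
  by apply: hy; rewrite map_inj_uniq// => i j /addrI /oppr_inj.
apply: (@le_trans _ _ (\sum_(k <- S) weight k `^ (- (s - r)) *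
    (y * \sum_(j <- I) P j ^+ 2 * weight (k - j) `^ (- s)))).
  by apply: ler_sum => k _; apply: ler_wpM2l; [exact: powR_ge0|exact: step].
(* Exchanging the sums leaves, for each [j], an inner sum over [k] bounded by [C] uniformly in
   [j]. *)
have -> : \sum_(k <- S) weight k `^ (- (s - r)) *
    (y * \sum_(j <- I) P j ^+ 2 * weight (k - j) `^ (- s)) =
   y * \sum_(j <- I) P j ^+ 2 *
      \sum_(k <- S) weight k `^ (- (s - r)) * weight (k - j) `^ (- s).
  rewrite mulr_sumr; under [RHS]eq_bigr do rewrite !mulr_sumr.
  rewrite [RHS]exchange_big /=; apply: eq_bigr => k _.
  by rewrite !mulr_sumr; apply: eq_bigr => j _; ring.
have -> : C * (x * y) = y * (C * x) by ring.
apply: ler_wpM2l => //.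
apply: (@le_trans _ _ (\sum_(j <- I) P j ^+ 2 * C)).
  by apply: ler_sum => j _; apply: ler_wpM2l; [exact: sqr_ge0|exact: hC].
rewrite -mulr_suml mulrC; apply: ler_wpM2l => //.
have := hx I uI; under eq_bigr do rewrite powRr0 mul1r.
by [].
Qed.

(** Splitting the weight of order [s] between the two input frequencies gives two terms, each an
    instance of [half_bilinear] with [p] and [q] exchanged. *)
Lemma bilinear_bound : exists2 C, 0 <= C &
  forall (p q : int -> R) x y, (forall k, 0 <= p k) -> (forall k, 0 <= q k) ->
    weighted_bound s (fun k => p k ^+ 2) x -> weighted_bound s (fun k => q k ^+
        2) y ->
    forall S I : seq int, uniq S -> uniq I ->
    \sum_(k <- S) weight k `^ r * (\sum_(j <- I) p j * q (k - j)) ^+ 2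
      <= C * (x * y).
Proof.
have [C C0 hC] := half_bilinear.
have D0 : 0 <= (4 `^ (s / 2)) ^+ 2 :> R by exact: sqr_ge0.
(* One factor 2 from [(A + B)^2 <= 2 (A^2 + B^2)], another from the two half estimates;
   [4 ^ (s / 2)] is the cost of splitting the weight. *)
exists (4 * (4 `^ (s / 2)) ^+ 2 * C); first by rewrite !mulr_ge0.
move=> p q x y p0 q0 hx hy S I uS uI.
have sq (z : R) (j : int) : (weight j `^ (z / 2)) ^+ 2 = weight j `^ z.
  by rewrite -powR_mulrn ?powR_ge0// -powRrM mulfVK.
pose P k := weight k `^ (s / 2) * p k; pose Q k := weight k `^ (s / 2) * q k.
have P0 k : 0 <= P k by rewrite mulr_ge0 ?powR_ge0.
have Q0 k : 0 <= Q k by rewrite mulr_ge0 ?powR_ge0.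
have hP : weighted_bound 0 (fun k => P k ^+ 2) x.
  move=> t ut; have := hx t ut; under eq_bigr do rewrite -sq -exprMn.
  by under [X in _ -> X <= _]eq_bigr do rewrite powRr0 mul1r.
have hQ : weighted_bound 0 (fun k => Q k ^+ 2) y.
  move=> t ut; have := hy t ut; under eq_bigr do rewrite -sq -exprMn.
  by under [X in _ -> X <= _]eq_bigr do rewrite powRr0 mul1r.
(* After the substitution [l = k - j] the range of [l] depends on [k]; [L] is a common finite range
   for all [k] in [S], harmless to enlarge to as the terms are nonnegative. *)
pose L := undup [seq k - j | k <- S, j <- I].
have uL : uniq L by exact: undup_uniq.
pose A k := \sum_(j <- I) P j * q (k - j).
pose B k := \sum_(l <- L) Q l * p (k - l).
have key k : k \in S -> weight k `^ r * (\sum_(j <- I) p j * q (k - j)) ^+ 2 <=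
    2 * (4 `^ (s / 2)) ^+ 2 * (weight k `^ (- (s - r)) * A k ^+ 2 +
       weight k `^ (- (s - r)) * B k ^+ 2).
  move=> kS.
  have -> : weight k `^ r = weight k `^ (- (s - r)) * (weight k `^ (s / 2)) ^+
      2.
    by rewrite sq -powRD; [congr powR; ring|rewrite (gt_eqF (weight_gt0 _))
        implybT].
  have h : weight k `^ (s / 2) * (\sum_(j <- I) p j * q (k - j)) <=
      4 `^ (s / 2) * (A k + B k).
    apply: (@le_trans _ _ (4 `^ (s / 2) *
      (A k + \sum_(j <- I) Q (k - j) * p (k - (k - j))))).
      rewrite /A -big_split /= !mulr_sumr; apply: ler_sum => j _.
      rewrite subKr /P /Q.
      have s2 : 0 <= s / 2 by rewrite divr_ge0.
      have := ler_wpM2r (mulr_ge0 (p0 j) (q0 (k - j))) (weight_pow_sub k j s2);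
          lra.
    apply: ler_wpM2l; first exact: powR_ge0.
    rewrite lerD2l /B -(big_map (fun j => k - j) predT (fun l => Q l * p (k -
        l))).
    set t := map _ _.
    have ut : uniq t by rewrite map_inj_uniq// => i j /addrI /oppr_inj.
    have st : {subset t <= L}.
      move=> _ /mapP[j jI ->]; rewrite mem_undup.
      by apply/allpairsP; exists (k, j).
    by apply: ler_sum_sub => // l; rewrite mulr_ge0.
  have h0 : 0 <= weight k `^ (s / 2) * (\sum_(j <- I) p j * q (k - j)).
    by rewrite mulr_ge0 ?powR_ge0// sumr_ge0// => j _; rewrite mulr_ge0.
  rewrite -mulrA -exprMn.
  have : (weight k `^ (s / 2) * (\sum_(j <- I) p j * q (k - j))) ^+ 2 <=
      2 * (4 `^ (s / 2)) ^+ 2 * (A k ^+ 2 + B k ^+ 2).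
    apply: (@le_trans _ _ ((4 `^ (s / 2) * (A k + B k)) ^+ 2)).
      by rewrite lerXn2r ?nnegrE//; exact: le_trans h.
    have hAB : (A k + B k) ^+ 2 <= 2 * (A k ^+ 2 + B k ^+ 2).
      by have := sqr_ge0 (A k - B k); lra.
    by rewrite exprMn; apply: le_trans (ler_wpM2l D0 hAB) _; lra.
  move=> h2; have := ler_wpM2l (powR_ge0 (weight k) (- (s - r))) h2.
  by move=> h3; apply: le_trans h3 _; rewrite -mulrDr mulrCA.
apply: (@le_trans _ _ (\sum_(k <- S) 2 * (4 `^ (s / 2)) ^+ 2 *
   (weight k `^ (- (s - r)) * A k ^+ 2 + weight k `^ (- (s - r)) * B k ^+ 2))).
  rewrite big_seq [leRHS]big_seq; exact: ler_sum.
rewrite -mulr_sumr big_split /=.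
have hA := hC _ _ _ _ P0 q0 hP hy S I uS uI.
have hB := hC _ _ _ _ Q0 p0 hQ hx S L uS uL.
have : 2 * (4 `^ (s / 2)) ^+ 2 * (C * (x * y) + C * (y * x)) <=
  4 * (4 `^ (s / 2)) ^+ 2 * C * (x * y) by lra.
apply: le_trans; apply: ler_wpM2l; first by rewrite mulr_ge0.
exact: lerD.
Qed.

End Bilinear.
End Weights.

(** * Fourier coefficients of a product *)

Section ProductAmplitude.
Variable R : realType.
Implicit Types (f g : R -> R) (c x e : R) (k m j : int) (N : nat).

Definition amp f k : R := Num.sqrt (cos_coef f k ^+ 2 + sin_coef f k ^+ 2).

Lemma amp_ge0 f k : 0 <= amp f k. Proof. exact: sqrtr_ge0. Qed.

Lemma amp_sqr f k : amp f k ^+ 2 = cos_coef f k ^+ 2 + sin_coef f k ^+ 2.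
Proof. by rewrite sqr_sqrtr// addr_ge0// sqr_ge0. Qed.

Lemma cos_coefN f k : cos_coef f (- k) = cos_coef f k.
Proof. by apply: eq_integral01 => x _; rewrite /cos_mode mulrNz mulrN mulNr
    cosN. Qed.

Lemma sin_coefN f k : integrable01 f -> sin_coef f (- k) = - sin_coef f k.
Proof.
move=> hf; rewrite /sin_coef -[RHS]mulN1r -integral01Z; last exact:
    integrable01_sin_mode.
by apply: eq_integral01 => x _; rewrite /sin_mode mulrNz mulrN mulNr sinN
    mulN1r mulrN.
Qed.

Lemma ampN f k : integrable01 f -> amp f (- k) = amp f k.
Proof. by move=> hf; rewrite /amp cos_coefN sin_coefN// sqrrN. Qed.

(** For complex numbers [z] and [w], the real part of [z] times the conjugate of [w] is at most
    [|z| |w|]. *)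
Lemma dot_le (a b c d p q : R) : 0 <= p -> 0 <= q ->
  p ^+ 2 = a ^+ 2 + b ^+ 2 -> q ^+ 2 = c ^+ 2 + d ^+ 2 -> `|a * c + b * d| <= p
      * q.
Proof.
move=> p0 q0 hp hq; rewrite -(ler_pXn2r (n := 2))// ?nnegrE ?mulr_ge0//.
rewrite real_normK ?num_real// exprMn hp hq.
by have := sqr_ge0 (a * d - b * c); lra.
Qed.

Lemma integral01_lin2 f g (a b : R) : integrable01 f -> integrable01 g ->
  integral01 (fun x => a * f x + b * g x) = a * integral01 f + b * integral01 g.
Proof.
move=> hf hg; rewrite integral01D; [|exact: integrable01Z|exact: integrable01Z].
by rewrite !integral01Z.
Qed.

Lemma mode_prod k j x :
  [/\ cos_mode k x * cos_mode j x = 2^-1 * (cos_mode (k + j) x + cos_mode (k -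
      j) x),
      cos_mode k x * sin_mode j x = 2^-1 * (sin_mode (k + j) x - sin_mode (k -
          j) x),
      sin_mode k x * cos_mode j x = 2^-1 * (sin_mode (k + j) x + sin_mode (k -
          j) x) &
      sin_mode k x * sin_mode j x = 2^-1 * (cos_mode (k - j) x - cos_mode (k +
          j) x)].
Proof.
rewrite /cos_mode /sin_mode; set a := 2 * pi * k%:~R * x; set b := 2 * pi *
    j%:~R * x.
have -> : 2 * pi * (k + j)%:~R * x = a + b by rewrite /a /b rmorphD /=; ring.
have -> : 2 * pi * (k - j)%:~R * x = a - b by rewrite /a /b rmorphB /=; ring.
by rewrite cosD cosB sinD sinB; split; field.
Qed.

Lemma cos_coef_cos_mode g k j : integrable01 g ->
  cos_coef (fun x => g x * cos_mode k x) j = 2^-1 * cos_coef g (k + j) + 2^-1 *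
      cos_coef g (k - j).
Proof.
move=> hg; rewrite -integral01_lin2; [|exact: integrable01_cos_mode|exact:
    integrable01_cos_mode].
by apply: eq_integral01 => x _; rewrite -mulrA; have [-> _ _ _] := mode_prod k
    j x; ring.
Qed.

Lemma sin_coef_cos_mode g k j : integrable01 g ->
  sin_coef (fun x => g x * cos_mode k x) j = 2^-1 * sin_coef g (k + j) + (-
      2^-1) * sin_coef g (k - j).
Proof.
move=> hg; rewrite -integral01_lin2; [|exact: integrable01_sin_mode|exact:
    integrable01_sin_mode].
by apply: eq_integral01 => x _; rewrite -mulrA; have [_ -> _ _] := mode_prod k
    j x; ring.
Qed.

Lemma cos_coef_sin_mode g k j : integrable01 g ->
  cos_coef (fun x => g x * sin_mode k x) j = 2^-1 * sin_coef g (k + j) + 2^-1 *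
      sin_coef g (k - j).
Proof.
move=> hg; rewrite -integral01_lin2; [|exact: integrable01_sin_mode|exact:
    integrable01_sin_mode].
by apply: eq_integral01 => x _; rewrite -mulrA; have [_ _ -> _] := mode_prod k
    j x; ring.
Qed.

Lemma sin_coef_sin_mode g k j : integrable01 g ->
  sin_coef (fun x => g x * sin_mode k x) j = 2^-1 * cos_coef g (k - j) + (-
      2^-1) * cos_coef g (k + j).
Proof.
move=> hg; rewrite -integral01_lin2; [|exact: integrable01_cos_mode|exact:
    integrable01_cos_mode].
by apply: eq_integral01 => x _; rewrite -mulrA; have [_ _ _ ->] := mode_prod k
    j x; ring.
Qed.

(** Multiplication by a mode shifts the frequencies of [g] to [k + j] and [k - j]. As [f] is real,
    the first is read at [-j], so that the bound is the even part of the convolution summand, which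
    suits a Fejer sum. *)
Lemma coef_dot_cos_mode f g k j : integrable01 f -> integrable01 g ->
  `|coef_dot f (fun x => g x * cos_mode k x) j| <=
  2^-1 * (amp f (- j) * amp g (k - - j)) + 2^-1 * (amp f j * amp g (k - j)).
Proof.
move=> hf hg; rewrite ampN// opprK /coef_dot cos_coef_cos_mode//
    sin_coef_cos_mode//.
have -> : cos_coef f j * (2^-1 * cos_coef g (k + j) + 2^-1 * cos_coef g (k -
    j)) +
     sin_coef f j * (2^-1 * sin_coef g (k + j) + - 2^-1 * sin_coef g (k - j)) =
   2^-1 * (cos_coef f j * cos_coef g (k + j) + sin_coef f j * sin_coef g (k +
       j)) +
   2^-1 * (cos_coef f j * cos_coef g (k - j) + sin_coef f j * - sin_coef g (k -
       j)) by ring.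
apply: le_trans (ler_normD _ _) _; rewrite !normrM [`|2^-1|]ger0_norm
    ?invr_ge0//.
by apply: lerD; rewrite ler_wpM2l ?invr_ge0//; apply: dot_le;
  rewrite ?amp_ge0 ?amp_sqr ?sqrrN.
Qed.

Lemma coef_dot_sin_mode f g k j : integrable01 f -> integrable01 g ->
  `|coef_dot f (fun x => g x * sin_mode k x) j| <=
  2^-1 * (amp f (- j) * amp g (k - - j)) + 2^-1 * (amp f j * amp g (k - j)).
Proof.
move=> hf hg; rewrite ampN// opprK /coef_dot cos_coef_sin_mode//
    sin_coef_sin_mode//.
have -> : cos_coef f j * (2^-1 * sin_coef g (k + j) + 2^-1 * sin_coef g (k -
    j)) +
     sin_coef f j * (2^-1 * cos_coef g (k - j) + - 2^-1 * cos_coef g (k + j)) =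
   2^-1 * (cos_coef f j * sin_coef g (k + j) + sin_coef f j * - cos_coef g (k +
       j)) +
   2^-1 * (cos_coef f j * sin_coef g (k - j) + sin_coef f j * cos_coef g (k -
       j)) by ring.
apply: le_trans (ler_normD _ _) _; rewrite !normrM [`|2^-1|]ger0_norm
    ?invr_ge0//.
by apply: lerD; rewrite ler_wpM2l ?invr_ge0//; apply: dot_le;
  rewrite ?amp_ge0 ?amp_sqr ?sqrrN// addrC.
Qed.

Definition sym_range N : seq int := [seq i%:Z - N%:Z | i <- iota 0 N.*2.+1].

Lemma sym_range_uniq N : uniq (sym_range N).
Proof.
rewrite map_inj_uniq ?iota_uniq// => i j /addIr [].
by [].
Qed.

Lemma mem_sym_range N k : (`|k| <= N)%N -> k \in sym_range N.
Proof.
move=> kN; apply/mapP; exists (absz (k + N%:Z)).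
  by rewrite mem_iota; lia.
by lia.
Qed.

(** For each fixed [i], both [i - j] and [j - i] run injectively through [[-N, N]]; the [N] inner
    sums are thus at most the full sum each, and the prefactor [1 / N] averages them. *)
Lemma fejer_sum_le N (F G : int -> R) : (0 < N)%N -> (forall j, 0 <= G j) ->
  (forall j, `|F j| <= 2^-1 * G (- j) + 2^-1 * G j) ->
  `|fejer_sum N F| <= \sum_(j <- sym_range N) G j.
Proof.
move=> N0 G0 FG; set S := \sum_(j <- _) _.
have h (s : 'I_N -> 'I_N -> int) (i : 'I_N) : injective (s i) ->
    (forall j : 'I_N, (`|s i j| <= N)%N) -> \sum_(j < N) G (s i j) <= S.
  move=> inj sN; rewrite -(big_map (s i) predT G).
  apply: ler_sum_sub => //; first by rewrite map_inj_uniq ?index_enum_uniq.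
  - exact: sym_range_uniq.
  - by move=> _ /mapP[j _ ->]; exact: mem_sym_range.
rewrite /fejer_sum normrM ger0_norm ?invr_ge0 ?ler0n// ler_pdivrMl ?ltr0n//.
apply: le_trans (ler_norm_sum _ _ _) _.
rewrite mulr_natl -[X in _ *+ X]card_ord -sumr_const.
apply: ler_sum => i _.
apply: le_trans (ler_norm_sum _ _ _) _.
apply: (@le_trans _ _ (\sum_(j < N)
   (2^-1 * G (- (i%:Z - j%:Z)) + 2^-1 * G (i%:Z - j%:Z)))).
  by apply: ler_sum => j _; exact: FG.
rewrite big_split /= -!mulr_sumr.
have h1 := h (fun i j : 'I_N => - (i%:Z - j%:Z)) i.
have h2 := h (fun i j : 'I_N => (i%:Z - j%:Z)) i.
have {}h1 : \sum_(j < N) G (- (i%:Z - j%:Z)) <= S.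
  apply: h1 => [j j' e|j]; last by have := ltn_ord i; have := ltn_ord j; lia.
  by apply/val_inj => /=; lia.
have {}h2 : \sum_(j < N) G (i%:Z - j%:Z) <= S.
  apply: h2 => [j j' e|j]; last by have := ltn_ord i; have := ltn_ord j; lia.
  by apply/val_inj => /=; lia.
lra.
Qed.

Lemma parseval_le f g (G : int -> R) : L2 f -> L2 g -> (forall j, 0 <= G j) ->
  (forall j, `|coef_dot f g j| <= 2^-1 * G (- j) + 2^-1 * G j) ->
  forall e, 0 < e -> exists N0, forall N, (N0 <= N)%N -> 
  `|integral01 (fun x => f x * g x)| <= e + \sum_(j <- sym_range N) G j.
Proof.
move=> hf hg G0 hG e e0.
have [N0 hN0] := parseval_lim hf hg e0.
exists N0.+1 => N hN; have N1 : (0 < N)%N by lia.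
have := hN0 N (ltnW hN) N1; have := fejer_sum_le N1 G0 hG.
rewrite !ler_norml => /andP[? ?] /andP[? ?]; apply/andP; split; lra.
Qed.

(** Parseval for the pairs [f], [g * cos_mode k] and [f], [g * sin_mode k]. A finite sum with error
    [e] stands for the infinite convolution, as the bilinear estimate is about finite lists; the
    factor 2 generously replaces the square root of 2. *)
Lemma fourier_prod_le f g k : L2 f -> L2 g -> forall e, 0 < e ->
  exists N0, forall N, (N0 <= N)%N ->
  amp (fun x => f x * g x) k <=
    2 * (e + \sum_(j <- sym_range N) amp f j * amp g (k - j)).
Proof.
move=> hf hg e e0.
have G0 j : 0 <= amp f j * amp g (k - j) by rewrite mulr_ge0 ?amp_ge0.
have [N1 h1] := parseval_le hf (L2_cos_mode k hg) G0
  (fun j => coef_dot_cos_mode k j (L2_integrable01 hf) (L2_integrable01 hg)) e0.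
have [N2 h2] := parseval_le hf (L2_sin_mode k hg) G0
  (fun j => coef_dot_sin_mode k j (L2_integrable01 hf) (L2_integrable01 hg)) e0.
exists (maxn N1 N2) => N; rewrite geq_max => /andP[/h1 {}h1 /h2 {}h2].
set S := \sum_(j <- _) _ in h1 h2 *.
have S0 : 0 <= S by apply: sumr_ge0.
have -> : amp (fun x => f x * g x) k = Num.sqrt
   (integral01 (fun x => f x * (g x * cos_mode k x)) ^+ 2 +
    integral01 (fun x => f x * (g x * sin_mode k x)) ^+ 2).
  by rewrite /amp; congr (Num.sqrt (_ ^+ 2 + _ ^+ 2));
    apply: eq_integral01 => x _; rewrite mulrA.
rewrite -(ler_pXn2r (n := 2))// ?nnegrE ?sqrtr_ge0//; last by lra.
rewrite sqr_sqrtr; last by rewrite addr_ge0// sqr_ge0.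
have eS : 0 <= e + S by lra.
have p (a : R) : `|a| <= e + S -> a ^+ 2 <= (e + S) ^+ 2.
  by move=> ha; rewrite -(real_normK (num_real a)) lerXn2r.
have := p _ h1; have := p _ h2; have := sqr_ge0 (e + S); rewrite exprMn; lra.
Qed.

End ProductAmplitude.

(** * The kernel of the nonlocal operator *)

Section Kernel.
Variable R : realType.
Implicit Types (f g h : R -> R) (c x y z : R) (k m : int).
Local Notation mu := (@lebesgue_measure R).
Local Notation D := (`[(0:R), 1]%classic : set R).
Local Notation mfun f := (@measurable_fun _ _ (measurableTypeR R) R D f).
Local Notation mfunT f := (@measurable_fun _ _ (measurableTypeR R) R setT f).
Local Notation floor x := (Num.floor x).

Lemma is_derive_shift (c x : R) : is_derive x 1 (fun y => y - c) 1.
Proof.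
have := is_deriveB (is_derive_id x 1) (is_derive_cst c x 1).
by rewrite subr0.
Qed.

Lemma is_derive_expR_shift (c x : R) :
  is_derive x 1 (fun y => expR (y - c)) (expR (x - c)).
Proof.
have := @is_derive1_comp _ _ (fun y => y - c) x _ _ (is_derive_expR (x - c))
  (is_derive_shift c x).
by move=> /is_derive_eq; apply; rewrite mulr1.
Qed.

Lemma is_derive_expRN_shift (c x : R) :
  is_derive x 1 (fun y => expR (- (y - c))) (- expR (- (x - c))).
Proof.
have h : is_derive x 1 (fun y => - (y - c)) (-1).
  exact: is_deriveN (is_derive_shift c x).
have := @is_derive1_comp _ _ (fun y => - (y - c)) x _ _
  (is_derive_expR (- (x - c))) h.
by move=> /is_derive_eq; apply; rewrite mulrN1.
Qed.

Lemma is_derive_cosh (c x : R) :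
  is_derive x 1 (fun y => coshR (y - c)) (sinhR (x - c)).
Proof.
have := is_deriveZ 2^-1 (is_deriveD (is_derive_expR_shift c x)
   (is_derive_expRN_shift c x)).
have -> : (fun y => coshR (y - c)) =
    2^-1 \*: ((fun y : R => expR (y - c)) + (fun y => expR (- (y - c)))).
  by apply/funext => y; rewrite /coshR mulrC.
by move=> /is_derive_eq; apply; rewrite /sinhR /GRing.scale /= mulrC.
Qed.

Lemma is_derive_sinh (c x : R) :
  is_derive x 1 (fun y => sinhR (y - c)) (coshR (x - c)).
Proof.
have := is_deriveZ 2^-1 (is_deriveB (is_derive_expR_shift c x)
   (is_derive_expRN_shift c x)).
have -> : (fun y => sinhR (y - c)) =
    2^-1 \*: ((fun y : R => expR (y - c)) - (fun y => expR (- (y - c)))).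
  by apply/funext => y; rewrite /sinhR mulrC.
by move=> /is_derive_eq; apply; rewrite /coshR /GRing.scale /= opprK mulrC.
Qed.

Lemma sinhR_half_gt0 : 0 < sinhR (2^-1 : R).
Proof.
by rewrite /sinhR divr_gt0// subr_gt0 ltr_expR; lra.
Qed.

(** The derivative of [Gker] off the integers. At an integer, a corner of [Gker], this formula gives
    the limit from the right. *)
Definition dxG x : R := sinhR (x - (floor x)%:~R - 2^-1) / (2 * sinhR 2^-1).

Lemma dxG_le x : `|dxG x| <= 2^-1.
Proof.
have s0 := sinhR_half_gt0.
rewrite /dxG normrM [`|_^-1|]ger0_norm ?invr_ge0 ?mulr_ge0// ?(ltW s0)//.
rewrite ler_pdivrMr ?mulr_gt0// mulKf//.
have /andP[] := floor_itv x; rewrite intrD /= => f1 f2.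
set w := x - _ - _.
have w1 : - 2^-1 <= w by rewrite /w; lra.
have w2 : w <= 2^-1 by rewrite /w; lra.
rewrite /sinhR ler_norml.
have : expR w <= expR 2^-1 by rewrite ler_expR.
have : expR (- w) <= expR 2^-1 by rewrite ler_expR; lra.
have : expR (- 2^-1) <= expR w by rewrite ler_expR.
have : expR (- 2^-1) <= expR (- w) by rewrite ler_expR; lra.
by move=> *; apply/andP; split; lra.
Qed.

Lemma floor_shift x k : floor (x + k%:~R) = floor x + k.
Proof. by rewrite floorDrz ?intr_int// intrKfloor. Qed.

Lemma dxG_periodic x k : dxG (x + k%:~R) = dxG x.
Proof.
rewrite /dxG floor_shift.
have -> // : x + k%:~R - (floor x + k)%:~R = x - (floor x)%:~R.
by rewrite intrD; ring.
Qed.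

Lemma Gker_periodic x k : Gker (x + k%:~R) = Gker x.
Proof.
rewrite /Gker floor_shift.
have -> // : x + k%:~R - (floor x + k)%:~R = x - (floor x)%:~R.
by rewrite intrD; ring.
Qed.

Lemma derive1_Gker_periodic x k : derive1 (@Gker R) (x + k%:~R) = derive1
    (@Gker R) x.
Proof.
rewrite /derive1 (_ : (fun e : R => e^-1 *:
    (Gker (e + (x + k%:~R)) - Gker (x + k%:~R))) =
  (fun e => e^-1 *: (Gker (e + x) - Gker x)))//.
by apply/funext => e; rewrite addrA !Gker_periodic.
Qed.

Lemma derive1_Gker x : (floor x)%:~R != x -> derive1 (@Gker R) x = dxG x.
Proof.
move=> xn; set n := floor x.
have /andP[] := floor_itv x; rewrite -/n => f1 f2.
have {}f1 : n%:~R < x by rewrite lt_neqAle xn.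
pose F y : R := (2 * sinhR 2^-1)^-1 *: coshR (y - (n%:~R + 2^-1)).
rewrite derive1E.
have hF : is_derive x 1 F ((2 * sinhR 2^-1)^-1 *: sinhR (x - (n%:~R + 2^-1))).
  exact: (is_deriveZ _ (is_derive_cosh (n%:~R + 2^-1) x)).
rewrite (near_eq_derive (g := F)).
  have [_ ->] := hF; rewrite /dxG /GRing.scale /= mulrC; congr (sinhR _ / _).
  by rewrite opprD addrA.
near=> y.
suff fy : floor y = n.
  by rewrite /Gker fy /F /GRing.scale /= opprD addrA [RHS]mulrC.
apply: floor_def; apply/andP; split.
  by apply: ltW; near: y; exact: lt_nbhsr.
by near: y; exact: lt_nbhsl.
Unshelve. all: by end_near. Qed.

(** Nothing is known of the derivative at a corner, but by periodicity it is the same at every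
    integer, which is enough for measurability. *)
Lemma derive1_GkerE x : derive1 (@Gker R) x =
  if (floor x)%:~R == x then derive1 (@Gker R) 0 else dxG x.
Proof.
case: ifPn => [/eqP xn|]; last exact: derive1_Gker.
by rewrite -xn -[in LHS](add0r ((floor x)%:~R : R)) derive1_Gker_periodic.
Qed.

Lemma measurable_floor : mfunT (fun x => (floor x)%:~R).
Proof.
apply: nondecreasing_measurable; first exact: measurableT.
by move=> x y xy; rewrite ler_int le_floor.
Qed.

Lemma measurable_dxG : mfunT dxG.
Proof.
have h : mfunT (fun x => x - (floor x)%:~R - 2^-1).
  apply: measurable_funB; last exact: measurable_cst.
  by apply: measurable_funB; [exact: measurable_id|exact: measurable_floor].
rewrite /dxG; apply: measurable_funM; last exact: measurable_cst.
rewrite /sinhR; apply: measurable_funM; last exact: measurable_cst.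
apply: measurable_funB; apply: (measurableT_comp (@measurable_expR R)) => //.
exact: measurable_funN.
Qed.

Lemma measurable_derive1_Gker : mfunT (derive1 (@Gker R)).
Proof.
have -> : derive1 (@Gker R) = fun x =>
    if (floor x)%:~R == x then derive1 (@Gker R) 0 else dxG x.
  by apply/funext => x; exact: derive1_GkerE.
apply: measurable_fun_ifT; [|exact: measurable_cst|exact: measurable_dxG].
by apply: measurable_fun_eqr; [exact: measurable_floor|exact: measurable_id].
Qed.

Lemma measurable_subl x : mfunT (fun y => x - y).
Proof.
by apply: measurable_funB; [exact: measurable_cst|exact: measurable_id].
Qed.

Lemma mfun_T f : mfunT f -> mfun f.
Proof. exact: measurable_funTS. Qed.

(** The two integrands differ at most where [x - y] is an integer, a countable set of [y]. *)
Lemma dxG_convE h x : mfun h ->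
  dxG_conv h x = integral01 (fun y => dxG (x - y) * h y).
Proof.
move=> mh; apply: integral01_ae.
- apply: measurable_funM => //; apply: mfun_T.
  exact: (measurableT_comp measurable_derive1_Gker (measurable_subl x)).
- apply: measurable_funM => //; apply: mfun_T.
  exact: (measurableT_comp measurable_dxG (measurable_subl x)).
pose B := [set y : R | exists k : int, y = x - k%:~R].
have cB : countable B.
  have -> : B = [set x - k%:~R | k in [set: int]].
    by apply/seteqP; split => [y [k ->]|y [k _ <-]]; exists k.
  apply: sub_countable (card_image_le _ _) _; exact: countableP.
exists B; split.
- exact: countable_measurable.
- exact: countable_lebesgue_measure0.
- move=> y /=; apply: contra_notP => nB _.
  rewrite derive1_Gker//; apply/eqP => e; apply: nB.
  by exists (floor (x - y)); rewrite e subKr.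
Qed.

Lemma dxG_conv_periodic h : mfun h -> periodic (dxG_conv h) 1.
Proof.
move=> mh x; rewrite (@dxG_convE h (x + 1) mh) (@dxG_convE h x mh).
by apply: eq_integral01 => y _; rewrite addrAC -[1]/((1%:Z)%:~R : R)
    dxG_periodic.
Qed.

Lemma integrable01_conv h x : mfunT h -> integrable01 h -> integrable01 (fun y
    => dxG (x - y) * h y).
Proof.
move=> mh hi; apply: (@eq_integrable01 _ (fun y => h y * dxG (x - y))).
  by move=> y _; rewrite mulrC.
apply: (integrable01M_bnd (c := 2^-1)) => //; last by move=> y _; exact: dxG_le.
apply: mfun_T; exact: (measurableT_comp measurable_dxG (measurable_subl x)).
Qed.

Lemma dxG_conv_le h x : mfunT h -> integrable01 h ->
  `|dxG_conv h x| <= 2^-1 * integral01 (fun y => `|h y|).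
Proof.
move=> mh hi; rewrite dxG_convE; last exact: mfun_T.
apply: le_trans (norm_integral01 (integrable01_conv x mh hi)) _.
rewrite -integral01Z; last exact: integrable01_norm.
apply: le_integral01;
    [exact/integrable01_norm/integrable01_conv|exact/integrable01Z/integrable01_norm|].
by move=> y _; rewrite normrM ler_wpM2r// dxG_le.
Qed.

Let T2 := ((measurableTypeR R) * (measurableTypeR R))%type.

Lemma measurable_dxG2 : measurable_fun [set: T2] (fun z : T2 => dxG (z.1 -
    z.2)).
Proof.
apply: (measurableT_comp measurable_dxG).
by apply: measurable_funB; [exact: measurable_fst|exact: measurable_snd].
Qed.

(** Tonelli's theorem, applied separately to the positive and negative parts of the integrand on the
    plane, gives measurability of each partial integral. *)
Lemma measurable_dxG_conv h : mfunT h -> integrable01 h -> mfunT (dxG_conv h).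
Proof.
move=> mh hi.
pose F (z : T2) : \bar R := (dxG (z.1 - z.2) * (h \_ D) z.2)%:E.
have mF : measurable_fun setT F.
  apply/measurable_EFinP; apply: measurable_funM; first exact: measurable_dxG2.
  apply: (measurableT_comp (f := h \_ D)); last exact: measurable_snd.
  by apply/(measurable_restrictT _ (@measurable01 R)); exact: mfun_T.
have E x : dxG_conv h x = fine (\int[mu]_y F^\+ (x, y) - \int[mu]_y F^\- (x,
    y))%E.
  rewrite dxG_convE; last exact: mfun_T.
  rewrite /integral01 Rintegral_mkcond /Rintegral integralE; congr (fine (_ -
      _)%E);
    apply: eq_integral => y _; rewrite ?funeposE ?funenegE /F /=;
    by rewrite /patch; case: ifP; rewrite ?mulr0.
have -> : dxG_conv h = fine \o
    (fun x => \int[mu]_y F^\+ (x, y) - \int[mu]_y F^\- (x, y))%E.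
  by apply/funext => x; exact: E.
apply: (measurableT_comp (@fine_measurable R setT measurableT)).
apply: emeasurable_funB.
  apply: (@measurable_fun_fubini_tonelli_F _ _ (measurableTypeR R)
      (measurableTypeR R) R mu (F^\+)%E) => //.
  exact: measurable_funepos.
apply: (@measurable_fun_fubini_tonelli_F _ _ (measurableTypeR R)
    (measurableTypeR R) R mu (F^\-)%E) => //.
exact: measurable_funeneg.
Qed.

(** A dominating function of [y] alone suffices, because [x] ranges over an interval of measure 1.
    All functions are extended by zero outside the unit square. *)
Lemma integral01_fubini (F : R -> R -> R) g :
  measurable_fun [set: T2] (fun z : T2 => F z.1 z.2) -> integrable01 g ->
  (forall x y, x \in `[(0:R), 1] -> y \in `[(0:R), 1] -> `|F x y| <= g y) ->
  integral01 (fun x => integral01 (fun y => F x y)) = integral01 (fun y =>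
      integral01 (fun x => F x y)).
Proof.
move=> mF hg Fg.
pose DD : set T2 := D `*` D.
have mDD : measurable DD by apply: measurableX; exact: measurable01.
pose G : T2 -> \bar R := (EFin \o (fun z : T2 => F z.1 z.2)) \_ DD.
have mG : measurable_fun setT G.
  apply/(measurable_restrictT _ mDD); apply: measurable_funTS.
  exact/measurable_EFinP.
have GE x y : G (x, y) = if (x \in D) && (y \in D) then (F x y)%:E else 0%E.
  rewrite /G /patch /=; congr (if _ then _ else _).
  by apply/idP/andP; rewrite !inE /= => -[].
have sF x : x \in D -> integrable01 (F x).
  rewrite inE => xD; apply: (@integrable01_le _ _ g) => //.
    apply: mfun_T; exact: (measurableT_comp mF (measurable_pair1 x)).
  by move=> y yD; exact: Fg.
have sF' y : y \in D -> integrable01 (F ^~ y).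
  rewrite inE => yD; apply: (@integrable01_bnd _ _ (g y)) => //.
    apply: mfun_T; exact: (measurableT_comp mF (measurable_pair2 y)).
  by move=> x xD; exact: Fg.
have I1 x : (\int[mu]_y G (x, y) = ((fun x => integral01 (F x)) \_ D x)%:E)%E.
  rewrite /patch; case: ifP => xD.
    transitivity (\int[mu]_y ((EFin \o F x) \_ D) y)%E.
      by apply: eq_integral => y _; rewrite GE xD /= /patch.
    rewrite -integral_mkcond /integral01 /Rintegral fineK//.
    by apply: integrable_fin_num; [exact: measurable01|exact: sF].
  by under eq_integral do rewrite GE xD /=; rewrite integral0.
have I2 y : (\int[mu]_x G (x, y) = ((fun y => integral01 (F ^~ y)) \_ D
    y)%:E)%E.
  rewrite /patch; case: ifP => yD.
    transitivity (\int[mu]_x ((EFin \o F ^~ y) \_ D) x)%E.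
      by apply: eq_integral => x _; rewrite GE yD andbT /= /patch.
    rewrite -integral_mkcond /integral01 /Rintegral fineK//.
    by apply: integrable_fin_num; [exact: measurable01|exact: sF'].
  by under eq_integral do rewrite GE yD andbF /=; rewrite integral0.
have iG : (mu \x mu)%E.-integrable setT G.
  apply/integrable21ltyP => //.
  apply: (@le_lt_trans _ _ (\int[mu]_y ((EFin \o g) \_ D) y)%E).
    apply: ge0_le_integral => //.
    - by move=> y _; apply: integral_ge0.
    - apply: (@measurable_fun_fubini_tonelli_G _ _ (measurableTypeR R)
        (measurableTypeR R) R mu (abse \o G)) => //.
        exact: measurableT_comp.
      by move=> z; exact: abse_ge0.
    - by apply/(measurable_restrictT _ (@measurable01 R)); case/integrableP: hg.
    move=> y _; rewrite /patch; case: ifP => yD; last first.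
      by under eq_integral do rewrite GE yD andbF /= normr0; rewrite integral0.
    apply: (@le_trans _ _ (\int[mu]_x ((cst (g y)%:E) \_ D) x)%E).
      apply: ge0_le_integral => //.
      - by move: yD; rewrite inE => yD; apply: (measurableT_comp (f := abse))
          => //;
          exact: (measurableT_comp mG (measurable_pair2 y)).
      - by apply/(measurable_restrictT _ (@measurable01 R)); exact:
          measurable_cst.
      - move=> x _; rewrite GE yD andbT /patch; case: ifP => // xD.
        by rewrite /= lee_fin; move: xD yD; rewrite !inE; exact: Fg.
      by rewrite abse0.
    rewrite -integral_mkcond /cst (integral_cst _ (@measurable01 R)).
    by rewrite [X in (_ * X)%E]lebesgue_measure01 mule1.
  by rewrite -integral_mkcond; apply: integrable_lty => //; exact: measurable01.
have := Fubini iG.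
under eq_integral do rewrite I1; under [RHS]eq_integral do rewrite I2.
move=> /(congr1 fine); rewrite /integral01 Rintegral_mkcond => H.
by rewrite [RHS]Rintegral_mkcond; exact: H.
Qed.

End Kernel.

(** * Smoothing of products *)

Section Multiplier.
Variable R : realType.
Implicit Types (f g h : R -> R) (c x y z : R) (k m : int).
Local Notation mu := (@lebesgue_measure R).
Local Notation D := (`[(0:R), 1]%classic : set R).
Local Notation mfun f := (@measurable_fun _ _ (measurableTypeR R) R D f).
Local Notation mfunT f := (@measurable_fun _ _ (measurableTypeR R) R setT f).

(** * The Fourier multiplier of the nonlocal operator *)

Lemma integral_FTC_le f (F : R -> R) (a b : R) : a <= b -> continuous f ->
  (forall x, is_derive x 1 F (f x)) ->
  \int[mu]_(x in `[a, b]) f x = F b - F a.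
Proof.
rewrite le_eqVlt => /predU1P[->|ab] cf dF; last exact: integral_FTC.
by rewrite set_itv1 Rintegral_set1 subrr.
Qed.

(** The pieces exclude the right endpoint: for [y = 0] the kernel jumps again at [x = 1]. *)
Lemma integral01_piecewise (p f1 f2 : R -> R) y : y \in `[(0:R), 1] ->
    integrable01 p ->
  continuous f1 -> continuous f2 ->
  (forall x, 0 <= x < y -> p x = f1 x) -> (forall x, y <= x < 1 -> p x = f2 x)
      ->
  integral01 p = \int[mu]_(x in `[0, y]) f1 x + \int[mu]_(x in `[y, 1]) f2 x.
Proof.
rewrite in_itv/= => /andP[y0 y1] ip c1 c2 h1 h2.
have i01 : mu.-integrable `[0, 1[ (EFin \o p).
  apply: integrableS ip; [exact: measurable01|exact: measurable_itv|].
  by apply: subset_itvl; rewrite bnd_simp.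
have ci (f : R -> R) (a b : R) : continuous f -> mu.-integrable `[a, b[ (EFin
    \o f).
  move=> cf; apply: (@integrableS _ _ _ mu `[a, b]).
  - exact: measurable_itv.
  - exact: measurable_itv.
  - by apply: subset_itvl; rewrite bnd_simp.
  - apply: continuous_compact_integrable; first exact: segment_compact.
    exact: continuous_subspaceT.
rewrite /integral01 -Rintegral_itv_bndo_bndc// -(Rintegral_itv_bndo_bndc (ci _
    _ _ c1)).
rewrite -(Rintegral_itv_bndo_bndc (ci _ _ _ c2)).
rewrite (@itv_bndbnd_setU _ _ _ (BLeft y)) ?bnd_simp//.
rewrite Rintegral_setU//=.
- congr (_ + _); apply: eq_Rintegral => x; rewrite inE/= in_itv/=; [exact:
    h1|exact: h2].
- by rewrite -itv_bndbnd_setU ?bnd_simp.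
- rewrite disj_set2E; apply/eqP; apply/seteqP; split=> // x /=.
  by rewrite !in_itv/= => -[/andP[_ a] /andP[b _]]; move: (lt_le_trans a b);
      rewrite ltxx.
Qed.

Lemma dxG_pieces x y : y \in `[(0:R), 1] ->
  (0 <= x < y -> dxG (x - y) = sinhR (x - (y - 2^-1)) / (2 * sinhR 2^-1)) /\
  (y <= x < 1 -> dxG (x - y) = sinhR (x - (y + 2^-1)) / (2 * sinhR 2^-1)).
Proof.
rewrite in_itv/= => /andP[y0 y1]; split => /andP[a b].
  have E : Num.floor (x - y) = -1.
    by apply: floor_def; rewrite addNr mulrN1z; apply/andP; split; lra.
  by rewrite /dxG E mulrN1z; congr (sinhR _ / _); lra.
have E : Num.floor (x - y) = 0.
  by apply: floor_def; rewrite add0r mulr0z mulr1z; apply/andP; split; lra.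
by rewrite /dxG E mulr0z; congr (sinhR _ / _); lra.
Qed.

(** An antiderivative of [sinhR (x - c) * cos (l * x)], found by integrating by parts twice; its
    factor [1 / (1 + l^2)] is the symbol of [(1 - dx^2)^-1]. *)
Definition prim_cos (l c x : R) : R :=
  (1 + l ^+ 2)^-1 * (coshR (x - c) * cos (l * x) + l * (sinhR (x - c) * sin (l
      * x))).

Definition prim_sin (l c x : R) : R :=
  (1 + l ^+ 2)^-1 * (coshR (x - c) * sin (l * x) - l * (sinhR (x - c) * cos (l
      * x))).

Lemma one_sqr_neq0 (l : R) : 1 + l ^+ 2 != 0.
Proof. by rewrite gt_eqF// ltr_pwDl// sqr_ge0. Qed.

Lemma is_derive_cosM (l x : R) :
  is_derive x 1 (fun y => cos (l * y)) (- l * sin (l * x)).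
Proof.
have := is_derive_cos_lin l 0 x; rewrite addr0.
by have -> : (fun y => cos (l * y + 0)) = (fun y => cos (l * y))
  by apply/funext => y; rewrite addr0.
Qed.

Lemma is_derive_sinM (l x : R) :
  is_derive x 1 (fun y => sin (l * y)) (l * cos (l * x)).
Proof.
have := is_derive_sin_lin l 0 x; rewrite addr0.
by have -> : (fun y => sin (l * y + 0)) = (fun y => sin (l * y))
  by apply/funext => y; rewrite addr0.
Qed.

Lemma is_derive_prim_cos l c x :
  is_derive x 1 (prim_cos l c) (sinhR (x - c) * cos (l * x)).
Proof.
have h1 := is_deriveM (is_derive_cosh c x) (is_derive_cosM l x).
have h2 := is_deriveM (is_derive_sinh c x) (is_derive_sinM l x).
have := is_deriveZ (1 + l ^+ 2)^-1 (is_deriveD h1 (is_deriveZ l h2)).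
move=> /is_derive_eq; apply; rewrite /GRing.scale /=.
apply: (mulfI (one_sqr_neq0 l)); rewrite mulVKf ?one_sqr_neq0//; ring.
Qed.

Lemma is_derive_prim_sin l c x :
  is_derive x 1 (prim_sin l c) (sinhR (x - c) * sin (l * x)).
Proof.
have h1 := is_deriveM (is_derive_cosh c x) (is_derive_sinM l x).
have h2 := is_deriveM (is_derive_sinh c x) (is_derive_cosM l x).
have := is_deriveZ (1 + l ^+ 2)^-1 (is_deriveB h1 (is_deriveZ l h2)).
move=> /is_derive_eq; apply; rewrite /GRing.scale /=.
apply: (mulfI (one_sqr_neq0 l)); rewrite mulVKf ?one_sqr_neq0//; ring.
Qed.

Lemma cont_sinh c : continuous (fun x : R => sinhR (x - c)).
Proof. by apply: derive_cont => x; exact: is_derive_sinh. Qed.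

Lemma cont_sinh_cos_mode c k :
  continuous (fun x => sinhR (x - c) * cos_mode k x / (2 * sinhR 2^-1)).
Proof.
by move=> x; apply: cvgMl; apply: cvgM; [exact: cont_sinh|exact: cos_mode_cont].
Qed.

Lemma cont_sinh_sin_mode c k :
  continuous (fun x => sinhR (x - c) * sin_mode k x / (2 * sinhR 2^-1)).
Proof.
by move=> x; apply: cvgMl; apply: cvgM; [exact: cont_sinh|exact: sin_mode_cont].
Qed.

Lemma mfun_dxG y : mfun (fun x => dxG (x - y)).
Proof.
apply: mfun_T; apply: (measurableT_comp (@measurable_dxG R)).
by apply: measurable_funB; [exact: measurable_id|exact: measurable_cst].
Qed.

Lemma sinhRN x : sinhR (- x) = - sinhR x.
Proof. by rewrite /sinhR opprK -mulNr opprB. Qed.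

Lemma coshRN x : coshR (- x) = coshR x.
Proof. by rewrite /coshR opprK addrC. Qed.

Lemma mode_endpoints k : [/\ cos (2 * pi * k%:~R * 1) = 1 :> R,
  sin (2 * pi * k%:~R * 1) = 0 :> R, cos (2 * pi * k%:~R * 0) = 1 :> R &
  sin (2 * pi * k%:~R * 0) = 0 :> R].
Proof.
split; rewrite ?mulr0 ?cos0 ?sin0// mulr1.
  by rewrite -[X in cos X]add0r cosD2pin cos0.
by rewrite -[X in sin X]add0r sinD2pin sin0.
Qed.

Lemma integral01_dxG_cos_mode y k : y \in `[(0:R), 1] ->
  integral01 (fun x => dxG (x - y) * cos_mode k x) =
  2 * pi * k%:~R / (1 + (2 * pi * k%:~R) ^+ 2) * sin_mode k y.
Proof.
move=> yD.
have yD' := yD; move: yD'; rewrite in_itv/= => /andP[y0 y1].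
set l : R := 2 * pi * k%:~R.
have s0 : 2 * sinhR (2^-1 : R) != 0 by rewrite mulf_neq0// gt_eqF//
    sinhR_half_gt0.
have dF c x : is_derive x 1 (fun x => (2 * sinhR 2^-1)^-1 * prim_cos l c x)
    (sinhR (x - c) * cos_mode k x / (2 * sinhR 2^-1)).
  have := is_deriveZ (2 * sinhR 2^-1)^-1 (is_derive_prim_cos l c x).
  by move=> /is_derive_eq; apply; rewrite /GRing.scale /= mulrC.
rewrite (integral01_piecewise (f1 := fun x => sinhR (x - (y - 2^-1)) * cos_mode
    k x / (2 * sinhR 2^-1))
   (f2 := fun x => sinhR (x - (y + 2^-1)) * cos_mode k x / (2 * sinhR 2^-1))
       yD).
- rewrite (integral_FTC_le y0 (@cont_sinh_cos_mode _ k) (dF _)).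
  rewrite (integral_FTC_le y1 (@cont_sinh_cos_mode _ k) (dF _)).
  rewrite /prim_cos; have [c1 z1 c0 z0] := mode_endpoints k.
  rewrite !subKr c1 z1 c0 z0.
  have -> : y - (y + 2^-1) = - 2^-1 :> R by ring.
  (* The arguments at [x = 0] and [x = 1] coincide, so these boundary terms cancel. At [x = y] the
     even [coshR] cancels too and the odd [sinhR] leaves the jump of the kernel. *)
  have -> : 0 - (y - 2^-1) = 1 - (y + 2^-1) :> R by lra.
  rewrite coshRN sinhRN /sin_mode -/l !mulr0 !addr0.
  have := one_sqr_neq0 l => l0.
  set S := sinhR 2^-1 in s0 *; set C := coshR 2^-1.
  have S0 : S != 0 by move: s0; rewrite mulf_eq0 negb_or => /andP[].
  by field; rewrite S0 l0.
- by apply: integrable01_cos_mode; apply: (integrable01_bnd (c := 2^-1));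
    [exact: mfun_dxG|move=> x _; exact: dxG_le].
- exact: cont_sinh_cos_mode.
- exact: cont_sinh_cos_mode.
- by move=> x hx; rewrite (dxG_pieces x yD).1// mulrAC.
- by move=> x hx; rewrite (dxG_pieces x yD).2// mulrAC.
Qed.

Lemma integral01_dxG_sin_mode y k : y \in `[(0:R), 1] ->
  integral01 (fun x => dxG (x - y) * sin_mode k x) =
  - (2 * pi * k%:~R / (1 + (2 * pi * k%:~R) ^+ 2)) * cos_mode k y.
Proof.
move=> yD.
have yD' := yD; move: yD'; rewrite in_itv/= => /andP[y0 y1].
set l : R := 2 * pi * k%:~R.
have s0 : 2 * sinhR (2^-1 : R) != 0 by rewrite mulf_neq0// gt_eqF//
    sinhR_half_gt0.
have dF c x : is_derive x 1 (fun x => (2 * sinhR 2^-1)^-1 * prim_sin l c x)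
    (sinhR (x - c) * sin_mode k x / (2 * sinhR 2^-1)).
  have := is_deriveZ (2 * sinhR 2^-1)^-1 (is_derive_prim_sin l c x).
  by move=> /is_derive_eq; apply; rewrite /GRing.scale /= mulrC.
rewrite (integral01_piecewise (f1 := fun x => sinhR (x - (y - 2^-1)) * sin_mode
    k x / (2 * sinhR 2^-1))
   (f2 := fun x => sinhR (x - (y + 2^-1)) * sin_mode k x / (2 * sinhR 2^-1))
       yD).
- rewrite (integral_FTC_le y0 (@cont_sinh_sin_mode _ k) (dF _)).
  rewrite (integral_FTC_le y1 (@cont_sinh_sin_mode _ k) (dF _)).
  rewrite /prim_sin; have [c1 z1 c0 z0] := mode_endpoints k.
  rewrite !subKr c1 z1 c0 z0.
  have -> : y - (y + 2^-1) = - 2^-1 :> R by ring.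
  have -> : 0 - (y - 2^-1) = 1 - (y + 2^-1) :> R by lra.
  rewrite coshRN sinhRN /cos_mode -/l !mulr0 !sub0r !mulr1.
  have := one_sqr_neq0 l => l0.
  set S := sinhR 2^-1 in s0 *; set C := coshR 2^-1.
  have S0 : S != 0 by move: s0; rewrite mulf_eq0 negb_or => /andP[].
  by field; rewrite S0 l0.
- by apply: integrable01_sin_mode; apply: (integrable01_bnd (c := 2^-1));
    [exact: mfun_dxG|move=> x _; exact: dxG_le].
- exact: cont_sinh_sin_mode.
- exact: cont_sinh_sin_mode.
- by move=> x hx; rewrite (dxG_pieces x yD).1// mulrAC.
- by move=> x hx; rewrite (dxG_pieces x yD).2// mulrAC.
Qed.

Let T2 := ((measurableTypeR R) * (measurableTypeR R))%type.

Lemma integral01_conv_fubini h p : mfunT h -> integrable01 h -> mfunT p ->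
  (forall x, `|p x| <= 1) ->
  integral01 (fun x => dxG_conv h x * p x) = integral01 (fun y => h y *
      integral01 (fun x => dxG (x - y) * p x)).
Proof.
move=> mh hi mp p1.
have ip y : integrable01 (fun x => dxG (x - y) * p x).
  apply: (integrable01_bnd (c := 2^-1)).
    by apply: measurable_funM; [exact: mfun_dxG|exact: mfun_T].
  by move=> x _; rewrite normrM -[2^-1]mulr1 ler_pM// dxG_le.
transitivity (integral01 (fun x => integral01 (fun y => dxG (x - y) * h y * p
    x))).
  apply: eq_integral01 => x _; rewrite (@dxG_convE _ h x); last exact: mfun_T.
  rewrite mulrC -integral01Z; last exact: integrable01_conv.
  by apply: eq_integral01 => y _; rewrite mulrC.
rewrite (@integral01_fubini _ (fun x y => dxG (x - y) * h y * p x) (fun y =>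
    `|h y|)).
- apply: eq_integral01 => y _; rewrite -integral01Z//.
  by apply: eq_integral01 => x _; ring.
- apply: measurable_funM.
    apply: measurable_funM; first exact: measurable_dxG2.
    exact: (measurableT_comp mh (@measurable_snd _ _ (measurableTypeR R)
        (measurableTypeR R))).
  exact: (measurableT_comp mp (@measurable_fst _ _ (measurableTypeR R)
      (measurableTypeR R))).
- exact: integrable01_norm.
- move=> x y _ _.
  have -> : `|dxG (x - y) * h y * p x| = `|dxG (x - y)| * `|h y| * `|p x|.
    by rewrite normrM (normrM (dxG _)).
  have := dxG_le (x - y); have := p1 x; have := normr_ge0 (h y).
  move: (normr_ge0 (dxG (x - y))) (normr_ge0 (p x)) => a b c d e.
  have d1 : `|dxG (x - y)| <= 1 by lra.
  rewrite mulrAC; apply: ler_piMl => //.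
  by rewrite -[1]mulr1 ler_pM.
Qed.

Lemma mfunT_cont f : continuous f -> mfunT f.
Proof. exact: continuous_measurable_fun. Qed.

(** With [l = 2 pi k], the operator multiplies the complex coefficient by [i l / (1 + l^2)]; this
    lemma and the next are its real and imaginary parts. *)
Lemma cos_coef_conv h k : mfunT h -> integrable01 h -> cos_coef (dxG_conv h) k =
  2 * pi * k%:~R / (1 + (2 * pi * k%:~R) ^+ 2) * sin_coef h k.
Proof.
move=> mh hi; rewrite /cos_coef integral01_conv_fubini//.
- rewrite /sin_coef -integral01Z; last exact: integrable01_sin_mode.
  by apply: eq_integral01 => y yD; rewrite integral01_dxG_cos_mode//; ring.
- by apply: mfunT_cont; exact: cos_mode_cont.
- by move=> x; exact: cos_mode_le1.
Qed.

Lemma sin_coef_conv h k : mfunT h -> integrable01 h -> sin_coef (dxG_conv h) k =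
  - (2 * pi * k%:~R / (1 + (2 * pi * k%:~R) ^+ 2)) * cos_coef h k.
Proof.
move=> mh hi; rewrite /sin_coef integral01_conv_fubini//.
- rewrite /cos_coef -integral01Z; last exact: integrable01_cos_mode.
  by apply: eq_integral01 => y yD; rewrite integral01_dxG_sin_mode//; ring.
- by apply: mfunT_cont; exact: sin_mode_cont.
- by move=> x; exact: sin_mode_le1.
Qed.

(** The squared multiplier [l^2 / (1 + l^2)^2] is at most [1 / (1 + l^2)]: a gain of one
    derivative. *)
Lemma amp_conv h k : mfunT h -> integrable01 h ->
  amp (dxG_conv h) k ^+ 2 <= weight R k `^ (-1) * amp h k ^+ 2.
Proof.
move=> mh hi; rewrite !amp_sqr cos_coef_conv// sin_coef_conv// powR_inv1; last
    exact/ltW/weight_gt0.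
rewrite /weight; set l : R := 2 * pi * k%:~R.
have l0 : 0 < 1 + l ^+ 2 by rewrite ltr_pwDl// sqr_ge0.
have -> : (l / (1 + l ^+ 2) * sin_coef h k) ^+ 2 +
    (- (l / (1 + l ^+ 2)) * cos_coef h k) ^+ 2 =
    (l / (1 + l ^+ 2)) ^+ 2 * (cos_coef h k ^+ 2 + sin_coef h k ^+ 2) by ring.
apply: ler_wpM2r; first by rewrite addr_ge0// sqr_ge0.
have -> : (l / (1 + l ^+ 2)) ^+ 2 = l ^+ 2 / (1 + l ^+ 2) * (1 + l ^+ 2)^-1.
  by field; rewrite gt_eqF.
by apply: ler_piMl; [rewrite invr_ge0 ltW|rewrite ler_pdivrMr// mul1r; lra].
Qed.

(* The squared [H^r] norm of [f] is at most [x]; stated through finite partial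
   sums, it needs no extended real numbers. *)
Definition sobolev_bound r f x := weighted_bound r (fun k => amp f k ^+ 2) x.

Lemma sobolev_ge0 r f x : sobolev_bound r f x -> 0 <= x.
Proof. by move/(_ [::] isT); rewrite big_nil. Qed.

Lemma L2_le_sobolev f x : L2 f -> sobolev_bound 0 f x -> integral01 (fun x => f
    x ^+ 2) <= x.
Proof.
move=> hf hx; apply/ler_addgt0Pr => e e0.
have G0 j : 0 <= amp f j ^+ 2 by exact: sqr_ge0.
have hG j : `|coef_dot f f j| <= 2^-1 * amp f (- j) ^+ 2 + 2^-1 * amp f j ^+ 2.
  rewrite ampN; last exact: L2_integrable01.
  by rewrite /coef_dot -!expr2 -amp_sqr ger0_norm//; lra.
have [N /(_ N (leqnn N))] := parseval_le hf hf G0 hG e0.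
have := hx _ (sym_range_uniq N); under eq_bigr do rewrite powRr0 mul1r.
have -> : integral01 (fun x => f x ^+ 2) = integral01 (fun x => f x * f x).
  by apply: eq_integral01 => z _; rewrite expr2.
by have := ler_norm (integral01 (fun x => f x * f x)); lra.
Qed.

Lemma sobolev_le r r' f x : r <= r' -> sobolev_bound r' f x -> sobolev_bound r
    f x.
Proof.
move=> rr h S uS; apply: le_trans (h S uS); apply: ler_sum => k _.
apply: ler_wpM2r; first exact: sqr_ge0.
by apply: ler_powR => //; exact: weight_ge1.
Qed.

(** The operator gains one derivative, so the bilinear estimate is used at order [r - 1]. The
    truncation error of the convolution is made negligible on the finite list [S], and then removed
    because [e] is arbitrary. *)
Lemma conv_product_bound (s r : R) : 0 <= s -> r <= s + 1 ->
  2 * (r - 1) < 4 * s - 1 -> exists2 C, 0 <= C &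
  forall f g x y, mfunT f -> mfunT g -> L2 f -> L2 g ->
    sobolev_bound s f x -> sobolev_bound s g y ->
    sobolev_bound r (dxG_conv (fun z => f z * g z)) (C * (x * y)).
Proof.
move=> s0 rs r4; have rs' : r - 1 <= s by lra.
have [C C0 hC] := bilinear_bound s0 rs' r4.
exists (8 * C); first by rewrite mulr_ge0.
move=> f g x y mf mg hf hg hx hy S uS.
have mfg : mfunT (fun z => f z * g z) by exact: measurable_funM.
have ifg : integrable01 (fun z => f z * g z) by exact: integrable01_L2M.
apply: (@le_trans _ _ (\sum_(k <- S) weight R k `^ (r - 1) *
    amp (fun z => f z * g z) k ^+ 2)).
  apply: ler_sum => k _.
  have -> : weight R k `^ (r - 1) = weight R k `^ r * weight R k `^ (-1).
    by rewrite powRD// (gt_eqF (weight_gt0 _ _)) implybT.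
  by rewrite -mulrA; apply: ler_wpM2l; [exact: powR_ge0|exact: amp_conv].
pose M := \sum_(k <- S) weight R k `^ (r - 1).
have M0 : 0 <= M by apply: sumr_ge0 => k _; exact: powR_ge0.
apply/ler_addgt0Pr => e e0.
have d0 : 0 < e / (8 * (1 + M)) by rewrite divr_gt0// mulr_gt0// ltr_pwDl.
(* Squaring [2 (d + B)] costs [8 d^2 + 8 B^2], and [d] makes the total error [8 d^2 M] at most [e];
   [1 + M] avoids dividing by zero. *)
pose d := Num.sqrt (e / (8 * (1 + M))).
have dd : d ^+ 2 = e / (8 * (1 + M)) by rewrite sqr_sqrtr// ltW.
have {}d0 : 0 < d by rewrite sqrtr_gt0.
(* One truncation serves all [k] in [S] because [S] is finite. *)
have hN : exists N, forall k, k \in S ->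
    amp (fun x => f x * g x) k <=
    2 * (d + \sum_(j <- sym_range N) amp f j * amp g (k - j)).
  have [N0 hN0] : exists N0, forall k, k \in S -> forall N, (N0 <= N)%N ->
      amp (fun x => f x * g x) k <=
      2 * (d + \sum_(j <- sym_range N) amp f j * amp g (k - j)).
    elim: (S) => [|k0 S' [N1 ih]]; first by exists 0%N.
    have [N2 h2] := fourier_prod_le k0 hf hg d0.
    exists (maxn N1 N2) => k; rewrite in_cons => /predU1P[->|/ih hk] N;
      rewrite geq_max => /andP[a b]; [exact: h2|exact: hk].
  by exists N0 => k kS; exact: hN0.
have [N {}hN] := hN.
have hB := hC _ _ _ _ (amp_ge0 f) (amp_ge0 g) hx hy S (sym_range N) uS
    (sym_range_uniq N).
apply: (@le_trans _ _ (\sum_(k <- S) (8 * d ^+ 2 * weight R k `^ (r - 1) +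
   8 * (weight R k `^ (r - 1) * (\sum_(j <- sym_range N) amp f j * amp g (k -
       j)) ^+ 2)))).
  rewrite big_seq [leRHS]big_seq; apply: ler_sum => k kS.
  have := hN k kS; set B := \sum_(j <- _) _ => hk.
  have B0 : 0 <= B by apply: sumr_ge0 => j _; rewrite mulr_ge0 ?amp_ge0.
  have h2 : amp (fun x => f x * g x) k ^+ 2 <= 8 * d ^+ 2 + 8 * B ^+ 2.
    apply: (@le_trans _ _ ((2 * (d + B)) ^+ 2)).
      by rewrite lerXn2r// ?nnegrE ?amp_ge0// mulr_ge0// addr_ge0// ltW.
    by have := sqr_ge0 (d - B); rewrite exprMn; lra.
  have := ler_wpM2l (powR_ge0 (weight R k) (r - 1)) h2; lra.
rewrite big_split /= -!mulr_sumr -/M.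
have : 8 * d ^+ 2 * M <= e.
  rewrite dd; have M1 : 0 < 1 + M by rewrite ltr_pwDl.
  have -> : 8 * (e / (8 * (1 + M))) * M = e * (M / (1 + M)).
    by field; rewrite gt_eqF.
  rewrite -[leRHS]mulr1; apply: ler_wpM2l; first exact: ltW.
  by rewrite ler_pdivrMr// mul1r lerDr.
lra.
Qed.

End Multiplier.

(** * Sobolev norms *)

Section SobolevNorm.
Variable R : realType.
Implicit Types (f g h phi : R -> R) (F : (R -> R) -> R) (c x y z e r s t T : R)
    (k : int).
Local Notation mu := (@lebesgue_measure R).
Local Notation D := (`[(0:R), 1]%classic : set R).
Local Notation mfun f := (@measurable_fun _ _ (measurableTypeR R) R D f).
Local Notation mfunT f := (@measurable_fun _ _ (measurableTypeR R) R setT f).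

Lemma fourier_sqr_ge0 F k : 0 <= fourier_sqr F k.
Proof. by rewrite addr_ge0// sqr_ge0. Qed.

Lemma fourier_sqr_distr f k : fourier_sqr (distr_of f) k = amp f k ^+ 2.
Proof. by rewrite amp_sqr. Qed.

Lemma esum_le_weighted_bound r F x : weighted_bound r (fourier_sqr F) x ->
  (\esum_(k in [set: int])
      ((1 + (2 * pi * k%:~R) ^+ 2) `^ r * fourier_sqr F k)%:E <= x%:E)%E.
Proof.
move=> h; apply: ge_ereal_sup => _ [A [fA _] <-].
rewrite fsbig_finite//= sumEFin lee_fin.
by apply: h; exact: finmap.fset_uniq.
Qed.

Lemma weighted_bound_esum r F x : (\esum_(k in [set: int])
      ((1 + (2 * pi * k%:~R) ^+ 2) `^ r * fourier_sqr F k)%:E <= x%:E)%E ->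
  weighted_bound r (fourier_sqr F) x.
Proof.
move=> h S uS; rewrite -lee_fin; apply: le_trans h.
apply: esum_ge; exists [set` S]; first by split => //; exact: finite_seq.
rewrite fsbig_finite; [|exact: finite_seq].
rewrite sumEFin lee_fin le_eqVlt; apply/orP; left; apply/eqP.
apply: perm_big; apply: uniq_perm => //; first exact: finmap.fset_uniq.
move=> k; rewrite in_fset_set; last exact: finite_seq.
by apply/idP/idP => [kS|/set_mem//]; exact/mem_set.
Qed.

Lemma Hnorm_le r F x : 0 <= x -> weighted_bound r (fourier_sqr F) (x ^+ 2) ->
  (Hnorm r F <= x%:E)%E.
Proof.
move=> x0 /esum_le_weighted_bound h; rewrite /Hnorm.
have -> : x%:E = ((x ^+ 2)%:E `^ 2^-1)%E.
  by rewrite poweR_EFin powR12_sqrt ?sqr_ge0// sqrtr_sqr ger0_norm.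
apply: gt0_ler_poweR => //.
- by rewrite in_itv/= leey andbT; apply: esum_ge0 => k _;
    rewrite lee_fin mulr_ge0 ?powR_ge0 ?fourier_sqr_ge0.
- by rewrite in_itv/= leey andbT lee_fin sqr_ge0.
Qed.

Lemma weighted_bound_Hnorm r F x : 0 <= x -> (Hnorm r F <= x%:E)%E ->
  weighted_bound r (fourier_sqr F) (x ^+ 2).
Proof.
move=> x0 h; apply: weighted_bound_esum; move: h; rewrite /Hnorm.
set E := (\esum_(k in _) _)%E.
have : (0 <= E)%E by apply: esum_ge0 => k _;
    rewrite lee_fin mulr_ge0 ?powR_ge0 ?fourier_sqr_ge0.
case: E => [e| |]//.
  rewrite lee_fin poweR_EFin lee_fin => e0; rewrite powR12_sqrt// => h.
  rewrite lee_fin -(sqr_sqrtr e0) lerXn2r// nnegrE//.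
by rewrite poweRyr ?invr_neq0// leye_eq.
Qed.

Lemma Hnorm_ge0 r F : (0 <= Hnorm r F)%E.
Proof. exact: poweR_ge0. Qed.

Lemma cvge0P (I : Type) (FF : set_system I) (FFF : Filter FF) (f : I -> \bar R)
    :
  (forall i : I, 0 <= f i)%E ->
  (f i @[i --> FF] --> 0%E) <->
  (forall e, 0 < e -> \forall i \near FF, (f i <= e%:E)%E).
Proof.
move=> f0; split.
- move=> /fine_cvgP[fn /cvgrPdist_le h] e /h he.
  near=> t; have ft : f t \is a fin_num by near: t.
  rewrite -(fineK ft) lee_fin.
  have : `|0 - fine (f t)| <= e by near: t.
  by rewrite sub0r normrN; apply: le_trans; exact: ler_norm.
- move=> h; apply/fine_cvgP; split.
    near=> t; rewrite ge0_fin_numE//; apply: (@le_lt_trans _ _ 1%:E); last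
        exact: ltry.
    by near: t; exact: h.
  apply/cvgrPdist_le => e /h he; near=> t.
  rewrite sub0r normrN ger0_norm; last exact: fine_ge0.
  have fe : (f t <= e%:E)%E by near: t.
  rewrite -lee_fin fineK// ge0_fin_numE//.
  exact: le_lt_trans fe (ltry _).
Unshelve. all: by end_near. Qed.

Lemma near_withinP (A : set R) t (P : R -> Prop) :
  (\forall t' \near within A (nbhs t), P t') <->
  exists2 d, 0 < d & forall t', A t' -> `|t' - t| < d -> P t'.
Proof.
split.
- move=> /nbhs_ballP[d /= d0 h]; exists d => // t' At' ht.
  by apply: h => //; rewrite /ball /= distrC.
- move=> [d d0 h]; apply/nbhs_ballP; exists d => //= t' ht At'.
  by apply: h => //; move: ht; rewrite /ball /= distrC.
Qed.

Lemma near_within_dnbhsP (A : set R) t (P : R -> Prop) :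
  (\forall t' \near within A t^', P t') <->
  exists2 d, 0 < d & forall t', A t' -> t' != t -> `|t' - t| < d -> P t'.
Proof.
split.
- move=> /nbhs_ballP[d /= d0 h]; exists d => // t' At' tt' ht.
  by apply: h => //; rewrite /ball /= distrC.
- move=> [d d0 h]; apply/nbhs_ballP; exists d => //= t' ht tt' At'.
  by apply: h => //; move: ht; rewrite /ball /= distrC.
Qed.

(** * Functions on the circle and the bilinear map *)

Lemma circle_mfunT f : L2_circle f -> mfunT f.
Proof. by case. Qed.

Lemma circle_L2 f : L2_circle f -> L2 f.
Proof. by case=> _ mf hf; split=> //; exact: mfun_T. Qed.

Lemma circle_integrable01 f : L2_circle f -> integrable01 f.
Proof. by move=> /circle_L2 /L2_integrable01. Qed.

Lemma L2_circleP f : periodic f 1 -> mfunT f -> L2 f -> L2_circle f.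
Proof. by move=> pf mf [_ hf]; split. Qed.

Lemma circle_lin c f g : L2_circle f -> L2_circle g ->
  L2_circle (fun x => c * f x + g x).
Proof.
move=> hf hg; apply: L2_circleP.
- by case: hf => pf _ _; case: hg => pg _ _ x; rewrite pf pg.
- apply: measurable_funD; last exact: circle_mfunT.
  by apply: measurable_funM; [exact: measurable_cst|exact: circle_mfunT].
- by apply: L2D; [apply: L2Z|]; exact: circle_L2.
Qed.

Lemma circle_cst c : L2_circle (fun=> c).
Proof. by apply: L2_circleP => //; exact: L2_cst. Qed.

Lemma circleZ c f : L2_circle f -> L2_circle (fun x => c * f x).
Proof.
move=> hf; have := circle_lin c hf (circle_cst 0).
by have -> : (fun x => c * f x + 0) = (fun x => c * f x)
  by apply/funext => x; rewrite addr0.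
Qed.

Lemma circleB f g : L2_circle f -> L2_circle g -> L2_circle (fun x => f x - g
    x).
Proof.
move=> hf hg; have := circle_lin (-1) hg hf.
by have -> : (fun x => -1 * g x + f x) = (fun x => f x - g x)
  by apply/funext => x; rewrite mulN1r addrC.
Qed.

Definition cprod f g := dxG_conv (fun z => f z * g z).

Lemma cprod_mfunT f g : L2_circle f -> L2_circle g -> mfunT (fun z => f z * g
    z).
Proof. by move=> hf hg; apply: measurable_funM; exact: circle_mfunT. Qed.

Lemma cprod_integrable01 f g : L2_circle f -> L2_circle g -> integrable01 (fun
    z => f z * g z).
Proof. by move=> hf hg; apply: integrable01_L2M; exact: circle_L2. Qed.

Lemma circle_cprod f g : L2_circle f -> L2_circle g -> L2_circle (cprod f g).
Proof.
move=> hf hg; have mh := cprod_mfunT hf hg; have hi := cprod_integrable01 hf hg.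
have mc : mfunT (cprod f g) by exact: measurable_dxG_conv.
apply: L2_circleP.
- by apply: dxG_conv_periodic; exact: mfun_T.
- exact: mc.
- apply: (@L2_bnd _ _ (2^-1 * integral01 (fun y => `|f y * g y|))); first
    exact: mfun_T.
  by move=> x _; exact: dxG_conv_le.
Qed.

Lemma conv_lin c f g x : mfunT f -> mfunT g -> integrable01 f -> integrable01 g
    ->
  dxG_conv (fun z => c * f z + g z) x = c * dxG_conv f x + dxG_conv g x.
Proof.
move=> mf mg hf hg.
rewrite (@dxG_convE _ (fun z => c * f z + g z) x); last first.
  apply: mfun_T; apply: measurable_funD => //.
  by apply: measurable_funM; [exact: measurable_cst|].
rewrite (@dxG_convE _ f x); last exact: mfun_T.
rewrite (@dxG_convE _ g x); last exact: mfun_T.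
rewrite -integral01Z; last exact: integrable01_conv.
rewrite -integral01D; [|by apply: integrable01Z; exact:
    integrable01_conv|exact: integrable01_conv].
by apply: eq_integral01 => y _; ring.
Qed.

Lemma cprod_linl c f g h x : L2_circle f -> L2_circle g -> L2_circle h ->
  cprod (fun z => c * f z + g z) h x = c * cprod f h x + cprod g h x.
Proof.
move=> hf hg hh; rewrite /cprod -conv_lin; last 4 first.
- exact: cprod_mfunT.
- exact: cprod_mfunT.
- exact: cprod_integrable01.
- exact: cprod_integrable01.
by congr dxG_conv; apply/funext => z; ring.
Qed.

Lemma cprodC f g : cprod f g = cprod g f.
Proof. by congr dxG_conv; apply/funext => z; rewrite mulrC. Qed.

Lemma cprod_linr c f g h x : L2_circle f -> L2_circle g -> L2_circle h ->
  cprod h (fun z => c * f z + g z) x = c * cprod h f x + cprod h g x.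
Proof. by move=> hf hg hh; rewrite ![cprod h _]cprodC cprod_linl. Qed.

(** The factor [1] gives the right-hand side the shape [c * f + g] of the lemmas on linear
    combinations. *)
Lemma cprod_diff f f' g g' z :
  L2_circle f -> L2_circle f' -> L2_circle g -> L2_circle g' ->
  cprod f' g' z - cprod f g z = 1 * cprod (fun x => f' x - f x) g' z +
    cprod f (fun x => g' x - g x) z.
Proof.
move=> hf hf' hg hg'.
have -> : (fun x => f' x - f x) = (fun x => -1 * f x + f' x).
  by apply/funext => ?; ring.
have -> : (fun x => g' x - g x) = (fun x => -1 * g x + g' x).
  by apply/funext => ?; ring.
by rewrite cprod_linl// cprod_linr//; ring.
Qed.

(** Frequency by frequency, [(a + b)^2 <= 2 a^2 + 2 b^2]. It plays the role of the triangle
    inequality, since the bounds are on squared norms. *)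
Lemma sobolev_lin r c f g x y : integrable01 f -> integrable01 g ->
    sobolev_bound r f x -> sobolev_bound r g y ->
  sobolev_bound r (fun z => c * f z + g z) (2 * (c ^+ 2 * x + y)).
Proof.
move=> hf hg hx hy S uS; have := hx S uS; have := hy S uS => h1 h2.
apply: (@le_trans _ _ (\sum_(k <- S) (2 * c ^+ 2 * (weight R k `^ r * amp f k
    ^+ 2) +
    2 * (weight R k `^ r * amp g k ^+ 2)))).
  apply: ler_sum => k _; rewrite !amp_sqr cos_coef_lin// sin_coef_lin//.
  move: (cos_coef f k) (sin_coef f k) (cos_coef g k) (sin_coef g k) => a b a'
      b'.
  have : (c * a + a') ^+ 2 + (c * b + b') ^+ 2 <=
      2 * c ^+ 2 * (a ^+ 2 + b ^+ 2) + 2 * (a' ^+ 2 + b' ^+ 2).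
    by have := sqr_ge0 (c * a - a'); have := sqr_ge0 (c * b - b'); lra.
  by move/(ler_wpM2l (powR_ge0 (weight R k) r)); lra.
rewrite big_split /= -!mulr_sumr.
by have := ler_wpM2l (sqr_ge0 c) h2; lra.
Qed.

Lemma eq_sobolev r f g x : (forall k, cos_coef f k = cos_coef g k) -> (forall
    k, sin_coef f k = sin_coef g k) ->
  sobolev_bound r f x -> sobolev_bound r g x.
Proof.
move=> ab bb h S uS; have := h S uS; under eq_bigr do rewrite amp_sqr ab bb.
by under [X in _ -> X <= _]eq_bigr do rewrite amp_sqr.
Qed.

Lemma sobolev_weak r f x y : x <= y -> sobolev_bound r f x -> sobolev_bound r f
    y.
Proof. by move=> xy h S uS; exact: le_trans (h S uS) xy. Qed.

Lemma sobolev_bound0 r x : 0 <= x -> sobolev_bound r (fun=> 0) x.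
Proof.
move=> x0 S uS; rewrite big1// => k _.
have E : integral01 (fun=> 0 : R) = 0 by rewrite integral01_cst.
have -> : amp (fun=> 0 : R) k ^+ 2 = 0; last by rewrite mulr0.
rewrite amp_sqr /cos_coef /sin_coef.
have -> : integral01 (fun x => 0 * cos_mode k x) = 0 by rewrite -[RHS]E; apply:
    eq_integral01 => *; rewrite mul0r.
have -> : integral01 (fun x => 0 * sin_mode k x) = 0 by rewrite -[RHS]E; apply:
    eq_integral01 => *; rewrite mul0r.
by rewrite expr0n addr0.
Qed.

Lemma sobolev_bound1 r : sobolev_bound r (fun=> 1) 1.
Proof.
move=> S uS.
have a1 k : amp (fun=> 1 : R) k ^+ 2 = (k == 0)%:R.
  rewrite amp_sqr.
  have -> : cos_coef (fun=> 1 : R) k = (k == 0)%:R.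
    by rewrite -integral01_cos_mode; apply: eq_integral01 => x _; rewrite mul1r.
  have -> : sin_coef (fun=> 1 : R) k = 0.
    by rewrite -(@integral01_sin_mode R k); apply: eq_integral01 => x _;
        rewrite mul1r.
  by case: eqP; rewrite ?expr1n expr0n ?addr0.
apply: (@le_trans _ _ (\sum_(k <- [:: 0%Z]) weight R k `^ r * amp (fun=> 1 : R)
    k ^+ 2)).
  have [S0|S0] := boolP (0%Z \in S); last first.
    rewrite big_seq big1.
      by rewrite big_seq1; exact: mulr_ge0 (powR_ge0 _ _) (sqr_ge0 _).
    move=> k kS; by rewrite a1; case: eqP kS S0 => [->->//|]; rewrite mulr0.
  rewrite (bigD1_seq 0%Z)//= big_seq1 big1 ?addr0// => k k0.
  by rewrite a1 (negbTE k0) mulr0.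
by rewrite big_seq1 a1 eqxx mulr1 /weight mulr0 expr0n addr0 powR1.
Qed.

(** * Functions as periodic distributions *)

Lemma test_function_cont phi : test_function phi -> continuous phi.
Proof.
move=> [_ h] x; apply: differentiable_continuous; apply/derivable1_diffP.
exact: h 0%N x.
Qed.

Lemma test_function_bounded phi : test_function phi ->
  exists M, forall x, x \in `[(0:R), 1] -> `|phi x| <= M.
Proof.
move=> /test_function_cont c.
have : {within `[(0:R), 1], continuous (fun x => `|phi x|)}.
  apply: continuous_subspaceT => x; apply: cvg_norm; exact: c.
by move=> /(EVT_max ler01)[m _ hm]; exists `|phi m|.
Qed.

Lemma integrable01_test f phi : integrable01 f -> test_function phi ->
    integrable01 (fun x => f x * phi x).
Proof.
move=> hf hp; have [M hM] := test_function_bounded hp.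
by apply: (integrable01M_bnd (c := M)) => //; apply: cont_mfun; exact:
    test_function_cont.
Qed.

Lemma distr_of_periodic f : L2_circle f -> periodic_distribution (distr_of f).
Proof.
move=> hf; have hi := circle_integrable01 hf; split.
  move=> a phi psi hp hq; rewrite /distr_of.
  rewrite -[RHS]/(a * integral01 (fun x => f x * phi x) + integral01 (fun x =>
      f x * psi x)).
  rewrite -integral01Z; last exact: integrable01_test.
  rewrite -integral01D; [|by apply: integrable01Z; exact:
      integrable01_test|exact: integrable01_test].
  by apply: eq_integral01 => x _; ring.
exists (integral01 (fun x => `|f x|)), 0%N => phi M hp hM.
rewrite -[distr_of f phi]/(integral01 (fun x => f x * phi x)).
apply: le_trans (norm_integral01 (integrable01_test hi hp)) _.
rewrite mulrC -integral01Z; last exact: integrable01_norm.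
apply: le_integral01;
    [exact/integrable01_norm/integrable01_test|exact/integrable01Z/integrable01_norm|].
by move=> x _; rewrite normrM mulrC ler_wpM2r//; exact: (hM 0%N x).
Qed.

Lemma inH_sobolev r f x : L2_circle f -> sobolev_bound r f x -> inH r (distr_of
    f).
Proof.
move=> hf hx; split; first exact: distr_of_periodic.
have x0 := sobolev_ge0 hx.
apply: (@le_lt_trans _ _ (Num.sqrt x)%:E); last exact: ltry.
apply: Hnorm_le; first exact: sqrtr_ge0.
rewrite sqr_sqrtr// => S uS; under eq_bigr do rewrite fourier_sqr_distr.
exact: hx.
Qed.

Lemma sobolev_inH r f : inH r (distr_of f) -> exists x, sobolev_bound r f x.
Proof.
move=> [_ h]; have : exists2 x, 0 <= x & (Hnorm r (distr_of f) <= x%:E)%E.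
  move: h (Hnorm_ge0 r (distr_of f)); case: (Hnorm _ _) => [x| |]// _ x0.
  by exists x.
move=> [x x0 /(weighted_bound_Hnorm x0) hx]; exists (x ^+ 2) => S uS.
by under eq_bigr do rewrite -fourier_sqr_distr; exact: hx.
Qed.

End SobolevNorm.

(** * Curves of functions *)

Section FunctionCurves.
Variable R : realType.
Variable T : R.
Implicit Types (f g h : R -> R) (v w : R -> R -> R) (c x y z e d r s t : R) (k
    : int) (n : nat).
Local Notation I := (`[- T, T]).

(** Membership in [H^r] at each time, with no uniformity in [t]. Here and in the next two
    definitions the bound is on the squared norm. *)
Definition sobolev_bounded r v := forall t, t \in I -> exists x, sobolev_bound
    r (v t) x.

Definition sobolev_cont r v := forall t, t \in I -> forall e, 0 < e ->
  exists2 d, 0 < d & forall t', t' \in I -> `|t' - t| < d ->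
    sobolev_bound r (fun x => v t' x - v t x) e.

Definition sobolev_deriv r v v' := forall t, t \in I -> forall e, 0 < e ->
  exists2 d, 0 < d & forall t', t' \in I -> t' != t -> `|t' - t| < d ->
    sobolev_bound r (fun x => (t' - t)^-1 * (v t' x - v t x) - v' t x) e.

Definition circle_curve v := forall t, t \in I -> L2_circle (v t).

(** Unlike in [Ck_curve], the successive derivatives are curves of functions, not only of
    functionals, so that they can be multiplied. *)
Fixpoint Ck_function_curve r n v : Prop :=
  [/\ circle_curve v, sobolev_bounded r v, sobolev_cont r v &
      if n is n'.+1 then exists2 v', sobolev_deriv r v v' & Ck_function_curve r
          n' v' else True].

Lemma Ck_function_curve_circle r n v : Ck_function_curve r n v -> circle_curve
    v.
Proof. by case: n => [|n] []. Qed.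

Lemma Ck_function_curve_bounded r n v : Ck_function_curve r n v ->
    sobolev_bounded r v.
Proof. by case: n => [|n] []. Qed.

Lemma Ck_function_curve_cont r n v : Ck_function_curve r n v -> sobolev_cont r
    v.
Proof. by case: n => [|n] []. Qed.

Lemma weighted_bound_ext r (F G : int -> R) x : (forall k, F k = G k) ->
  weighted_bound r F x -> weighted_bound r G x.
Proof. by move=> FG h S uS; under eq_bigr do rewrite -FG; exact: h. Qed.

Lemma fourier_sqr_lin c f g k : L2_circle f -> L2_circle g ->
  fourier_sqr (fun phi => c * distr_of f phi + distr_of g phi) k =
  amp (fun x => c * f x + g x) k ^+ 2.
Proof.
move=> /circle_integrable01 hf /circle_integrable01 hg.
by rewrite amp_sqr cos_coef_lin// sin_coef_lin.
Qed.

Lemma cos_coef_comb c f g h k : integrable01 f -> integrable01 g ->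
    integrable01 h ->
  cos_coef (fun x => c * (f x - g x) - h x) k = c * (cos_coef f k - cos_coef g
      k) - cos_coef h k.
Proof.
move=> hf hg hh; rewrite /cos_coef -integral01B; [|exact:
    integrable01_cos_mode|exact: integrable01_cos_mode].
rewrite -integral01Z; last by apply: integrable01B; exact:
    integrable01_cos_mode.
rewrite -integral01B; [|by apply: integrable01Z; apply: integrable01B; exact:
    integrable01_cos_mode|exact: integrable01_cos_mode].
by apply: eq_integral01 => x _; ring.
Qed.

Lemma sin_coef_comb c f g h k : integrable01 f -> integrable01 g ->
    integrable01 h ->
  sin_coef (fun x => c * (f x - g x) - h x) k = c * (sin_coef f k - sin_coef g
      k) - sin_coef h k.
Proof.
move=> hf hg hh; rewrite /sin_coef -integral01B; [|exact:
    integrable01_sin_mode|exact: integrable01_sin_mode].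
rewrite -integral01Z; last by apply: integrable01B; exact:
    integrable01_sin_mode.
rewrite -integral01B; [|by apply: integrable01Z; apply: integrable01B; exact:
    integrable01_sin_mode|exact: integrable01_sin_mode].
by apply: eq_integral01 => x _; ring.
Qed.

Lemma Hnorm_small r F e : 0 < e -> weighted_bound r (fourier_sqr F) (e ^+ 2) ->
  (Hnorm r F <= e%:E)%E.
Proof. by move=> e0; apply: Hnorm_le; exact: ltW. Qed.

Lemma Ck_function_curve_Ck_curve r n v : Ck_function_curve r n v -> Ck_curve r
    T n (fun t => distr_of (v t)).
Proof.
have key v' : circle_curve v' -> sobolev_bounded r v' -> sobolev_cont r v' ->
    continuous_curve r T (fun t => distr_of (v' t)).
  move=> vc vb vs t tI; split.
    by have [x hx] := vb t tI; apply: (inH_sobolev (x := x)) => //; exact: vc.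
  apply/(cvge0P _ (fun t => Hnorm_ge0 r _)) => e e0; apply/near_withinP.
  have [d d0 hd] := vs t tI _ (exprn_gt0 2 e0).
  exists d => // t' t'I t't; apply: Hnorm_small => //.
  apply: weighted_bound_ext (hd t' t'I t't) => k.
  have -> : (fun phi => distr_of (v' t') phi - distr_of (v' t) phi) =
      (fun phi => -1 * distr_of (v' t) phi + distr_of (v' t') phi).
    by apply/funext => phi; rewrite mulN1r addrC.
  rewrite fourier_sqr_lin; [|exact: vc|exact: vc]; congr (amp _ k ^+ 2).
  by apply/funext => x; rewrite mulN1r addrC.
elim: n v => [|n ih] v; first by move=> [vc vb vs _]; split => //; exact: key.
move=> [vc vb vs [v' dv cv]]; split; first exact: key.
exists (fun t => distr_of (v' t)); split; last exact: ih.
move=> t tI.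
apply/(cvge0P _ (fun t => Hnorm_ge0 r _)) => e e0; apply/near_within_dnbhsP.
have [d d0 hd] := dv t tI _ (exprn_gt0 2 e0).
exists d => // t' t'I t'N t't; apply: Hnorm_small => //.
apply: weighted_bound_ext (hd t' t'I t'N t't) => k.
have vc' := Ck_function_curve_circle cv.
rewrite amp_sqr cos_coef_comb ?sin_coef_comb//; apply: circle_integrable01;
  by [exact: vc|exact: vc'].
Qed.

Lemma Ck_function_curve_ext r n v w : (forall t x, v t x = w t x) ->
    Ck_function_curve r n v -> Ck_function_curve r n w.
Proof. by move=> vw; have -> : v = w by apply/funext => t; apply/funext => x.
    Qed.

Lemma Ck_function_curve_pred r n v : Ck_function_curve r n.+1 v ->
    Ck_function_curve r n v.
Proof.
elim: n v => [|n ih] v [vc vb vs [v' dv cv]]; split => //.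
by exists v' => //; exact: ih.
Qed.

Lemma sobolev_bounded_lin r c v w : circle_curve v -> circle_curve w ->
  sobolev_bounded r v -> sobolev_bounded r w ->
  sobolev_bounded r (fun t x => c * v t x + w t x).
Proof.
move=> vc wc vb wb t tI; have [x hx] := vb t tI; have [y hy] := wb t tI.
exists (2 * (c ^+ 2 * x + y)); apply: sobolev_lin => //; apply:
    circle_integrable01;
  by [exact: vc|exact: wc].
Qed.

(** The common tolerance for two curves that [sobolev_lin] with coefficient [c] turns into at most
    [e]. *)
Lemma small_combination c e : 0 < e -> 0 < e / (4 * (c ^+ 2 + 1)).
Proof. by move=> e0; rewrite divr_gt0// mulr_gt0// ltr_wpDl// sqr_ge0. Qed.

Lemma small_combinationE c e : 0 < e ->
  2 * (c ^+ 2 * (e / (4 * (c ^+ 2 + 1))) + e / (4 * (c ^+ 2 + 1))) <= e.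
Proof.
move=> e0; have c1 : 0 < c ^+ 2 + 1 by rewrite ltr_wpDl// sqr_ge0.
have -> : 2 * (c ^+ 2 * (e / (4 * (c ^+ 2 + 1))) + e / (4 * (c ^+ 2 + 1))) = e
    / 2.
  by field; rewrite gt_eqF.
lra.
Qed.

Lemma sobolev_cont_lin r c v w : circle_curve v -> circle_curve w ->
  sobolev_cont r v -> sobolev_cont r w -> sobolev_cont r (fun t x => c * v t x
      + w t x).
Proof.
move=> vc wc vs ws t tI e e0.
have [d1 d10 h1] := vs t tI _ (small_combination c e0).
have [d2 d20 h2] := ws t tI _ (small_combination c e0).
exists (Num.min d1 d2); first by rewrite lt_min d10.
move=> t' t'I; rewrite lt_min => /andP[t1 t2].
apply: sobolev_weak (small_combinationE c e0) _.
have -> : (fun x => c * v t' x + w t' x - (c * v t x + w t x)) =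
    (fun x => c * (v t' x - v t x) + (w t' x - w t x)).
  by apply/funext => x; ring.
apply: sobolev_lin; [| |exact: h1|exact: h2]; apply: circle_integrable01;
    apply: circleB;
  by [exact: vc|exact: wc].
Qed.

Lemma Ck_function_curve_lin r c n v w : Ck_function_curve r n v ->
    Ck_function_curve r n w ->
  Ck_function_curve r n (fun t x => c * v t x + w t x).
Proof.
elim: n v w => [|n ih] v w [vc vb vs hv] [wc wb ws hw]; split.
- by move=> t tI; apply: circle_lin; [exact: vc|exact: wc].
- exact: sobolev_bounded_lin.
- exact: sobolev_cont_lin.
- by [].
- by move=> t tI; apply: circle_lin; [exact: vc|exact: wc].
- exact: sobolev_bounded_lin.
- exact: sobolev_cont_lin.
have [v' dv cv] := hv; have [w' dw cw] := hw.
exists (fun t x => c * v' t x + w' t x); last exact: ih.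
have vc' := Ck_function_curve_circle cv; have wc' := Ck_function_curve_circle
    cw.
move=> t tI e e0.
have [d1 d10 h1] := dv t tI _ (small_combination c e0).
have [d2 d20 h2] := dw t tI _ (small_combination c e0).
exists (Num.min d1 d2); first by rewrite lt_min d10.
move=> t' t'I t'N; rewrite lt_min => /andP[t1 t2].
apply: sobolev_weak (small_combinationE c e0) _.
have -> : (fun x => (t' - t)^-1 * (c * v t' x + w t' x - (c * v t x + w t x)) -
      (c * v' t x + w' t x)) =
    (fun x => c * ((t' - t)^-1 * (v t' x - v t x) - v' t x) +
       ((t' - t)^-1 * (w t' x - w t x) - w' t x)).
  by apply/funext => x; ring.
apply: sobolev_lin; [| |exact: h1|exact: h2]; apply: circle_integrable01;
    apply: circleB;
  first [apply: circleZ; apply: circleB|idtac];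
  by [exact: vc|exact: wc|exact: vc'|exact: wc'].
Qed.

Lemma Ck_function_curve_cst r n f x : L2_circle f -> sobolev_bound r f x ->
    Ck_function_curve r n (fun=> f).
Proof.
have E (g : R -> R) : (fun x => g x - g x) = (fun=> 0).
  by apply/funext => z; rewrite subrr.
elim: n f x => [|n ih] f x fc fx; split => //.
- by move=> t tI; exists x.
- by move=> t tI e e0; exists 1 => // t' _ _; rewrite E;
    exact/sobolev_bound0/ltW.
- by move=> t tI; exists x.
- by move=> t tI e e0; exists 1 => // t' _ _; rewrite E;
    exact/sobolev_bound0/ltW.
exists (fun=> fun=> 0); last exact: ih (circle_cst 0) (sobolev_bound0 r (lexx
    0)).
move=> t tI e e0; exists 1 => // t' _ _ _.
have -> : (fun x => (t' - t)^-1 * (f x - f x) - 0) = (fun=> 0).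
  by apply/funext => z; rewrite subrr mulr0 subr0.
exact/sobolev_bound0/ltW.
Qed.

Section Product.
Variables (s r : R).
Hypotheses (s0 : 0 <= s) (rs : r <= s + 1) (r4 : 2 * (r - 1) < 4 * s - 1).

(** Continuity with tolerance 1 bounds the norm uniformly near [t]; this handles the factor taken at
    time [t'] in differences of products. *)
Lemma near_bound v t x : circle_curve v -> sobolev_cont s v -> t \in I ->
    sobolev_bound s (v t) x ->
  exists2 d, 0 < d & forall t', t' \in I -> `|t' - t| < d ->
    sobolev_bound s (v t') (2 * (1 + x)).
Proof.
move=> vc vs tI hx; have [d d0 hd] := vs t tI _ (@ltr01 R).
exists d => // t' t'I t't.
have -> : v t' = (fun x => 1 * (v t' x - v t x) + v t x).
  by apply/funext => z; rewrite mul1r subrK.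
have -> : 2 * (1 + x) = 2 * (1 ^+ 2 * 1 + x) by ring.
by apply: sobolev_lin; [| |exact: hd|exact: hx]; apply: circle_integrable01;
  [apply: circleB; exact: vc|exact: vc].
Qed.

Lemma sobolev_bounded_prod v w : circle_curve v -> circle_curve w ->
  sobolev_bounded s v -> sobolev_bounded s w -> sobolev_bounded r (fun t =>
      cprod (v t) (w t)).
Proof.
have [C C0 hC] := conv_product_bound s0 rs r4.
move=> vc wc vb wb t tI; have [x hx] := vb t tI; have [y hy] := wb t tI.
exists (C * (x * y)); apply: hC => //; try exact: circle_mfunT (vc t tI);
  try exact: circle_mfunT (wc t tI); try exact: circle_L2 (vc t tI);
  exact: circle_L2 (wc t tI).
Qed.

Lemma sobolev_cont_prod v w : circle_curve v -> circle_curve w ->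
  sobolev_bounded s v -> sobolev_bounded s w -> sobolev_cont s v ->
      sobolev_cont s w ->
  sobolev_cont r (fun t => cprod (v t) (w t)).
Proof.
have [C C0 hC] := conv_product_bound s0 rs r4.
move=> vc wc vb wb vs ws t tI e e0.
have [x hx] := vb t tI; have [y hy] := wb t tI.
have x0 := sobolev_ge0 hx; have y0 := sobolev_ge0 hy.
pose M := 2 * (C * (2 * (1 + y) + x)) + 1.
have M0 : 0 < M by rewrite ltr_wpDl// !mulr_ge0// addr_ge0// mulr_ge0//
    addr_ge0.
have em : 0 < e / M by rewrite divr_gt0.
have [d1 d10 h1] := vs t tI _ em.
have [d2 d20 h2] := ws t tI _ em.
have [d3 d30 h3] := near_bound wc ws tI hy.
exists (Num.min d1 (Num.min d2 d3)); first by rewrite !lt_min d10 d20.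
move=> t' t'I; rewrite !lt_min => /and3P[t1 t2 t3].
have cdv : L2_circle (fun x => v t' x - v t x) by apply: circleB; exact: vc.
have cdw : L2_circle (fun x => w t' x - w t x) by apply: circleB; exact: wc.
have -> : (fun x => cprod (v t') (w t') x - cprod (v t) (w t) x) =
    (fun x => 1 * cprod (fun x => v t' x - v t x) (w t') x +
              cprod (v t) (fun x => w t' x - w t x) x).
  apply/funext => z; apply: cprod_diff; by [exact: vc|exact: wc].
have k1 := hC _ _ _ _ (circle_mfunT cdv) (circle_mfunT (wc t' t'I))
  (circle_L2 cdv) (circle_L2 (wc t' t'I)) (h1 t' t'I t1) (h3 t' t'I t3).
have k2 := hC _ _ _ _ (circle_mfunT (vc t tI)) (circle_mfunT cdw)
  (circle_L2 (vc t tI)) (circle_L2 cdw) hx (h2 t' t'I t2).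
apply: sobolev_weak (sobolev_lin _ _ _ k1 k2); last 2 first.
- by apply: circle_integrable01; apply: circle_cprod => //; exact: wc.
- by apply: circle_integrable01; apply: circle_cprod => //; exact: vc.
have -> : 2 * (1 ^+ 2 * (C * (e / M * (2 * (1 + y)))) + C * (x * (e / M))) =
   (2 * (C * (2 * (1 + y) + x))) * (e / M) by ring.
have : M * (e / M) = e by rewrite mulrC divfK// gt_eqF.
by rewrite {1}/M mulrDl mul1r; lra.
Qed.

(** The error of the product rule is a sum of three products, each with one factor tending to 0 (the
    error for [v], the increment of [w], the error for [w]) and one that stays bounded. *)
Lemma sobolev_deriv_prod v w v' w' :
  circle_curve v -> circle_curve w -> circle_curve v' -> circle_curve w' ->
  sobolev_bounded s v -> sobolev_bounded s w -> sobolev_bounded s v' ->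
      sobolev_cont s w ->
  sobolev_deriv s v v' -> sobolev_deriv s w w' ->
  sobolev_deriv r (fun t => cprod (v t) (w t))
    (fun t x => 1 * cprod (v' t) (w t) x + cprod (v t) (w' t) x).
Proof.
have [C C0 hC] := conv_product_bound s0 rs r4.
move=> vc wc vc' wc' vb wb vb' ws dv dw t tI e e0.
have [x hx] := vb t tI; have [y hy] := wb t tI; have [x' hx'] := vb' t tI.
have x0 := sobolev_ge0 hx; have y0 := sobolev_ge0 hy; have x'0 := sobolev_ge0
    hx'.
(* The factor 4 pays for two nested uses of [sobolev_lin]; the final 1 makes [M] positive. *)
pose M := 4 * (C * (2 * (1 + y) + x' + x)) + 1.
have M0 : 0 < M.
  by rewrite ltr_wpDl// !mulr_ge0// addr_ge0// addr_ge0// mulr_ge0// addr_ge0.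
have em : 0 < e / M by rewrite divr_gt0.
have [d1 d10 h1] := dv t tI _ em.
have [d2 d20 h2] := dw t tI _ em.
have [d3 d30 h3] := near_bound wc ws tI hy.
have [d4 d40 h4] := ws t tI _ em.
exists (Num.min d1 (Num.min d2 (Num.min d3 d4))).
  by rewrite !lt_min d10 d20 d30.
move=> t' t'I t'N; rewrite !lt_min => /and4P[t1 t2 t3 t4].
set a := (t' - t)^-1.
pose dqv x := a * (v t' x - v t x) - v' t x.
pose dqw x := a * (w t' x - w t x) - w' t x.
pose dw0 x := w t' x - w t x.
have cqv : L2_circle dqv.
  apply: circleB; last exact: vc'.
  by apply: circleZ; apply: circleB; exact: vc.
have cqw : L2_circle dqw.
  apply: circleB; last exact: wc'.
  by apply: circleZ; apply: circleB; exact: wc.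
have cdw : L2_circle dw0 by apply: circleB; exact: wc.
have -> : (fun x => a * (cprod (v t') (w t') x - cprod (v t) (w t) x) -
      (1 * cprod (v' t) (w t) x + cprod (v t) (w' t) x)) =
    (fun x => 1 * cprod dqv (w t') x +
       (1 * cprod (v' t) dw0 x + cprod (v t) dqw x)).
  apply/funext => z.
  have cvt := vc t tI; have cvt' := vc t' t'I; have cv't := vc' t tI.
  have cwt := wc t tI; have cwt' := wc t' t'I; have cw't := wc' t tI.
  have -> : dqv = (fun x => a * (-1 * v t x + v t' x) + -1 * v' t x).
    by apply/funext => ?; rewrite /dqv; ring.
  have -> : dqw = (fun x => a * (-1 * w t x + w t' x) + -1 * w' t x).
    by apply/funext => ?; rewrite /dqw; ring.
  have -> : dw0 = (fun x => -1 * w t x + w t' x).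
    by apply/funext => ?; rewrite /dw0; ring.
  rewrite cprod_linl//; [|exact: circle_lin|exact: circleZ].
  rewrite (cprod_linl (-1) z cvt cvt' cwt').
  rewrite (cprod_linr a z (circle_lin (-1) cwt cwt') (circleZ (-1) cw't) cvt).
  rewrite (cprod_linr (-1) z cwt cwt' cvt) (cprod_linr (-1) z cwt cwt' cv't).
  have zl f g : L2_circle f -> L2_circle g ->
      cprod (fun x => -1 * f x) g z = - cprod f g z.
    move=> cf cg; have := @cprod_linl R (-2) f f g z cf cf cg.
    have -> : (fun z => -2 * f z + f z) = (fun x => -1 * f x).
      by apply/funext => ?; ring.
    by move=> ->; ring.
  have zr f g : L2_circle f -> L2_circle g ->
      cprod g (fun x => -1 * f x) z = - cprod g f z.
    by move=> cf cg; rewrite ![cprod g _]cprodC zl.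
  by rewrite zl// zr//; ring.
have k1 := hC _ _ _ _ (circle_mfunT cqv) (circle_mfunT (wc t' t'I))
  (circle_L2 cqv) (circle_L2 (wc t' t'I)) (h1 t' t'I t'N t1) (h3 t' t'I t3).
have k2 := hC _ _ _ _ (circle_mfunT (vc' t tI)) (circle_mfunT cdw)
  (circle_L2 (vc' t tI)) (circle_L2 cdw) hx' (h4 t' t'I t4).
have k3 := hC _ _ _ _ (circle_mfunT (vc t tI)) (circle_mfunT cqw)
  (circle_L2 (vc t tI)) (circle_L2 cqw) hx (h2 t' t'I t'N t2).
have c1 := circle_cprod cqv (wc t' t'I).
have c2 := circle_cprod (vc' t tI) cdw.
have c3 := circle_cprod (vc t tI) cqw.
have k23 := sobolev_lin 1 (circle_integrable01 c2) (circle_integrable01 c3) k2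
    k3.
have k123 := sobolev_lin 1 (circle_integrable01 c1) (circle_integrable01
    (circle_lin 1 c2 c3)) k1 k23.
apply: sobolev_weak k123.
set m := e / M in em *.
have : M * m = e by rewrite mulrC divfK// gt_eqF.
have m0 := ltW em.
have := mulr_ge0 C0 (mulr_ge0 m0 (addr_ge0 ler01 y0)).
rewrite {1}/M; lra.
Qed.

End Product.

Lemma Ck_function_curve_prod s r n v w : 0 <= s -> r <= s + 1 -> 2 * (r - 1) <
    4 * s - 1 ->
  Ck_function_curve s n v -> Ck_function_curve s n w -> Ck_function_curve r n
      (fun t => cprod (v t) (w t)).
Proof.
move=> s0 rs r4; elim: n v w => [|n ih] v w hv hw.
  have [vc vb vs _] := hv; have [wc wb ws _] := hw; split.
  - by move=> t tI; apply: circle_cprod; [exact: vc|exact: wc].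
  - exact: (sobolev_bounded_prod s0 rs r4).
  - exact: (sobolev_cont_prod s0 rs r4).
  - by [].
have [vc vb vs [v' dv cv]] := hv; have [wc wb ws [w' dw cw]] := hw; split.
- by move=> t tI; apply: circle_cprod; [exact: vc|exact: wc].
- exact: (sobolev_bounded_prod s0 rs r4).
- exact: (sobolev_cont_prod s0 rs r4).
exists (fun t x => 1 * cprod (v' t) (w t) x + cprod (v t) (w' t) x).
  apply: (sobolev_deriv_prod s0 rs r4) => //.
  - exact: Ck_function_curve_circle cv.
  - exact: Ck_function_curve_circle cw.
  - exact: Ck_function_curve_bounded cv.
apply: (@Ck_function_curve_lin r 1 n (fun t => cprod (v' t) (w t)) (fun t =>
    cprod (v t) (w' t))).
  by apply: ih => //; exact: Ck_function_curve_pred.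
by apply: ih => //; exact: Ck_function_curve_pred.
Qed.

End FunctionCurves.

(** * Time derivatives *)

Section TimeDerivative.
Variable R : realType.
Variable T : R.
Implicit Types (f g h : R -> R) (v w : R -> R -> R) (a b c x y z e d r s t : R)
    (k : int) (n : nat).
Local Notation mu := (@lebesgue_measure R).
Local Notation I := (`[- T, T]).
Local Notation D := (`[(0:R), 1]%classic : set R).
Local Notation mfun f := (@measurable_fun _ _ (measurableTypeR R) R D f).

(** * Scalar calculus on the closed time interval *)

Definition continuous_on g := forall t, t \in I -> forall e, 0 < e ->
  exists2 d, 0 < d & forall t', t' \in I -> `|t' - t| < d -> `|g t' - g t| <= e.

Definition derivative_on g (dg : R -> R) := forall t, t \in I -> forall e, 0 <
    e ->
  exists2 d, 0 < d & forall t', t' \in I -> t' != t -> `|t' - t| < d ->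
    `|(t' - t)^-1 * (g t' - g t) - dg t| <= e.

Lemma continuous_on_within g : continuous_on g -> {within [set` I], continuous
    g}.
Proof.
move=> h; apply/subspace_continuousP => t tI.
apply/cvgrPdist_le => e /(h t tI)[d d0 hd]; apply/near_withinP.
by exists d => // t' t'I t't; rewrite distrC; exact: hd.
Qed.

Lemma derivative_on_continuous_on g (dg : R -> R) : derivative_on g dg ->
    continuous_on g.
Proof.
move=> h t tI e e0; have [d d0 hd] := h t tI 1 ltr01.
have m0 : 0 < e / (1 + `|dg t|) by rewrite divr_gt0// ltr_pwDl.
exists (Num.min d (e / (1 + `|dg t|))); first by rewrite lt_min d0.
move=> t' t'I; rewrite lt_min => /andP[t1 t2].
have [->|tN] := eqVneq t' t; first by rewrite subrr normr0 ltW.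
have tt0 : t' - t != 0 by rewrite subr_eq0.
have -> : g t' - g t = (t' - t) * ((t' - t)^-1 * (g t' - g t)) by rewrite
    mulVKf.
have h1 : `|(t' - t)^-1 * (g t' - g t)| <= 1 + `|dg t|.
  rewrite -[X in `|X|](subrK (dg t)); apply: le_trans (ler_normD _ _) _.
  by rewrite lerD2r; exact: hd.
rewrite normrM; apply: le_trans (ler_pM _ _ (ltW t2) h1) _ => //.
by rewrite divfK// gt_eqF// ltr_pwDl.
Qed.

Lemma derivative_on_is_derive g (dg : R -> R) t : derivative_on g dg -> - T < t
    < T ->
  is_derive t 1 g (dg t).
Proof.
move=> h /andP[t1 t2]; have tI : t \in I by rewrite in_itv/= !ltW.
have c : h^-1 *: ((g \o shift t) (h *: (1 : R)) - g t) @[h --> 0^'] --> dg t.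
  apply/cvgrPdist_le => e /(h t tI)[d d0 hd].
  have m0 : 0 < Num.min d (Num.min (T - t) (t + T)).
    by rewrite !lt_min d0/=; apply/andP; split; lra.
  apply/nbhs_ballP; exists (Num.min d (Num.min (T - t) (t + T))) => //= y.
  rewrite /ball /= sub0r normrN !lt_min => /and3P[y1 y2 y3] y0.
  have E : y + t - t = y by rewrite addrK.
  have := hd (y + t); rewrite E /= [_ *: 1]mulr1 distrC; apply => //.
    move: y2 y3; rewrite !ltr_norml => /andP[? ?] /andP[? ?].
    by rewrite in_itv/=; apply/andP; split; lra.
  by rewrite -subr_eq0 E.
apply: DeriveDef; first by apply: cvgP c.
exact: cvg_lim c.
Qed.

Lemma mvt_lt g (dg : R -> R) a b : derivative_on g dg -> a \in I -> b \in I ->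
    a < b ->
  exists2 c, a < c < b & g b - g a = dg c * (b - a).
Proof.
move=> h; rewrite !in_itv/= => /andP[a1 a2] /andP[b1 b2] ab.
have hd x : x \in `]a, b[ -> is_derive x 1 g (dg x).
  rewrite in_itv/= => /andP[x1 x2]; apply: derivative_on_is_derive h _.
  by apply/andP; split; lra.
have hc : {within `[a, b], continuous g}.
  apply: continuous_subspaceW (continuous_on_within
      (derivative_on_continuous_on h)).
  by move=> x /=; rewrite !in_itv/= => /andP[x1 x2]; apply/andP; split; lra.
have [c] := MVT ab hd hc.
by rewrite in_itv/= => cab E; exists c.
Qed.

(** Stated for [t] and [t'] in either order, with the intermediate point no farther from [t] than
    [t'] is, so that continuity at [t] applies to it. *)
Lemma mvt_eps g (dg : R -> R) t t' : derivative_on g dg -> t \in I -> t' \in I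
    ->
  t' != t -> exists c, [/\ c \in I, `|c - t| <= `|t' - t| &
    g t' - g t = dg c * (t' - t)].
Proof.
move=> h tI t'I; have := tI; have := t'I; rewrite !in_itv/=.
move=> /andP[a1 a2] /andP[b1 b2]; rewrite neq_lt => /orP[tt|tt].
- have [c /andP[c1 c2] E] := mvt_lt h t'I tI tt; exists c; split.
  + by rewrite in_itv/=; apply/andP; split; lra.
  + by rewrite !ltr0_norm ?subr_lt0//; lra.
  + by rewrite -opprB E -mulrN opprB.
- have [c /andP[c1 c2] E] := mvt_lt h tI t'I tt; exists c; split => //.
  + by rewrite in_itv/=; apply/andP; split; lra.
  + by rewrite !gtr0_norm ?subr_gt0//; lra.
Qed.

Lemma derivative_on_lin a b g h (dg dh : R -> R) : derivative_on g dg ->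
    derivative_on h dh ->
  derivative_on (fun t => a * g t + b * h t) (fun t => a * dg t + b * dh t).
Proof.
move=> hg hh t tI e e0.
have m0 : 0 < e / (`|a| + `|b| + 1) by rewrite divr_gt0// ltr_wpDl// addr_ge0.
have [d1 d10 h1] := hg t tI _ m0; have [d2 d20 h2] := hh t tI _ m0.
exists (Num.min d1 d2); first by rewrite lt_min d10.
move=> t' t'I t'N; rewrite lt_min => /andP[t1 t2].
have -> : (t' - t)^-1 * (a * g t' + b * h t' - (a * g t + b * h t)) -
   (a * dg t + b * dh t) = a * ((t' - t)^-1 * (g t' - g t) - dg t) +
   b * ((t' - t)^-1 * (h t' - h t) - dh t) by ring.
apply: le_trans (ler_normD _ _) _; rewrite !normrM.
have := ler_wpM2l (normr_ge0 a) (h1 t' t'I t'N t1).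
have := ler_wpM2l (normr_ge0 b) (h2 t' t'I t'N t2).
have : (`|a| + `|b| + 1) * (e / (`|a| + `|b| + 1)) = e.
  by rewrite mulrC divfK// gt_eqF// ltr_wpDl// addr_ge0.
by move: m0; set m := e / _ => m0; rewrite !mulrDl mul1r; lra.
Qed.

Lemma derivative_on_sum (S : seq int) (c : int -> R) (G dG : int -> R -> R) :
  (forall k, derivative_on (G k) (dG k)) ->
  derivative_on (fun t => \sum_(k <- S) c k * G k t) (fun t => \sum_(k <- S) c
      k * dG k t).
Proof.
move=> h; elim: S => [|k S ih].
  move=> t tI e e0; exists 1 => // t' _ _ _.
  by rewrite !big_nil !subrr mulr0 subr0 normr0 ltW.
have := derivative_on_lin (c k) 1 (h k) ih.
have -> : (fun t => c k * G k t + 1 * (\sum_(k <- S) c k * G k t)) =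
   (fun t => \sum_(k <- k :: S) c k * G k t).
  by apply/funext => t; rewrite big_cons mul1r.
have -> // : (fun t => c k * dG k t + 1 * (\sum_(k <- S) c k * dG k t)) =
   (fun t => \sum_(k <- k :: S) c k * dG k t).
by apply/funext => t; rewrite big_cons mul1r.
Qed.

Lemma continuous_on_integrable f a b : continuous_on f -> - T <= a -> b <= T ->
  mu.-integrable `[a, b] (EFin \o f).
Proof.
move=> h a1 b1; apply: continuous_compact_integrable; first exact:
    segment_compact.
apply: continuous_subspaceW (continuous_on_within h).
by move=> x /=; rewrite !in_itv/= => /andP[x1 x2]; apply/andP; split; lra.
Qed.

Lemma integral_add f a b c : continuous_on f -> - T <= a -> a <= b -> b <= c ->
    c <= T ->
  \int[mu]_(x in `[a, c]) f x =
  \int[mu]_(x in `[a, b]) f x + \int[mu]_(x in `[b, c]) f x.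
Proof.
move=> h a1 ab bc c1.
have := @Rintegral_itvB R f (BLeft a) (BRight c) b (continuous_on_integrable h
    a1 c1).
rewrite !bnd_simp => /(_ ab bc) E.
have i : mu.-integrable `]b, c] (EFin \o f); last first.
  by rewrite -(Rintegral_itv_obnd_cbnd i) -E addrC subrK.
apply: (@integrableS _ _ _ mu `[b, c]).
- exact: measurable_itv.
- exact: measurable_itv.
- by apply: subset_itvr; rewrite bnd_simp.
- by apply: continuous_on_integrable => //; lra.
Qed.

Lemma oriented_integral_diff f a b : 0 < T -> continuous_on f -> a \in I -> b
    \in I ->
  a <= b -> oriented_integral b f - oriented_integral a f =
  \int[mu]_(x in `[a, b]) f x.
Proof.
move=> T0 h; rewrite !in_itv/= => /andP[a1 a2] /andP[b1 b2] ab.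
rewrite /oriented_integral; have [a0|a0] := leP 0 a.
  rewrite (le_trans a0 ab) (@integral_add f 0 a b)//; last by lra.
  by rewrite addrC addKr.
have [b0|b0] := leP 0 b.
  by rewrite opprK addrC (@integral_add f a 0 b)// ltW.
rewrite opprK (@integral_add f a b 0)//; first by ring.
- exact: ltW.
- exact: ltW.
Qed.

Lemma integral_bounds f a b m M : continuous_on f -> - T <= a -> a < b -> b <=
    T ->
  (forall x, a <= x <= b -> m <= f x <= M) ->
  m * (b - a) <= \int[mu]_(x in `[a, b]) f x <= M * (b - a).
Proof.
move=> h a1 ab b1 hm.
have mab : measurable (`[a, b]%classic : set (measurableTypeR R)).
  exact: measurable_itv.
have C c : \int[mu]_(x in `[a, b]) c = c * (b - a).
  have mE : mu `[a, b]%classic = (b - a)%:E.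
    by rewrite lebesgue_measure_itv/= lte_fin ab.
  by rewrite (Rintegral_cst _ mab) [X in fine X]mE.
have ci c : mu.-integrable `[a, b] (EFin \o (fun=> c)).
  apply: continuous_compact_integrable; first exact: segment_compact.
  exact: cst_continuous.
have fi := continuous_on_integrable h a1 b1.
apply/andP; split; rewrite -C.
  by apply: (le_Rintegral mab (ci m) fi) => x /=; rewrite in_itv/= =>
      /hm/andP[].
by apply: (le_Rintegral mab fi (ci M)) => x /=; rewrite in_itv/= => /hm/andP[].
Qed.

(** The quotient is an average of [f] between [t] and [t']. The explicit modulus, unlike a limit,
    can be used uniformly in a parameter. *)
Lemma oriented_integral_quotient f t t' c e : 0 < T -> continuous_on f ->
  t \in I -> t' \in I -> t' != t ->
  (forall x, x \in I -> `|x - t| <= `|t' - t| -> `|f x - c| <= e) ->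
  `|(t' - t)^-1 * (oriented_integral t' f - oriented_integral t f) - c| <= e.
Proof.
move=> T0 h tI t'I; have := tI; have := t'I; rewrite !in_itv/=.
move=> /andP[a1 a2] /andP[b1 b2]; rewrite neq_lt => /orP[tt|tt] hc.
- have hb : forall x, t' <= x <= t -> c - e <= f x <= c + e.
    move=> x /andP[x1 x2]; rewrite -ler_distl; apply: hc.
      by rewrite in_itv/=; apply/andP; split; lra.
    by rewrite !ler0_norm ?subr_le0 ?(ltW tt)//; lra.
  have := integral_bounds h a1 tt b2 hb.
  rewrite -(oriented_integral_diff T0 h t'I tI (ltW tt)) => /andP[i1 i2].
  have p0 : 0 < t - t' by rewrite subr_gt0.
  set A := oriented_integral t' f in i1 i2 *.
  set B := oriented_integral t f in i1 i2 *.
  have -> : (t' - t)^-1 * (A - B) = (B - A) / (t - t').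
    by rewrite -[t' - t]opprB invrN mulNr -mulrN opprB mulrC.
  by rewrite ler_distl ler_pdivlMr// ler_pdivrMr// i1 i2.
- have hb : forall x, t <= x <= t' -> c - e <= f x <= c + e.
    move=> x /andP[x1 x2]; rewrite -ler_distl; apply: hc.
      by rewrite in_itv/=; apply/andP; split; lra.
    by rewrite !ger0_norm ?subr_ge0 ?(ltW tt)//; lra.
  have := integral_bounds h b1 tt a2 hb.
  rewrite -(oriented_integral_diff T0 h tI t'I (ltW tt)) => /andP[i1 i2].
  have p0 : 0 < t' - t by rewrite subr_gt0.
  by rewrite mulrC ler_distl ler_pdivlMr// ler_pdivrMr// i1 i2.
Qed.

(** The kernel is bounded, so Cauchy-Schwarz and Parseval control the sup norm of the product by L2
    norms. The condition on [x * y] avoids square roots. *)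
Lemma cprod_le f g x y a z : L2_circle f -> L2_circle g -> sobolev_bound 0 f x
    -> sobolev_bound 0 g y ->
  0 <= a -> x * y <= a ^+ 2 -> `|cprod f g z| <= a.
Proof.
move=> hf hg hx hy a0 xy.
apply: le_trans (dxG_conv_le z (cprod_mfunT hf hg) (cprod_integrable01 hf hg))
    _.
have h1 := L2_cauchy (circle_L2 hf) (circle_L2 hg).
have h2 := L2_le_sobolev (circle_L2 hf) hx; have h3 := L2_le_sobolev (circle_L2
    hg) hy.
have J0 : 0 <= integral01 (fun y => `|f y * g y|) by apply: integral01_ge0.
have Jf : 0 <= integral01 (fun y => f y ^+ 2) by apply: integral01_ge0 => *;
    exact: sqr_ge0.
have Jg : 0 <= integral01 (fun y => g y ^+ 2) by apply: integral01_ge0 => *;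
    exact: sqr_ge0.
suff : integral01 (fun y => `|f y * g y|) <= a by lra.
rewrite -(ler_pXn2r (n := 2))// ?nnegrE//.
apply: le_trans h1 _; apply: le_trans xy; exact: ler_pM.
Qed.

Lemma cprod_unif v w : circle_curve T v -> circle_curve T w ->
  sobolev_bounded T 0 v -> sobolev_bounded T 0 w -> sobolev_cont T 0 v ->
      sobolev_cont T 0 w ->
  forall t, t \in I -> forall e, 0 < e ->
  exists2 d, 0 < d & forall t', t' \in I -> `|t' - t| < d ->
    forall z, `|cprod (v t') (w t') z - cprod (v t) (w t) z| <= e.
Proof.
move=> vc wc vb wb vs ws t tI e e0.
have [x hx] := vb t tI; have [y hy] := wb t tI.
have x0 := sobolev_ge0 hx; have y0 := sobolev_ge0 hy.
pose M := 2 * (1 + y) + x.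
have M0 : 0 < M by rewrite /M; lra.
have e2 : 0 < (e / 2) ^+ 2 by rewrite exprn_gt0// divr_gt0.
have em : 0 < (e / 2) ^+ 2 / M by rewrite divr_gt0.
have ME : M * ((e / 2) ^+ 2 / M) = (e / 2) ^+ 2 by rewrite mulrC divfK// gt_eqF.
have [d1 d10 h1] := vs t tI _ em.
have [d2 d20 h2] := ws t tI _ em.
have [d3 d30 h3] := near_bound wc ws tI hy.
exists (Num.min d1 (Num.min d2 d3)); first by rewrite !lt_min d10 d20.
move=> t' t'I; rewrite !lt_min => /and3P[t1 t2 t3] z.
have cdv : L2_circle (fun x => v t' x - v t x) by apply: circleB; exact: vc.
have cdw : L2_circle (fun x => w t' x - w t x) by apply: circleB; exact: wc.
rewrite cprod_diff; [|exact: vc|exact: vc|exact: wc|exact: wc].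
rewrite mul1r; apply: le_trans (ler_normD _ _) _.
have eh : 0 <= e / 2 by rewrite divr_ge0// ltW.
have -> : e = e / 2 + e / 2 by lra.
apply: lerD.
- apply: (cprod_le z cdv (wc t' t'I) (h1 t' t'I t1) (h3 t' t'I t3) eh).
  have hM : 2 * (1 + y) <= M by rewrite /M; lra.
  by have := ler_wpM2l (ltW em) hM; rewrite [X in _ <= X]mulrC ME.
- apply: (cprod_le z (vc t tI) cdw hx (h2 t' t'I t2) eh).
  have hM : x <= M by rewrite /M; lra.
  by have := ler_wpM2r (ltW em) hM; rewrite ME.
Qed.

Lemma ae_mono (P Q : R -> Prop) : (forall x, P x -> Q x) ->
  {ae mu, forall x, P x} -> {ae mu, forall x, Q x}.
Proof.
move=> PQ; apply: negligibleS => x nQ Px; exact/nQ/PQ.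
Qed.

Lemma ae_mono2 (P Q S : R -> Prop) : (forall x, P x -> Q x -> S x) ->
  {ae mu, forall x, P x} -> {ae mu, forall x, Q x} -> {ae mu, forall x, S x}.
Proof.
move=> PQS hP hQ; apply: negligibleS (negligibleU hP hQ) => x /= nS.
by have [Px|] := pselect (P x); [right=> Qx; exact/nS/PQS|left].
Qed.

Lemma integral01_ae_bound g p e : 0 <= e -> mfun g -> mfun p ->
  (forall x, `|p x| <= 1) -> {ae mu, forall x, `|g x| <= e} ->
  `|integral01 (fun x => g x * p x)| <= e.
Proof.
move=> e0 mg mp p1 ge.
have mc : mfun (fun x => clip e (g x)) by exact: clip_mfun.
(* Truncation at [e] changes [g] only on a null set and turns the almost everywhere bound into a
   pointwise one. *)
rewrite (_ : integral01 _ = integral01 (fun x => clip e (g x) * p x)); last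
    first.
  apply: integral01_ae; [exact: measurable_funM|exact: measurable_funM|].
  by apply: ae_mono ge => x /clip_id -> _.
have b x : `|clip e (g x) * p x| <= e.
  by rewrite normrM -[leRHS]mulr1 ler_pM// clip_le.
have i : integrable01 (fun x => clip e (g x) * p x).
  by apply: (integrable01_bnd (c := e)) => //; exact: measurable_funM.
apply: le_trans (norm_integral01 i) _; rewrite -[leRHS]integral01_cst.
by apply: le_integral01 => //; [exact: integrable01_norm|exact:
    integrable01_cst].
Qed.

(** * Time derivative of a solution *)

Section SolutionDerivative.
Variables (u : R -> R -> R) (u0 : R -> R) (bb : R -> R -> R).
Hypothesis T0 : 0 < T.
Hypothesis uc : circle_curve T u.
Hypothesis u0c : L2_circle u0.
Hypothesis bc : circle_curve T bb.
Hypothesis bunif : forall t, t \in I -> forall e, 0 < e ->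
  exists2 d, 0 < d & forall t', t' \in I -> `|t' - t| < d ->
    forall z, `|bb t' z - bb t z| <= e.
Hypothesis uE : forall t, t \in I ->
  {ae mu, forall x, u t x = u0 x - oriented_integral t (bb^~ x)}.

Definition opp_curve t x := - bb t x.

Lemma circle_opp_curve : circle_curve T opp_curve.
Proof.
move=> t tI; have := circleZ (-1) (bc tI).
by have -> : (fun x => -1 * bb t x) = opp_curve t by apply/funext => x; rewrite
    mulN1r.
Qed.

Lemma bb_continuous_on x : continuous_on (bb^~ x).
Proof.
move=> t tI e e0; have [d d0 hd] := bunif tI e0.
by exists d => // t' t'I t't; exact: hd.
Qed.

(** The exceptional null set depends on [t'], but [d] does not depend on [x], by the uniformity in
    [bunif]; integration against a mode then preserves the bound. *)
Lemma quotient_ae t e : t \in I -> 0 < e ->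
  exists2 d, 0 < d & forall t', t' \in I -> t' != t -> `|t' - t| < d ->
    {ae mu, forall x, `|(t' - t)^-1 * (u t' x - u t x) - opp_curve t x| <= e}.
Proof.
move=> tI e0; have [d d0 hd] := bunif tI e0.
exists d => // t' t'I t'N t't; apply: ae_mono2 (uE t'I) (uE tI) => x -> ->.
rewrite /opp_curve -normrN.
have -> : - ((t' - t)^-1 * (u0 x - oriented_integral t' (bb^~ x) -
     (u0 x - oriented_integral t (bb^~ x))) - - bb t x) =
   (t' - t)^-1 * (oriented_integral t' (bb^~ x) - oriented_integral t (bb^~ x))
       -
   bb t x by ring.
apply: oriented_integral_quotient => //; first exact: bb_continuous_on.
by move=> y yI yt; apply: hd => //; exact: le_lt_trans yt t't.
Qed.

Lemma derivative_on_cos_coef k : derivative_on (fun t => cos_coef (u t) k) (fun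
    t => cos_coef (opp_curve t) k).
Proof.
move=> t tI e e0; have [d d0 hd] := quotient_ae tI e0.
exists d => // t' t'I t'N t't.
rewrite -cos_coef_comb;
    [|exact/circle_integrable01/uc|exact/circle_integrable01/uc|exact/circle_integrable01/circle_opp_curve].
apply: integral01_ae_bound; [exact: ltW| | | |exact: hd]; last 2 first.
- by apply: cont_mfun; exact: cos_mode_cont.
- by move=> x; exact: cos_mode_le1.
apply: mfun_T; apply: circle_mfunT; apply: circleB; last exact:
    circle_opp_curve.
by apply: circleZ; apply: circleB; exact: uc.
Qed.

Lemma derivative_on_sin_coef k : derivative_on (fun t => sin_coef (u t) k) (fun
    t => sin_coef (opp_curve t) k).
Proof.
move=> t tI e e0; have [d d0 hd] := quotient_ae tI e0.
exists d => // t' t'I t'N t't.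
rewrite -sin_coef_comb;
    [|exact/circle_integrable01/uc|exact/circle_integrable01/uc|exact/circle_integrable01/circle_opp_curve].
apply: integral01_ae_bound; [exact: ltW| | | |exact: hd]; last 2 first.
- by apply: cont_mfun; exact: sin_mode_cont.
- by move=> x; exact: sin_mode_le1.
apply: mfun_T; apply: circle_mfunT; apply: circleB; last exact:
    circle_opp_curve.
by apply: circleZ; apply: circleB; exact: uc.
Qed.

(* The mean value theorem is applied to the linear combination of Fourier
   coefficients whose weights are the coefficients of the error itself, so that
   the left-hand side becomes the squared norm of the error. *)
Lemma sobolev_deriv_solution r : sobolev_cont T r opp_curve -> sobolev_deriv T
    r u opp_curve.
Proof.
move=> hb t tI e e0; have [d d0 hd] := hb t tI e e0.
exists d => // t' t'I t'N t't S uS.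
set c := (t' - t)^-1.
pose P k := c * (cos_coef (u t') k - cos_coef (u t) k) - cos_coef (opp_curve t)
    k.
pose Q k := c * (sin_coef (u t') k - sin_coef (u t) k) - sin_coef (opp_curve t)
    k.
have iu y : y \in I -> integrable01 (u y) by move=> ?;
    exact/circle_integrable01/uc.
have ib y : y \in I -> integrable01 (opp_curve y) by move=> ?;
    exact/circle_integrable01/circle_opp_curve.
under eq_bigr => k _.
  rewrite amp_sqr cos_coef_comb ?sin_coef_comb; [|exact: iu|exact: iu|exact:
      ib|exact: iu|exact: iu|exact: ib].
  rewrite -/(P k) -/(Q k); over.
have hder : derivative_on
    (fun y => \sum_(k <- S) weight R k `^ r * (P k * cos_coef (u y) k + Q k *
        sin_coef (u y) k))
    (fun y => \sum_(k <- S) weight R k `^ r * (P k * cos_coef (opp_curve y) k +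
        Q k * sin_coef (opp_curve y) k)).
  apply: (@derivative_on_sum S (fun k => weight R k `^ r)
    (fun k y => P k * cos_coef (u y) k + Q k * sin_coef (u y) k)
    (fun k y => P k * cos_coef (opp_curve y) k + Q k * sin_coef (opp_curve y)
        k)) => k.
  by apply: derivative_on_lin; [exact: derivative_on_cos_coef|exact:
      derivative_on_sin_coef].
(* The intermediate time [y] depends on [S], but [d] does not, so the final bound is uniform in
   [S]. *)
have [y [yI yt E]] := mvt_eps hder tI t'I t'N.
have {}E : \sum_(k <- S) weight R k `^ r * (P k * (c * (cos_coef (u t') k -
    cos_coef (u t) k)) +
      Q k * (c * (sin_coef (u t') k - sin_coef (u t) k))) =
    \sum_(k <- S) weight R k `^ r * (P k * cos_coef (opp_curve y) k + Q k *
        sin_coef (opp_curve y) k).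
  have tt : t' - t != 0 by rewrite subr_eq0.
  apply: (mulIf tt); rewrite -E -sumrB mulr_suml; apply: eq_bigr => k _.
  rewrite -[RHS]mul1r -(mulVf tt) -/c; ring.
have hs := hd y yI (le_lt_trans yt t't) S uS.
have {}hs : \sum_(k <- S) weight R k `^ r * ((cos_coef (opp_curve y) k -
    cos_coef (opp_curve t) k) ^+ 2 +
    (sin_coef (opp_curve y) k - sin_coef (opp_curve t) k) ^+ 2) <= e.
  apply: le_trans hs; rewrite le_eqVlt; apply/orP; left; apply/eqP.
  apply: eq_bigr => k _; rewrite amp_sqr.
  have -> : (fun x => opp_curve y x - opp_curve t x) = (fun x => -1 * opp_curve
      t x + opp_curve y x).
    by apply/funext => ?; ring.
  by rewrite cos_coef_lin ?sin_coef_lin; [ring|exact: ib..].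
(* With [z] the error and [w] the increment of [opp_curve] from [t] to [y], the identity [E] says
   that [|z|^2] is the inner product of [z] and [w]; hence [2 |z|^2 <= |z|^2 + |w|^2]. *)
have key : 2 * (\sum_(k <- S) weight R k `^ r * (P k ^+ 2 + Q k ^+ 2)) <=
   (\sum_(k <- S) weight R k `^ r * (P k ^+ 2 + Q k ^+ 2)) +
   \sum_(k <- S) weight R k `^ r * ((cos_coef (opp_curve y) k - cos_coef
       (opp_curve t) k) ^+ 2 +
    (sin_coef (opp_curve y) k - sin_coef (opp_curve t) k) ^+ 2).
  apply: (@le_trans _ _ (2 * \sum_(k <- S) weight R k `^ r *
     (P k * (cos_coef (opp_curve y) k - cos_coef (opp_curve t) k) + Q k *
         (sin_coef (opp_curve y) k - sin_coef (opp_curve t) k)))).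
    rewrite le_eqVlt; apply/orP; left; apply/eqP; congr (_ * _).
    transitivity (\sum_(k <- S) weight R k `^ r * (P k * (c * (cos_coef (u t')
        k - cos_coef (u t) k)) +
      Q k * (c * (sin_coef (u t') k - sin_coef (u t) k))) -
      \sum_(k <- S) weight R k `^ r * (P k * cos_coef (opp_curve t) k + Q k *
          sin_coef (opp_curve t) k)).
      rewrite -sumrB; apply: eq_bigr => k _.
      rewrite (_ : c * (cos_coef (u t') k - cos_coef (u t) k) = P k + cos_coef
          (opp_curve t) k); last first.
        by rewrite /P subrK.
      rewrite (_ : c * (sin_coef (u t') k - sin_coef (u t) k) = Q k + sin_coef
          (opp_curve t) k); last first.
        by rewrite /Q subrK.
      by ring.
    by rewrite E -sumrB; apply: eq_bigr => k _; ring.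
  rewrite mulr_sumr -big_split /=; apply: ler_sum => k _.
  move: (cos_coef (opp_curve y) k - cos_coef (opp_curve t) k) (sin_coef
      (opp_curve y) k - sin_coef (opp_curve t) k) => p q.
  have h1 : 2 * (P k * p + Q k * q) <= P k ^+ 2 + Q k ^+ 2 + (p ^+ 2 + q ^+ 2).
    by have := sqr_ge0 (P k - p); have := sqr_ge0 (Q k - q); lra.
  by have := ler_wpM2l (powR_ge0 (weight R k) r) h1; lra.
lra.
Qed.

(** An increment of [u] is [t' - t] times the sum of the quotient's error and [opp_curve t], both in
    [H^r], even if [u] itself is not known to be. *)
Lemma increment_sobolev r : sobolev_bounded T r opp_curve -> sobolev_deriv T r
    u opp_curve ->
  forall t, t \in I -> exists2 d, 0 < d & exists2 X, 0 <= X &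
  forall t', t' \in I -> `|t' - t| < d ->
    sobolev_bound r (fun x => u t' x - u t x) ((t' - t) ^+ 2 * X).
Proof.
move=> hb hd t tI; have [x hx] := hb t tI; have x0 := sobolev_ge0 hx.
have [d d0 h] := hd t tI 1 ltr01.
exists d => //; exists (4 * (1 + x)); first by lra.
move=> t' t'I t't.
have [->|t'N] := eqVneq t' t.
  rewrite (_ : (fun x => u t x - u t x) = fun=> 0); last first.
    by apply/funext => z; rewrite subrr.
  by apply: sobolev_bound0; rewrite subrr expr0n mul0r.
have hq := h t' t'I t'N t't.
have tt : t' - t != 0 by rewrite subr_eq0.
have cu : L2_circle (fun x => u t' x - u t x) by apply: circleB; exact: uc.
have cq := circleB (circleZ (t' - t)^-1 cu) (circle_opp_curve tI).
have h1 := sobolev_lin 1 (circle_integrable01 cq) (circle_integrable01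
    (circle_opp_curve tI)) hq hx.
have h2 := sobolev_lin (t' - t) (circle_integrable01 (circle_lin 1 cq
    (circle_opp_curve tI)))
  (circle_integrable01 (circle_cst 0)) h1 (sobolev_bound0 r (lexx 0)).
have E : (fun z => (t' - t) * (1 * ((t' - t)^-1 * (u t' z - u t z) - opp_curve
    t z) + opp_curve t z) + 0) =
   (fun x => u t' x - u t x).
  by apply/funext => z; rewrite mul1r subrK mulVKf// addr0.
rewrite E in h2; apply: sobolev_weak h2; rewrite expr1n; lra.
Qed.

(* That [u t - u0] lies in [H^r] is a locally constant property of [t], so the
   indicator function [ind] has derivative zero; the property holds at [t = 0].
       *)
Lemma Ck_function_curve_increment r n : Ck_function_curve T r n opp_curve ->
    Ck_function_curve T r n.+1 (fun t x => u t x - u0 x).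
Proof.
move=> hn; have hb := Ck_function_curve_bounded hn; have hd :=
    sobolev_deriv_solution (Ck_function_curve_cont hn).
have inc := increment_sobolev hb hd.
have cu : circle_curve T (fun t x => u t x - u0 x).
  by move=> t tI; apply: circleB => //; exact: uc.
have E t t' : (fun x => (u t' x - u0 x) - (u t x - u0 x)) = (fun x => u t' x -
    u t x).
  by apply/funext => x; ring.
split => //.
- pose P t := exists x, sobolev_bound r (fun x => u t x - u0 x) x.
  have loc t : t \in I -> exists2 d, 0 < d &
      forall t', t' \in I -> `|t' - t| < d -> P t <-> P t'.
    move=> tI; have [d d0 [X X0 h]] := inc t tI; exists d => // t' t'I t't.
    have h1 := h t' t'I t't.
    have ci : L2_circle (fun x => u t' x - u t x) by apply: circleB; exact: uc.
    split=> -[x hx].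
      exists (2 * (1 ^+ 2 * ((t' - t) ^+ 2 * X) + x)).
      rewrite (_ : (fun x => u t' x - u0 x) =
        (fun x => 1 * (u t' x - u t x) + (u t x - u0 x))); last first.
        by apply/funext => z; ring.
      by apply: sobolev_lin => //; apply: circle_integrable01 => //; exact: cu.
    exists (2 * ((-1) ^+ 2 * ((t' - t) ^+ 2 * X) + x)).
    rewrite (_ : (fun x => u t x - u0 x) =
      (fun x => -1 * (u t' x - u t x) + (u t' x - u0 x))); last first.
      by apply/funext => z; ring.
    by apply: sobolev_lin => //; apply: circle_integrable01 => //; exact: cu.
  pose ind t : R := (`[< P t >])%:R.
  have ider : derivative_on ind (fun=> 0).
    move=> t tI e e0; have [d d0 h] := loc t tI; exists d => // t' t'I t'N t't.
    have -> : ind t' = ind t.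
      by congr (nat_of_bool _)%:R; apply/asboolP/asboolP; apply h.
    by rewrite subrr mulr0 subr0 normr0 ltW.
  have zI : 0 \in I by rewrite in_itv/= oppr_le0 (ltW T0).
  (* At time 0 the integral is over a single point, so [u 0] and [u0] agree almost everywhere and
     have the same coefficients. *)
  have P0 : P 0.
    exists 0; apply: (@eq_sobolev _ _ (fun=> 0)); last exact: sobolev_bound0.
    - move=> k; apply: integral01_ae.
      + exact: (integrable01_meas (integrable01_cos_mode k (@integrable01_cst R
          0))).
      + exact: (integrable01_meas (integrable01_cos_mode k (circle_integrable01
          (cu _ zI)))).
      apply: ae_mono (uE zI) => x -> _.
      by rewrite /oriented_integral lexx set_itv1 Rintegral_set1 subr0 subrr.
    - move=> k; apply: integral01_ae.
      + exact: (integrable01_meas (integrable01_sin_mode k (@integrable01_cst R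
          0))).
      + exact: (integrable01_meas (integrable01_sin_mode k (circle_integrable01
          (cu _ zI)))).
      apply: ae_mono (uE zI) => x -> _.
      by rewrite /oriented_integral lexx set_itv1 Rintegral_set1 subr0 subrr.
  move=> t tI; have [->//|t0] := eqVneq t 0.
  (* If the property failed at [t], the mean value theorem would give [0 - 1 = 0]. *)
  have [y [_ _]] := mvt_eps ider zI tI t0.
  rewrite mul0r /ind (asboolT P0); case: asboolP => // _ /eqP.
  by rewrite sub0r oppr_eq0 oner_eq0.
- move=> t tI e e0; have [d d0 [X X0 h]] := inc t tI.
  have m0 : 0 < e / (1 + X) by rewrite divr_gt0// ltr_pwDl.
  (* The bound 1 gives [(t' - t)^2 <= |t' - t|]. *)
  exists (Num.min d (Num.min 1 (e / (1 + X)))); first by rewrite !lt_min d0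
      ltr01.
  move=> t' t'I; rewrite !lt_min => /and3P[t1 t2 t3]; rewrite E.
  apply: sobolev_weak (h t' t'I t1).
  have : (t' - t) ^+ 2 <= e / (1 + X).
    rewrite -(real_normK (num_real _)) expr2 -[leRHS]mulr1.
    by apply: ler_pM => //; exact: ltW.
  move/(ler_wpM2r X0) => hX; apply: le_trans hX _.
  rewrite mulrAC ler_pdivrMr ?ltr_pwDl//.
  by apply: ler_wpM2l; [exact: ltW|rewrite lerDr].
exists opp_curve => // t tI e e0; have [d d0 h] := hd t tI e e0.
exists d => // t' t'I t'N t't; have := h t' t'I t'N t't.
have -> // : (fun x => (t' - t)^-1 * (u t' x - u0 x - (u t x - u0 x)) -
    opp_curve t x) =
  (fun x => (t' - t)^-1 * (u t' x - u t x) - opp_curve t x).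
by apply/funext => x; congr (_ * _ - _); ring.
Qed.

End SolutionDerivative.
End TimeDerivative.

(** * Regularity of solutions *)

Section Regularity.
Variable R : realType.
Local Notation mu := (@lebesgue_measure R).

Lemma continuous_curve_sobolev (r T : R) (u : R -> R -> R) : circle_curve T u ->
  continuous_curve r T (fun t => distr_of (u t)) ->
  sobolev_bounded T r u /\ sobolev_cont T r u.
Proof.
move=> uc hu; split=> t tI; first by have [/sobolev_inH h _] := hu t tI.
move=> e e0; have [_] := hu t tI.
move=> /(cvge0P _ (fun t => Hnorm_ge0 r _)) /(_ (Num.sqrt e)).
rewrite sqrtr_gt0 => /(_ e0)/near_withinP[d d0 hd].
exists d => // t' t'I t't; have := weighted_bound_Hnorm (sqrtr_ge0 e) (hd t'
    t'I t't).
rewrite sqr_sqrtr ?(ltW e0)//; apply: weighted_bound_ext => k.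
have -> : (fun phi => distr_of (u t') phi - distr_of (u t) phi) =
    (fun phi => -1 * distr_of (u t) phi + distr_of (u t') phi).
  by apply/funext => phi; rewrite mulN1r addrC.
rewrite fourier_sqr_lin; [|exact: uc|exact: uc]; congr (amp _ k ^+ 2).
by apply/funext => x; rewrite mulN1r addrC.
Qed.

Lemma solution_regularity (s T : R) (u0 : R -> R) (u : R -> R -> R) :
  0 <= s -> 0 < T -> L2_circle u0 -> solution s T u0 u ->
  forall r, r <= s + 1 -> 2 * (r - 1) < 4 * s - 1 ->
  forall n, Ck_function_curve T r n.+1 (fun t x => u t x - u0 x).
Proof.
move=> s0 T0 u0c [uc hu hE].
have [ub us] := continuous_curve_sobolev uc hu.
pose v t x := 2^-1 * u t x + 1.
pose bb t := cprod (v t) (u t).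
have vc : circle_curve T v.
  by move=> t tI; apply: circle_lin; [exact: uc|exact: circle_cst].
have bc : circle_curve T bb.
  by move=> t tI; apply: circle_cprod; [exact: vc|exact: uc].
have uE t : t \in `[- T, T] ->
    {ae mu, forall x, u t x = u0 x - oriented_integral t (bb^~ x)}.
  move=> tI; apply: ae_mono (hE t tI) => x ->.
  congr (_ - oriented_integral t _); apply/funext => t'.
  congr (dxG_conv _ x); apply/funext => y.
  by rewrite /v; field.
have Cv r n : Ck_function_curve T r n u -> Ck_function_curve T r n v.
  by move=> h; apply: Ck_function_curve_lin h (Ck_function_curve_cst T n
      (circle_cst 1) (sobolev_bound1 r)).
have Cdb r n : r <= s + 1 -> 2 * (r - 1) < 4 * s - 1 -> Ck_function_curve T s n
    u ->
    Ck_function_curve T r n (opp_curve bb).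
  move=> rs r4 h; have hp := Ck_function_curve_prod s0 rs r4 (Cv s n h) h.
  have := Ck_function_curve_lin (-1) hp (Ck_function_curve_cst T n (circle_cst
      0) (sobolev_bound0 r (lexx 0))).
  by apply: Ck_function_curve_ext => t x; rewrite /opp_curve mulN1r addr0.
have C0 : Ck_function_curve T s 0 u by [].
(* The uniform continuity in time of [bb] is an L2 matter: only order 0 of the assumed regularity is
   needed for it. *)
have w0 w : sobolev_bounded T s w -> sobolev_bounded T 0 w.
  by move=> h t /h[x hx]; exists x; exact: sobolev_le hx.
have w1 w : sobolev_cont T s w -> sobolev_cont T 0 w.
  move=> h t tI e e0; have [d d0 hd] := h t tI e e0; exists d => // t' t'I t't.
  exact: sobolev_le (hd t' t'I t't).
have bunif : forall t, t \in `[- T, T] -> forall e, 0 < e ->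
    exists2 d, 0 < d & forall t', t' \in `[- T, T] -> `|t' - t| < d ->
      forall z, `|bb t' z - bb t z| <= e.
  have vk := Cv s 0%N C0.
  apply: cprod_unif => //; [apply: w0|exact: w0|apply: w1|exact: w1].
    exact: Ck_function_curve_bounded vk.
  exact: Ck_function_curve_cont vk.
have Cu n : Ck_function_curve T s n u.
  elim: n => [//|n ih]; split => //.
  (* The bootstrap runs at order [s] itself, because products are estimated from factors in [H^s];
     the gain to order [r] is taken once, at the end. *)
  have ss : s <= s + 1 by lra.
  have s4 : 2 * (s - 1) < 4 * s - 1 by lra.
  have hdb := Cdb s n ss s4 ih.
  exists (opp_curve bb) => //.
  exact: (sobolev_deriv_solution T0 uc bc bunif uE (Ck_function_curve_cont
      hdb)).
move=> r rs r4 n.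
exact: (Ck_function_curve_increment T0 uc u0c bc bunif uE (Cdb r n rs r4 (Cu
    n))).
Qed.

End Regularity.

Unset Implicit Arguments.

Theorem theorem1p16 (R : realType) (s T : R) (u0 : R -> R) (u : R -> R -> R)
    (hs : 0 <= s) (hT : 0 < T)
    (hu0L2 : L2_circle u0) (hu0 : inH s (distr_of u0))
    (hu : solution s T u0 u) :
  (s <= 2^-1 ->
     forall r : R, r < 2 * s + 2^-1 ->
       Cinfty_curve r T (fun t => distr_of (fun x => u t x - u0 x))) /\
  (2^-1 < s ->
     Cinfty_curve (s + 1) T (fun t => distr_of (fun x => u t x - u0 x))).
Proof.
have reg := solution_regularity hs hT hu0L2 hu.
(* If [s <= 1/2], then [r < 2 s + 1/2] implies [r <= s + 1], and is itself the summability
   condition; for [r = s + 1] that condition reads [1/2 < s]. *)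
split=> [s2 r hr|s2] n; apply: Ck_function_curve_Ck_curve; apply: Ck_function_curve_pred; apply: reg; lra.
Qed.
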